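(* Let $\varphi:\mathbb{D}\to\mathbb{D}$ be a parabolic holomorphic self-map of zero hyperbolic step with Denjoy–Wolff point $\tau\in\partial\mathbb{D}$ and Koenigs function $h_\varphi$. Let $\psi\in\mathcal{Z}_{\forall}(\varphi)$. The following two statements hold. (A) The following angular limit exists and equals the simultaneous linearization coefficient $c_{\varphi,\psi}$ of $\psi$ with respect to $\varphi$: $$\angle\lim_{z\to\tau}\frac{\psi(z)-z}{\varphi(z)-z}=c_{\varphi,\psi}.$$ (B) Suppose that $$h\circ\varphi=h+c_1,\qquad h\circ\psi=h+c_2,$$ for some holomorphic function $h:\mathbb{D}\to\mathbb{C}$ and some $c_1,c_2\in\mathbb{C}$ with $|c_1|^2+|c_2|^2\neq0$. Then $c_1\neq0$ and $c_2/c_1=c_{\varphi,\psi}$.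
   Context: $\mathbb{D}=\{z\in\mathbb{C}:|z|<1\}$, and $\rho_{\mathbb{D}}$ denotes the hyperbolic distance in $\mathbb{D}$. The centralizer of $\varphi$ is $\mathcal{Z}_{\forall}(\varphi)=\{\psi:\mathbb{D}\to\mathbb{D}\text{ holomorphic}:\psi\circ\varphi=\varphi\circ\psi\}$. The symbol $\angle\lim$ denotes the angular (non-tangential) limit. A holomorphic self-map $\varphi$ of $\mathbb{D}$ is parabolic if its iterates converge locally uniformly to a point $\tau\in\partial\mathbb{D}$ (its Denjoy–Wolff point) and the angular derivative satisfies $\varphi'(\tau)=1$. It is of zero hyperbolic step if $\lim_{n\to\infty}\rho_{\mathbb{D}}(\varphi^{\circ n}(z),\varphi^{\circ(n+1)}(z))=0$ for some (equivalently, all) $z\in\mathbb{D}$. Koenigs function (parabolic, zero hyperbolic step): $h_\varphi$ is the unique holomorphic function $h:\mathbb{D}\to\mathbb{C}$ with $h(0)=0$ such that $h\circ\varphi=h+1$, $\mathbb{C}=\bigcup_{n\ge0}(h(\mathbb{D})-n)$, and $h$ is injective on some $\varphi$-absorbing domain, i.e. a domain $V\subset\mathbb{D}$ with $\varphi(V)\subset V$ and $\mathbb{D}=\bigcup_{n\in\mathbb{N}}(\varphi^{\circ n})^{-1}(V)$. Simultaneous linearization coefficient: for $\varphi$ parabolic of zero hyperbolic step and $\psi\in\mathcal{Z}_{\forall}(\varphi)$, the function $h_\varphi\circ\psi-h_\varphi$ is constant; $c_{\varphi,\psi}\in\mathbb{C}$ denotes this constant, so $h_\varphi\circ\psi=h_\varphi+c_{\varphi,\psi}$.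 *)

(* Defs.v *)
From Stdlib Require Import Reals Arith.
From Coquelicot Require Import Coquelicot.

Open Scope R_scope.

(* Functions on the disc are total functions C -> C; all conditions on them are
   restricted to the disc, and their values outside it are irrelevant. *)
Definition unit_disc (z : C) : Prop := Cmod z < 1.

Definition holomorphic_on (U : C -> Prop) (f : C -> C) : Prop :=
  forall z, U z -> @ex_derive C_AbsRing C_NormedModule f z.

Definition holomorphic_self_map (f : C -> C) : Prop :=
  holomorphic_on unit_disc f /\ (forall z, unit_disc z -> unit_disc (f z)).

(* Half the logarithm, i.e. the metric |dz| / (1 - |z|^2) of curvature -4; the
   other usual normalization is twice this one. *)
Definition hyp_dist (z w : C) : R :=
  let t := Cmod ((z - w) / (1 - Cconj w * z))%C in
  / 2 * ln ((1 + t) / (1 - t)).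

Definition stolz (tau : C) (M : R) (z : C) : Prop :=
  unit_disc z /\ Cmod (tau - z)%C < M * (1 - Cmod z).

Definition angular_lim (f : C -> C) (tau l : C) : Prop :=
  forall M : R, 1 < M ->
    filterlim f (within (stolz tau M) (@locally C_UniformSpace tau))
                (@locally C_UniformSpace l).

Definition angular_derivative (f : C -> C) (tau d : C) : Prop :=
  angular_lim (fun z => (f z - tau) / (z - tau))%C tau d.

Definition iterates_cv_loc_unif (f : C -> C) (tau : C) : Prop :=
  forall z, unit_disc z ->
    exists r : posreal, forall eps : posreal, exists N : nat,
      forall (n : nat) (w : C), (N <= n)%nat -> unit_disc w -> Cmod (w - z)%C < r ->
        Cmod (Nat.iter n f w - tau)%C < eps.

(* [parabolic f tau]: f is parabolic and tau is its Denjoy-Wolff point. *)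
Definition parabolic (f : C -> C) (tau : C) : Prop :=
  holomorphic_self_map f /\ Cmod tau = 1 /\
  iterates_cv_loc_unif f tau /\ angular_derivative f tau 1.

Definition zero_hyperbolic_step (f : C -> C) : Prop :=
  exists z, unit_disc z /\
    is_lim_seq (fun n => hyp_dist (Nat.iter n f z) (Nat.iter (S n) f z)) 0.

Definition centralizer (f g : C -> C) : Prop :=
  holomorphic_self_map g /\ (forall z, unit_disc z -> g (f z) = f (g z)).

Definition connected (V : C -> Prop) : Prop :=
  forall A B : C -> Prop,
    @open C_UniformSpace A -> @open C_UniformSpace B ->
    (forall z, V z -> A z \/ B z) ->
    (exists z, V z /\ A z) -> (exists z, V z /\ B z) ->
    exists z, V z /\ A z /\ B z.

Definition domain (V : C -> Prop) : Prop :=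
  @open C_UniformSpace V /\ (exists z, V z) /\ connected V.

Definition absorbing_domain (f : C -> C) (V : C -> Prop) : Prop :=
  domain V /\ (forall z, V z -> unit_disc z) /\ (forall z, V z -> V (f z)) /\
  (forall z, unit_disc z -> exists n : nat, V (Nat.iter n f z)).

Definition inj_on (V : C -> Prop) (f : C -> C) : Prop :=
  forall z w, V z -> V w -> f z = f w -> z = w.

(* The properties characterizing the Koenigs function of f, for f parabolic of
   zero hyperbolic step; they determine h uniquely on the disc. *)
Definition is_koenigs (f h : C -> C) : Prop :=
  holomorphic_on unit_disc h /\ h 0 = 0 /\
  (forall z, unit_disc z -> h (f z) = (h z + 1)%C) /\
  (forall w : C, exists (n : nat) (z : C), unit_disc z /\ w = (h z - INR n)%C) /\
  (exists V, absorbing_domain f V /\ inj_on V h).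

(* c is the value of the constant h o g - h, where h is the Koenigs function
   of f and g is in the centralizer of f. *)
Definition is_linearization_coeff (h g : C -> C) (c : C) : Prop :=
  forall z, unit_disc z -> h (g z) = (h z + c)%C.

(* Main.v *)
(** Idea. The Cayley transform sending tau to infinity turns phi into a self-map Phi of
    the right half-plane H. Since phi'(tau) = 1, Julia's lemma says that p(w) = Phi(w) - w
    maps H into its closure, so the Schwarz-Pick inequality applies to p as well as to Phi
    and to the conjugate Psi of psi. Put sigma(w) = |p(w)| / Re w.
    - Hyperbolic steps do not grow under maps commuting with Phi, so sigma stays small along
      orbits and at Psi(w) when it is small at w; and Schwarz-Pick for p makes Phi injective
      where sigma < 1. Hence the Koenigs function k is injective where sigma <= 1/3.
    - In the coordinate w = z + p(z) t the map Phi is close to t -> t + 1 for |t| << 1 / sigma(z),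
      and F(t) = k(z + p(z) t) - k(z) satisfies F(0) = 0, F(1) = 1. By injectivity, F omits
      s + 1 on small boxes where it takes s, so a Bloch argument bounds its oscillation at
      unit scale; hence F grows linearly on a box of size 1 / sigma(z), and interpolation
      at 0 and 1 gives F(t) = t + O(sigma(z)) for bounded t.
    - In a Stolz angle sigma tends to 0, and there k takes the value k(z) + c at a point
      z + p(z) (c + o(1)), which is Psi(z) by injectivity. This is (A).
    - For (B), h - c1 k read in the coordinate k is 1-periodic and picks up c2 - c1 c under
      the translation by c; its mean over a period does not depend on the height, so
      c2 = c1 c. Points where sigma is small exist by zero hyperbolic step.
    The complex analysis needed (maximum principle, Schwarz lemma with one or two nodes)
    comes from Goursat's theorem on rectangles. *)

Require Import Defs.
From Stdlib Require Import Reals Lra Lia Psatz Classical ClassicalEpsilon.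
From Coquelicot Require Import Coquelicot.
Local Open Scope C_scope.

(** * Complex differentiability *)

(** Nothing is known in advance about the size or the derivative of the Koenigs function; all
    control over it comes from injectivity. Equal values of [k] at two points only say that the
    orbits of these points eventually meet, because iterates enter the absorbing domain; where steps
    are small, [Phi] is injective and the iterates can be cancelled one at a time. The function
    theory is kept elementary. Squares and rectangles take the place of discs, as Goursat's theorem
    is proved for them. A crude bound of an interior value by the boundary maximum stands in for
    Cauchy's formula, and Landau's trick of taking high powers removes its constant. Derivatives are
    replaced by secant slopes, and Taylor remainders by interpolation errors at one or two nodes,
    which the maximum principle bounds. The quotient in (A) is not invariant under the Cayley
    transform: it acquires the factor (Phi w + 1) / (Psi w + 1). This factor tends to 1 in a Stolz
    angle because both displacements are small compared with Re w. *)

Definition ccont (f : C -> C) (z : C) : Prop :=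
  forall eps, (0 < eps)%R -> exists del, (0 < del)%R /\
    forall w, Cmod (w - z) < del -> Cmod (f w - f z) < eps.

(** Caratheodory's form of complex differentiability: [q] is the difference quotient, and [q z] is
    the derivative. Sum, product and chain rule become algebraic identities between the factors
    [q]. *)
Definition holo (f : C -> C) (z : C) : Prop :=
  exists q, ccont q z /\ forall w, f w = f z + q w * (w - z).

Lemma Cmod_sym (z w : C) : Cmod (z - w) = Cmod (w - z).
Proof. rewrite <- Cmod_opp. f_equal. ring. Qed.

Lemma Cmod_triangle_inv (z w : C) : (Cmod z - Cmod w <= Cmod (z - w))%R.
Proof.
  pose proof (Cmod_triangle (z - w) w) as H.
  replace (z - w + w) with z in H by ring. lra.
Qed.

Lemma Cmod_split (z w u : C) : (Cmod (z - u) <= Cmod (z - w) + Cmod (w - u))%R.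
Proof.
  replace (z - u) with ((z - w) + (w - u)) by ring. apply Cmod_triangle.
Qed.

Lemma Cmod_minus_le (z w : C) : (Cmod (z - w) <= Cmod z + Cmod w)%R.
Proof. unfold Cminus. rewrite <- (Cmod_opp w). apply Cmod_triangle. Qed.

Lemma Cmod_pos_neq (z w : C) : z <> w -> 0 < Cmod (z - w).
Proof.
  intros H. apply Cmod_gt_0. intros E. apply H.
  replace z with (z - w + w) by ring. rewrite E. ring.
Qed.

Lemma Cminus_neq0 (z w : C) : z <> w -> z - w <> 0.
Proof. intros H. apply Cmod_gt_0. now apply Cmod_pos_neq. Qed.

Lemma ccont_const (c z : C) : ccont (fun _ => c) z.
Proof.
  intros e He. exists 1%R. split; [lra|]. intros w _.
  replace (c - c) with (RtoC 0) by ring. now rewrite Cmod_0.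
Qed.

Lemma ccont_id (z : C) : ccont (fun w => w) z.
Proof. intros e He. exists e. auto. Qed.

Lemma ccont_plus (f g : C -> C) (z : C) :
  ccont f z -> ccont g z -> ccont (fun w => f w + g w) z.
Proof.
  intros Hf Hg e He.
  destruct (Hf (e / 2)%R) as [d1 [H1 K1]]; [lra|].
  destruct (Hg (e / 2)%R) as [d2 [H2 K2]]; [lra|].
  exists (Rmin d1 d2). split; [now apply Rmin_pos|]. intros w Hw.
  pose proof (Rmin_l d1 d2). pose proof (Rmin_r d1 d2).
  specialize (K1 w ltac:(lra)). specialize (K2 w ltac:(lra)).
  replace (f w + g w - (f z + g z)) with ((f w - f z) + (g w - g z)) by ring.
  pose proof (Cmod_triangle (f w - f z) (g w - g z)). lra.
Qed.

Lemma ccont_mult (f g : C -> C) (z : C) :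
  ccont f z -> ccont g z -> ccont (fun w => f w * g w) z.
Proof.
  intros Hf Hg e He.
  pose proof (Cmod_ge_0 (f z)) as Pf. pose proof (Cmod_ge_0 (g z)) as Pg.
  set (A := (Cmod (f z) + Cmod (g z) + 1)%R).
  assert (HA : 0 < e / (2 * A)) by (apply Rdiv_lt_0_compat; unfold A; lra).
  destruct (Hf (Rmin (e / (2 * A)) 1)) as [d1 [H1 K1]]; [apply Rmin_pos; lra|].
  destruct (Hg (e / (2 * A))%R) as [d2 [H2 K2]]; [lra|].
  exists (Rmin d1 d2). split; [now apply Rmin_pos|]. intros w Hw.
  pose proof (Rmin_l d1 d2). pose proof (Rmin_r d1 d2).
  specialize (K1 w ltac:(lra)). specialize (K2 w ltac:(lra)).
  pose proof (Rmin_l (e / (2 * A)) 1). pose proof (Rmin_r (e / (2 * A)) 1).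
  replace (f w * g w - f z * g z)
    with ((f w - f z) * (g w - g z) + f z * (g w - g z) + (f w - f z) * g z) by ring.
  eapply Rle_lt_trans; [apply Cmod_triangle|].
  eapply Rle_lt_trans; [apply Rplus_le_compat_r, Cmod_triangle|].
  rewrite !Cmod_mult.
  set (u := Cmod (f w - f z)) in *. set (v := Cmod (g w - g z)) in *.
  assert (0 <= u) by apply Cmod_ge_0. assert (0 <= v) by apply Cmod_ge_0.
  assert (e = 2 * A * (e / (2 * A)))%R by (field; unfold A; lra).
  set (t := (e / (2 * A))%R) in *.
  assert (u * v <= 1 * v)%R by (apply Rmult_le_compat_r; lra).
  assert (u * Cmod (g z) <= t * Cmod (g z))%R by (apply Rmult_le_compat_r; lra).
  assert (Cmod (f z) * v <= Cmod (f z) * t)%R by (apply Rmult_le_compat_l; lra).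
  unfold A in *. nra.
Qed.

Lemma ccont_inv (f : C -> C) (z : C) :
  ccont f z -> f z <> 0 -> ccont (fun w => / f w) z.
Proof.
  intros Hf Hz e He. apply Cmod_gt_0 in Hz as Pz.
  set (m := Cmod (f z)) in *.
  assert (0 < e * (m * m) / 2) by (apply Rdiv_lt_0_compat; [apply Rmult_lt_0_compat; nra|lra]).
  destruct (Hf (Rmin (m / 2) (e * (m * m) / 2))) as [d [Hd K]].
  { apply Rmin_pos; lra. }
  exists d. split; [exact Hd|]. intros w Hw. specialize (K w Hw).
  pose proof (Rmin_l (m / 2) (e * (m * m) / 2)).
  pose proof (Rmin_r (m / 2) (e * (m * m) / 2)).
  pose proof (Cmod_triangle_inv (f z) (f w)) as T. rewrite Cmod_sym in T. fold m in T.
  assert (Pw : 0 < Cmod (f w)) by lra.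
  assert (Hw0 : f w <> 0) by now apply Cmod_gt_0.
  replace (/ f w - / f z) with ((f z - f w) * (/ f w * / f z)) by (field; auto).
  rewrite !Cmod_mult, !Cmod_inv, Cmod_sym by auto. fold m.
  set (u := Cmod (f w)) in *. set (v := Cmod (f w - f z)) in *.
  replace (v * (/ u * / m))%R with (v / (u * m))%R by (field; lra).
  apply Rlt_div_l; [nra|]. nra.
Qed.

Lemma ccont_comp (f g : C -> C) (z : C) :
  ccont g z -> ccont f (g z) -> ccont (fun w => f (g w)) z.
Proof.
  intros Hg Hf e He. destruct (Hf e He) as [d [Hd K]].
  destruct (Hg d Hd) as [d' [Hd' K']]. exists d'. auto.
Qed.

Lemma ccont_ext_loc (f g : C -> C) (z : C) (r : R) :
  0 < r -> (forall w, Cmod (w - z) < r -> f w = g w) -> ccont f z -> ccont g z.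
Proof.
  intros Hr E Hf e He. destruct (Hf e He) as [d [Hd K]].
  exists (Rmin d r). split; [now apply Rmin_pos|]. intros w Hw.
  pose proof (Rmin_l d r). pose proof (Rmin_r d r).
  rewrite <- !E; [apply K; lra| |lra].
  replace (z - z) with (RtoC 0) by ring. now rewrite Cmod_0.
Qed.

Lemma holo_ccont (f : C -> C) (z : C) : holo f z -> ccont f z.
Proof.
  intros [q [Hq E]].
  apply (ccont_ext_loc (fun w => f z + q w * (w - z)) _ _ 1); [lra|intros; auto|].
  apply ccont_plus; [apply ccont_const|]. apply ccont_mult; [exact Hq|].
  apply ccont_plus; [apply ccont_id|apply ccont_const].
Qed.

Lemma holo_const (c z : C) : holo (fun _ => c) z.
Proof. exists (fun _ => 0). split; [apply ccont_const|]. intros; ring. Qed.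

Lemma holo_id (z : C) : holo (fun w => w) z.
Proof. exists (fun _ => 1). split; [apply ccont_const|]. intros; ring. Qed.

Lemma holo_plus (f g : C -> C) (z : C) :
  holo f z -> holo g z -> holo (fun w => f w + g w) z.
Proof.
  intros [q [Hq E]] [r [Hr F]]. exists (fun w => q w + r w).
  split; [now apply ccont_plus|]. intros w. rewrite (E w), (F w). ring.
Qed.

Lemma holo_mult (f g : C -> C) (z : C) :
  holo f z -> holo g z -> holo (fun w => f w * g w) z.
Proof.
  intros Hf Hg. pose proof (holo_ccont _ _ Hg) as Cg.
  destruct Hf as [q [Hq E]]. destruct Hg as [r [Hr F]].
  exists (fun w => q w * g w + f z * r w). split.
  - apply ccont_plus; apply ccont_mult; auto using ccont_const.
  - intros w.
    replace ((q w * g w + f z * r w) * (w - z))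
      with (q w * (w - z) * g w + f z * (r w * (w - z))) by ring.
    replace (q w * (w - z)) with (f w - f z) by (rewrite (E w); ring).
    replace (r w * (w - z)) with (g w - g z) by (rewrite (F w); ring). ring.
Qed.

Lemma holo_opp (f : C -> C) (z : C) : holo f z -> holo (fun w => - f w) z.
Proof.
  intros [q [Hq E]]. exists (fun w => (-(1)) * q w). split.
  - apply ccont_mult; auto using ccont_const.
  - intros w. rewrite (E w). ring.
Qed.

Lemma holo_minus (f g : C -> C) (z : C) :
  holo f z -> holo g z -> holo (fun w => f w - g w) z.
Proof. intros Hf Hg. apply holo_plus; [auto|now apply holo_opp]. Qed.

Lemma holo_comp (f g : C -> C) (z : C) :
  holo g z -> holo f (g z) -> holo (fun w => f (g w)) z.
Proof.
  intros Hg [q [Hq E]]. pose proof (holo_ccont _ _ Hg) as Cg.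
  destruct Hg as [r [Hr F]]. exists (fun w => q (g w) * r w). split.
  - apply ccont_mult; [now apply ccont_comp|auto].
  - intros w. rewrite (E (g w)). rewrite (F w) at 2. ring.
Qed.

Lemma holo_ext_loc (f g : C -> C) (z : C) (r : R) :
  0 < r -> (forall w, Cmod (w - z) < r -> f w = g w) -> holo f z -> holo g z.
Proof.
  intros Hr E [q [Hq F]].
  assert (Ez : f z = g z).
  { apply E. replace (z - z) with (RtoC 0) by ring. now rewrite Cmod_0. }
  (* The factorization has to hold for every [w], so [q] is corrected where [f] and [g] differ; the
     correction vanishes near [z] and leaves continuity there intact. *)
  exists (fun w => q w + (g w - f w) / (w - z)). split.
  - apply (ccont_ext_loc q _ _ r Hr); [|exact Hq].
    intros w Hw. rewrite (E w Hw). unfold Cdiv. ring.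
  - intros w. destruct (classic (w = z)) as [->|N]; [ring|].
    pose proof (Cminus_neq0 _ _ N).
    replace (g w) with (f w + (g w - f w)) by ring. rewrite (F w) at 1. rewrite Ez.
    field. auto.
Qed.

Lemma holo_inv (f : C -> C) (z : C) : holo f z -> f z <> 0 -> holo (fun w => / f w) z.
Proof.
  intros Hf Hz. pose proof (holo_ccont _ _ Hf) as Cf. apply Cmod_gt_0 in Hz as Pz.
  destruct (Cf _ Pz) as [d [Hd K]]. destruct Hf as [q [Hq E]].
  apply (holo_ext_loc
    (fun w => / f z + (- (q w * / f w * / f z)) * (w - z)) _ _ d Hd).
  - intros w Hw. specialize (K w Hw). rewrite Cmod_sym in K.
    pose proof (Cmod_triangle_inv (f z) (f w)).
    assert (f w <> 0).
    { apply Cmod_gt_0. pose proof (Cmod_triangle_inv (f z) (f z - f w)) as T.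
      replace (f z - (f z - f w)) with (f w) in T by ring. lra. }
    replace (/ f z + - (q w * / f w * / f z) * (w - z))
      with (/ f z - (q w * (w - z)) * (/ f w * / f z)) by ring.
    replace (q w * (w - z)) with (f w - f z) by (rewrite (E w); ring).
    field. auto.
  - exists (fun w => - (q w * / f w * / f z)). split.
    + apply (ccont_ext_loc (fun w => (-(1)) * (q w * / f w * / f z)) _ _ 1); [lra|intros; ring|].
      repeat apply ccont_mult; auto using ccont_const, ccont_inv.
    + intros w. ring.
Qed.

Lemma holo_div (f g : C -> C) (z : C) :
  holo f z -> holo g z -> g z <> 0 -> holo (fun w => f w / g w) z.
Proof. intros Hf Hg N. apply holo_mult; [auto|now apply holo_inv]. Qed.

Lemma holo_pow (f : C -> C) (z : C) (n : nat) : holo f z -> holo (fun w => f w ^ n) z.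
Proof.
  intros Hf. induction n; simpl; [apply holo_const|]. now apply holo_mult.
Qed.

Lemma ex_derive_holo (f : C -> C) (z : C) :
  @ex_derive C_AbsRing C_NormedModule f z -> holo f z.
Proof.
  intros [l [_ Hd]].
  specialize (Hd z (fun P HP => HP)).
  assert (K : forall eps, (0 < eps)%R -> exists del, (0 < del)%R /\ forall w,
    Cmod (w - z) < del -> (Cmod (f w - f z - (w - z) * l) <= eps * Cmod (w - z))%R).
  { intros e He. specialize (Hd (mkposreal e He)).
    destruct Hd as [d Hd]. exists d. split; [apply cond_pos|].
    intros w Hw. exact (Hd w Hw). }
  clear Hd.
  (* At [w = z] the numerator is 0, so the value is [l] whatever the inverse of 0 is. *)
  exists (fun w => l + (f w - f z - (w - z) * l) / (w - z)). split.
  - intros e He. destruct (K (e / 2)%R) as [d [Hd K1]]; [lra|].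
    exists d. split; [exact Hd|]. intros w Hw.
    replace (l + (f w - f z - (w - z) * l) / (w - z)
       - (l + (f z - f z - (z - z) * l) / (z - z)))
      with ((f w - f z - (w - z) * l) / (w - z)) by (unfold Cdiv; ring).
    destruct (classic (w = z)) as [->|N].
    + replace ((f z - f z - (z - z) * l) / (z - z)) with (RtoC 0) by (unfold Cdiv; ring).
      now rewrite Cmod_0.
    + rewrite Cmod_div by now apply Cminus_neq0.
      pose proof (Cmod_pos_neq _ _ N). specialize (K1 w Hw).
      apply Rle_lt_trans with (e / 2)%R; [|lra]. apply Rle_div_l; lra.
  - intros w. destruct (classic (w = z)) as [->|N]; [unfold Cdiv; ring|].
    field. now apply Cminus_neq0.
Qed.

(** * Goursat's theorem on rectangles *)

Definition cint (f : R -> C) (a b : R) : C := RInt (V := C_R_CompleteNormedModule) f a b.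
Definition ex_cint (f : R -> C) (a b : R) : Prop := ex_RInt (V := C_R_NormedModule) f a b.

Lemma ex_cint_cont (f : R -> C) (a b : R) :
  (forall x, Rmin a b <= x <= Rmax a b -> forall eps, (0 < eps)%R -> exists del, (0 < del)%R /\
     forall y, (Rabs (y - x) < del)%R -> Cmod (f y - f x) < eps) ->
  ex_cint f a b.
Proof.
  intros H. apply (ex_RInt_continuous (V := C_R_CompleteNormedModule)).
  intros x Hx P [e HP]. destruct (H x Hx e (cond_pos e)) as [d [Hd K]].
  exists (mkposreal d Hd). intros y Hy. apply HP. specialize (K y Hy).
  pose proof (Rmax_Cmod (f y - f x)) as M.
  pose proof (Rmax_l (Rabs (fst (f y - f x))) (Rabs (snd (f y - f x)))).
  pose proof (Rmax_r (Rabs (fst (f y - f x))) (Rabs (snd (f y - f x)))).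
  split; simpl; unfold ball; simpl; unfold AbsRing_ball, abs, minus, plus, opp; simpl.
  - unfold Cminus, Cplus, Copp in *; simpl in *. lra.
  - unfold Cminus, Cplus, Copp in *; simpl in *. lra.
Qed.

Lemma cint_bound (f : R -> C) (a b M : R) :
  a <= b -> ex_cint f a b -> (forall x, a <= x <= b -> Cmod (f x) <= M) ->
  (Cmod (cint f a b) <= (b - a) * M)%R.
Proof.
  intros Hab Hf HM. rewrite Cmod_norm.
  apply (norm_RInt_le_const (V := C_R_NormedModule) f a b); auto.
  - intros x Hx. eapply Rle_trans; [|exact (HM x Hx)]. rewrite Cmod_norm. apply Rle_refl.
  - apply (RInt_correct (V := C_R_CompleteNormedModule)). exact Hf.
Qed.

Lemma cint_plus (f g : R -> C) (a b : R) :
  ex_cint f a b -> ex_cint g a b ->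
  cint (fun x => f x + g x) a b = cint f a b + cint g a b.
Proof.
  intros Hf Hg. apply (RInt_plus (V := C_R_CompleteNormedModule) f g a b Hf Hg).
Qed.

Lemma cint_ext (f g : R -> C) (a b : R) :
  (forall x, Rmin a b <= x <= Rmax a b -> f x = g x) -> cint f a b = cint g a b.
Proof.
  intros H. apply (RInt_ext (V := C_R_CompleteNormedModule)). intros x Hx. apply H. lra.
Qed.

Lemma cint_chasles (f : R -> C) (a b c : R) :
  ex_cint f a b -> ex_cint f b c -> cint f a b + cint f b c = cint f a c.
Proof. apply (RInt_Chasles (V := C_R_CompleteNormedModule) f a b c). Qed.

Lemma cint_shift (f : R -> C) (v a b : R) :
  ex_cint f (a + v) (b + v) -> cint (fun x => f (x + v)%R) a b = cint f (a + v) (b + v).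
Proof.
  intros H. pose proof (RInt_comp_lin (V := C_R_CompleteNormedModule) f 1 v a b) as K.
  rewrite !Rmult_1_l in K. unfold cint. rewrite <- (K H).
  apply (RInt_ext (V := C_R_CompleteNormedModule)). intros x _.
  rewrite Rmult_1_l. symmetry. apply (scal_one (V := C_R_NormedModule)).
Qed.

Lemma is_RInt_lin (p q a b : R) :
  is_RInt (fun x => p + q * x)%R a b (p * (b - a) + q * ((b ^ 2 - a ^ 2) / 2))%R.
Proof.
  replace (p * (b - a) + q * ((b ^ 2 - a ^ 2) / 2))%R
    with (minus (p * b + q * (b ^ 2 / 2)) (p * a + q * (a ^ 2 / 2)))%R
    by (unfold minus, plus, opp; simpl; field).
  apply (is_RInt_derive (fun x => p * x + q * (x ^ 2 / 2))%R).
  - intros x _. auto_derive; [easy|]. field.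
  - intros x _. apply (ex_derive_continuous (fun x => p + q * x)%R).
    auto_derive. easy.
Qed.

Lemma cint_pair (f : R -> C) (a b u v : R) :
  is_RInt (fun x => fst (f x)) a b u -> is_RInt (fun x => snd (f x)) a b v ->
  cint f a b = (u, v).
Proof.
  intros Hu Hv. apply (is_RInt_unique (V := C_R_CompleteNormedModule)).
  now apply (is_RInt_fct_extend_pair (U := R_NormedModule) (V := R_NormedModule)).
Qed.

Lemma cint_snd (f : R -> C) (a b : R) :
  ex_cint f a b -> snd (cint f a b) = RInt (fun x => snd (f x)) a b.
Proof.
  intros Hf. symmetry. apply is_RInt_unique.
  apply (is_RInt_fct_extend_snd (U := R_NormedModule) (V := R_NormedModule)).
  apply (RInt_correct (V := C_R_CompleteNormedModule)). exact Hf.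
Qed.

Lemma ex_cint_snd (f : R -> C) (a b : R) :
  ex_cint f a b -> ex_RInt (fun x => snd (f x)) a b.
Proof. apply (ex_RInt_fct_extend_snd (U := R_NormedModule) (V := R_NormedModule)). Qed.

Lemma cint_fst (f : R -> C) (a b : R) :
  ex_cint f a b -> fst (cint f a b) = RInt (fun x => fst (f x)) a b.
Proof.
  intros Hf. symmetry. apply is_RInt_unique.
  apply (is_RInt_fct_extend_fst (U := R_NormedModule) (V := R_NormedModule)).
  apply (RInt_correct (V := C_R_CompleteNormedModule)). exact Hf.
Qed.

Lemma ex_cint_fst (f : R -> C) (a b : R) :
  ex_cint f a b -> ex_RInt (fun x => fst (f x)) a b.
Proof. apply (ex_RInt_fct_extend_fst (U := R_NormedModule) (V := R_NormedModule)). Qed.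
Lemma cint_point (f : R -> C) (a : R) : cint f a a = 0.
Proof. apply (RInt_point (V := C_R_CompleteNormedModule)). Qed.

Lemma cint_const (c : C) (a b : R) : cint (fun _ => c) a b = (b - a)%R * c.
Proof.
  destruct c as [c1 c2].
  replace ((b - a)%R * (c1, c2)) with ((scal (b - a) c1, scal (b - a) c2)%R : C).
  - apply cint_pair; simpl; apply (is_RInt_const (V := R_NormedModule)).
  - unfold RtoC, Cmult, scal; simpl. unfold mult; simpl. f_equal; ring.
Qed.

Lemma ex_cint_const (c : C) (a b : R) : ex_cint (fun _ => c) a b.
Proof. apply (ex_RInt_const (V := C_R_NormedModule)). Qed.

Opaque cint ex_cint.

(** * Integrals over the boundary of a rectangle, taken counterclockwise *)

Definition contour_int (f : C -> C) (a b c d : R) : C :=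
  cint (fun x => f (x, c)) a b - cint (fun x => f (x, d)) a b
  + Ci * (cint (fun y => f (b, y)) c d - cint (fun y => f (a, y)) c d).

Lemma ccont_row (f : C -> C) (a b y : R) :
  (forall x, Rmin a b <= x <= Rmax a b -> ccont f (x, y)) -> ex_cint (fun x => f (x, y)) a b.
Proof.
  intros H. apply ex_cint_cont. intros x Hx e He.
  destruct (H x Hx e He) as [d [Hd K]]. exists d. split; [exact Hd|].
  intros x' Hx'. apply K.
  replace ((x', y) - (x, y)) with (RtoC (x' - x)) by
    (unfold RtoC, Cminus, Cplus, Copp; simpl; f_equal; ring).
  now rewrite Cmod_R.
Qed.

Lemma Cmod_im (y : R) : Cmod (0%R, y) = Rabs y.
Proof.
  unfold Cmod; simpl. replace (0 * (0 * 1) + y * (y * 1))%R with (Rsqr y) by (unfold Rsqr; ring).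
  apply sqrt_Rsqr_abs.
Qed.

Lemma ccont_col (f : C -> C) (x c d : R) :
  (forall y, Rmin c d <= y <= Rmax c d -> ccont f (x, y)) -> ex_cint (fun y => f (x, y)) c d.
Proof.
  intros H. apply ex_cint_cont. intros y Hy e He.
  destruct (H y Hy e He) as [r [Hr K]]. exists r. split; [exact Hr|].
  intros y' Hy'. apply K.
  replace ((x, y') - (x, y)) with ((0%R, y' - y) : C)%R by
    (unfold Cminus, Cplus, Copp; simpl; f_equal; ring).
  now rewrite Cmod_im.
Qed.

Definition on_boundary (a b c d : R) (w : C) : Prop :=
  a <= Re w <= b /\ c <= Im w <= d /\ (Re w = a \/ Re w = b \/ Im w = c \/ Im w = d).

Definition cont_bd (f : C -> C) (a b c d : R) : Prop :=
  forall w, on_boundary a b c d w -> ccont f w.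

Lemma cont_bd_row (f : C -> C) (a b c d y a' b' : R) :
  cont_bd f a b c d -> (c <= d)%R -> y = c \/ y = d -> (a <= a' <= b')%R -> (b' <= b)%R ->
  ex_cint (fun x => f (x, y)) a' b'.
Proof.
  intros H Hcd Hy Ha Hb. apply ccont_row. intros x Hx.
  rewrite Rmin_left, Rmax_right in Hx by lra. apply H. unfold on_boundary, Re, Im; simpl. lra.
Qed.

Lemma cont_bd_col (f : C -> C) (a b c d x c' d' : R) :
  cont_bd f a b c d -> (a <= b)%R -> x = a \/ x = b -> (c <= c' <= d')%R -> (d' <= d)%R ->
  ex_cint (fun y => f (x, y)) c' d'.
Proof.
  intros H Hcd Hy Ha Hb. apply ccont_col. intros y Hx.
  rewrite Rmin_left, Rmax_right in Hx by lra. apply H. unfold on_boundary, Re, Im; simpl. lra.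
Qed.

Lemma contour_int_split_x (f : C -> C) (a m b c d : R) :
  (a <= m <= b)%R -> (c <= d)%R -> cont_bd f a b c d ->
  contour_int f a b c d = contour_int f a m c d + contour_int f m b c d.
Proof.
  intros Hm Hcd H. unfold contour_int.
  rewrite <- (cint_chasles (fun x => f (x, c)) a m b), <- (cint_chasles (fun x => f (x, d)) a m b);
    [ring|..]; apply (cont_bd_row f a b c d); auto; lra.
Qed.

Lemma contour_int_split_y (f : C -> C) (a b c m d : R) :
  (a <= b)%R -> (c <= m <= d)%R -> cont_bd f a b c d ->
  contour_int f a b c d = contour_int f a b c m + contour_int f a b m d.
Proof.
  intros Hab Hm H. unfold contour_int.
  rewrite <- (cint_chasles (fun y => f (a, y)) c m d), <- (cint_chasles (fun y => f (b, y)) c m d);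
    [ring|..]; apply (cont_bd_col f a b c d); auto; lra.
Qed.

Lemma contour_int_plus (f g : C -> C) (a b c d : R) :
  (a <= b)%R -> (c <= d)%R -> cont_bd f a b c d -> cont_bd g a b c d ->
  contour_int (fun w => f w + g w) a b c d = contour_int f a b c d + contour_int g a b c d.
Proof.
  intros Hab Hcd Hf Hg. unfold contour_int.
  rewrite (cint_plus (fun x => f (x, c)) (fun x => g (x, c)) a b),
    (cint_plus (fun x => f (x, d)) (fun x => g (x, d)) a b),
    (cint_plus (fun y => f (b, y)) (fun y => g (b, y)) c d),
    (cint_plus (fun y => f (a, y)) (fun y => g (a, y)) c d); [ring|..];
  first [ apply (cont_bd_row _ a b c d); auto; lra | apply (cont_bd_col _ a b c d); auto; lra ].
Qed.

Lemma contour_int_ext (f g : C -> C) (a b c d : R) :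
  (a <= b)%R -> (c <= d)%R -> (forall w, on_boundary a b c d w -> f w = g w) ->
  contour_int f a b c d = contour_int g a b c d.
Proof.
  intros Hab Hcd H. unfold contour_int, on_boundary in *.
  rewrite (cint_ext (fun x => f (x, c)) (fun x => g (x, c)) a b),
    (cint_ext (fun x => f (x, d)) (fun x => g (x, d)) a b),
    (cint_ext (fun y => f (b, y)) (fun y => g (b, y)) c d),
    (cint_ext (fun y => f (a, y)) (fun y => g (a, y)) c d); [reflexivity|..];
  intros t Ht; rewrite Rmin_left, Rmax_right in Ht by lra; apply H; unfold Re, Im; simpl; lra.
Qed.

Lemma contour_int_bound (f : C -> C) (a b c d M : R) :
  (a <= b)%R -> (c <= d)%R -> cont_bd f a b c d ->
  (forall w, on_boundary a b c d w -> Cmod (f w) <= M) ->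
  (Cmod (contour_int f a b c d) <= 2 * ((b - a) + (d - c)) * M)%R.
Proof.
  intros Hab Hcd H HM. unfold contour_int, on_boundary in *.
  assert (B1 := cint_bound (fun x => f (x, c)) a b M Hab
    (cont_bd_row _ _ _ _ _ c a b H Hcd ltac:(auto) ltac:(lra) ltac:(lra))
    (fun x Hx => HM (x, c) ltac:(unfold Re, Im; simpl; lra))).
  assert (B2 := cint_bound (fun x => f (x, d)) a b M Hab
    (cont_bd_row _ _ _ _ _ d a b H Hcd ltac:(auto) ltac:(lra) ltac:(lra))
    (fun x Hx => HM (x, d) ltac:(unfold Re, Im; simpl; lra))).
  assert (B3 := cint_bound (fun y => f (b, y)) c d M Hcd
    (cont_bd_col _ _ _ _ _ b c d H Hab ltac:(auto) ltac:(lra) ltac:(lra))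
    (fun x Hx => HM (b, x) ltac:(unfold Re, Im; simpl; lra))).
  assert (B4 := cint_bound (fun y => f (a, y)) c d M Hcd
    (cont_bd_col _ _ _ _ _ a c d H Hab ltac:(auto) ltac:(lra) ltac:(lra))
    (fun x Hx => HM (a, x) ltac:(unfold Re, Im; simpl; lra))).
  eapply Rle_trans; [apply Cmod_triangle|]. rewrite Cmod_mult, Cmod_Ci.
  pose proof (Cmod_minus_le (cint (fun x => f (x, c)) a b) (cint (fun x => f (x, d)) a b)).
  pose proof (Cmod_minus_le (cint (fun x => f (b, x)) c d) (cint (fun x => f (a, x)) c d)).
  lra.
Qed.

Lemma contour_int_affine (p q : C) (a b c d : R) : contour_int (fun w => p + q * w) a b c d = 0.
Proof.
  destruct p as [p1 p2], q as [q1 q2]. unfold contour_int.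
  assert (Hrow : forall y, cint (fun x => (p1, p2) + (q1, q2) * (x, y)) a b
    = ((p1 - q2 * y) * (b - a) + q1 * ((b ^ 2 - a ^ 2) / 2),
       (p2 + q1 * y) * (b - a) + q2 * ((b ^ 2 - a ^ 2) / 2))%R).
  { intros y. apply cint_pair.
    - eapply is_RInt_ext; [|apply is_RInt_lin]. intros x _; simpl. ring.
    - eapply is_RInt_ext; [|apply is_RInt_lin]. intros x _; simpl. ring. }
  assert (Hcol : forall x, cint (fun y => (p1, p2) + (q1, q2) * (x, y)) c d
    = ((p1 + q1 * x) * (d - c) + (- q2) * ((d ^ 2 - c ^ 2) / 2),
       (p2 + q2 * x) * (d - c) + q1 * ((d ^ 2 - c ^ 2) / 2))%R).
  { intros x. apply cint_pair.
    - eapply is_RInt_ext; [|apply is_RInt_lin]. intros y _; simpl. ring.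
    - eapply is_RInt_ext; [|apply is_RInt_lin]. intros y _; simpl. ring. }
  rewrite !Hrow, !Hcol. unfold RtoC, Ci, Cminus, Cplus, Cmult, Copp; simpl. f_equal; field.
Qed.

(** * Induction over rectangles by quartering *)

Section Cousin.
Variable P : R -> R -> R -> R -> Prop.
Hypothesis Pquart : forall a b c d, (a <= b)%R -> (c <= d)%R ->
  P a ((a + b) / 2) c ((c + d) / 2) -> P a ((a + b) / 2) ((c + d) / 2) d ->
  P ((a + b) / 2) b c ((c + d) / 2) -> P ((a + b) / 2) b ((c + d) / 2) d -> P a b c d.
Variables a b c d : R.
Hypothesis Hab : (a <= b)%R.
Hypothesis Hcd : (c <= d)%R.
Hypothesis Ploc : forall u v, a <= u <= b -> c <= v <= d -> exists del, (0 < del)%R /\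
  forall a' b' c' d', a <= a' <= u -> u <= b' <= b -> c <= c' <= v -> v <= d' <= d ->
    (b' - a' < del)%R -> (d' - c' < del)%R -> P a' b' c' d'.

(** Selects a quarter on which [P] fails. The last branch needs no test: if the other three quarters
    satisfy [P] and the whole does not, [Pquart] makes the fourth fail. *)
Let step (q : (R * R) * (R * R)) : (R * R) * (R * R) :=
  let '((a, b), (c, d)) := q in
  let m := ((a + b) / 2)%R in let n := ((c + d) / 2)%R in
  if excluded_middle_informative (~ P a m c n) then ((a, m), (c, n))
  else if excluded_middle_informative (~ P a m n d) then ((a, m), (n, d))
  else if excluded_middle_informative (~ P m b c n) then ((m, b), (c, n))
  else ((m, b), (n, d)).

Let Q (n : nat) := Nat.iter n step ((a, b), (c, d)).

(** If [P] failed, repeated quartering would give nested rectangles on which it fails, shrinking to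
    a point [(u, v)], against [Ploc] at that point. This serves both for Goursat's theorem and as a
    compactness argument. *)
Lemma cousin_rect : P a b c d.
Proof.
  apply NNPP. intros HN.
  assert (I : forall n, let '((a', b'), (c', d')) := Q n in
    a <= a' <= b' /\ b' <= b /\ c <= c' <= d' /\ d' <= d /\ ~ P a' b' c' d' /\
    (b' - a' = (b - a) / 2 ^ n)%R /\ (d' - c' = (d - c) / 2 ^ n)%R /\
    let '((a2, b2), (c2, d2)) := Q (S n) in
      (a' <= a2)%R /\ (b2 <= b')%R /\ (c' <= c2)%R /\ (d2 <= d')%R).
  { assert (K : forall a' b' c' d', a <= a' <= b' -> b' <= b -> c <= c' <= d' -> d' <= d ->
      ~ P a' b' c' d' -> let '((a2, b2), (c2, d2)) := step ((a', b'), (c', d')) in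
      (a' <= a2 <= b2)%R /\ (b2 <= b')%R /\ (c' <= c2 <= d2)%R /\ (d2 <= d')%R /\
      ~ P a2 b2 c2 d2 /\ (b2 - a2 = (b' - a') / 2)%R /\ (d2 - c2 = (d' - c') / 2)%R).
    { intros a' b' c' d' H1 H2 H3 H4 N. unfold step.
      set (m := ((a' + b') / 2)%R). set (k := ((c' + d') / 2)%R).
      assert (a' <= m <= b')%R by (unfold m; lra). assert (c' <= k <= d')%R by (unfold k; lra).
      destruct (excluded_middle_informative (~ P a' m c' k)) as [h1|h1];
      [|destruct (excluded_middle_informative (~ P a' m k d')) as [h2|h2];
      [|destruct (excluded_middle_informative (~ P m b' c' k)) as [h3|h3]]];
      (repeat split; try lra; try assumption; try (unfold m, k; lra)).
      apply NNPP in h1, h2, h3. intros h4. apply N. apply Pquart; auto; lra. }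
    assert (J : forall n, let '((a', b'), (c', d')) := Q n in
      a <= a' <= b' /\ b' <= b /\ c <= c' <= d' /\ d' <= d /\ ~ P a' b' c' d' /\
      (b' - a' = (b - a) / 2 ^ n)%R /\ (d' - c' = (d - c) / 2 ^ n)%R).
    { induction n.
      - simpl. repeat split; try lra; auto.
      - change (Q (S n)) with (step (Q n)). destruct (Q n) as [[a' b'] [c' d']].
        destruct IHn as [h1 [h2 [h3 [h4 [h5 [h6 h7]]]]]].
        specialize (K a' b' c' d' h1 h2 h3 h4 h5).
        destruct (step (a', b', (c', d'))) as [[a2 b2] [c2 d2]].
        destruct K as [k1 [k2 [k3 [k4 [k5 [k6 k7]]]]]].
        repeat split; try lra; auto.
        + rewrite k6, h6. simpl. field. apply pow_nonzero; lra.
        + rewrite k7, h7. simpl. field. apply pow_nonzero; lra. }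
    intros n. specialize (J n). change (Q (S n)) with (step (Q n)).
    destruct (Q n) as [[a' b'] [c' d']].
    destruct J as [h1 [h2 [h3 [h4 [h5 [h6 h7]]]]]].
    specialize (K a' b' c' d' h1 h2 h3 h4 h5).
    destruct (step (a', b', (c', d'))) as [[a2 b2] [c2 d2]].
    destruct K as [k1 [k2 [k3 [k4 [k5 [k6 k7]]]]]]. repeat split; try lra; auto. }
  set (A n := fst (fst (Q n))). set (B n := snd (fst (Q n))).
  set (X n := fst (snd (Q n))). set (Y n := snd (snd (Q n))).
  assert (I' : forall n, a <= A n <= B n /\ B n <= b /\ c <= X n <= Y n /\ Y n <= d /\
    ~ P (A n) (B n) (X n) (Y n) /\
    (B n - A n = (b - a) / 2 ^ n)%R /\ (Y n - X n = (d - c) / 2 ^ n)%R /\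
    (A n <= A (S n))%R /\ (B (S n) <= B n)%R /\ (X n <= X (S n))%R /\ (Y (S n) <= Y n)%R).
  { intros n. specialize (I n). unfold A, B, X, Y.
    destruct (Q n) as [[a' b'] [c' d']], (Q (S n)) as [[a2 b2] [c2 d2]]. simpl. tauto. }
  clear I.
  assert (Mono : forall n k, (A n <= A (n + k)%nat)%R /\ (B (n + k)%nat <= B n)%R /\
    (X n <= X (n + k)%nat)%R /\ (Y (n + k)%nat <= Y n)%R).
  { intros n. induction k.
    - rewrite Nat.add_0_r. lra.
    - rewrite Nat.add_succ_r. destruct (I' (n + k)%nat) as [_ [_ [_ [_ [_ [_ [_ h]]]]]]]. lra. }
  assert (Cross : forall n m, (A n <= B m)%R /\ (X n <= Y m)%R).
  { intros n m. pose proof (Mono n m) as h1. pose proof (Mono m n) as h2.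
    rewrite Nat.add_comm in h2. pose proof (I' (n + m)%nat) as h3. lra. }
  destruct (completeness (fun x => exists n, x = A n)) as [u [Hu1 Hu2]].
  { exists b. intros x [n ->]. pose proof (I' n). lra. }
  { exists (A 0%nat). now exists 0%nat. }
  destruct (completeness (fun x => exists n, x = X n)) as [v [Hv1 Hv2]].
  { exists d. intros x [n ->]. pose proof (I' n). lra. }
  { exists (X 0%nat). now exists 0%nat. }
  assert (Lu : forall n, (A n <= u <= B n)%R).
  { intros n. split; [apply Hu1; now exists n|]. apply Hu2. intros x [m ->]. apply Cross. }
  assert (Lv : forall n, (X n <= v <= Y n)%R).
  { intros n. split; [apply Hv1; now exists n|]. apply Hv2. intros x [m ->]. apply Cross. }
  destruct (Ploc u v) as [del [Hdel K]].
  { pose proof (Lu 0%nat). pose proof (I' 0%nat). lra. }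
  { pose proof (Lv 0%nat). pose proof (I' 0%nat). lra. }
  assert (Small : exists n, ((b - a) / 2 ^ n < del)%R /\ ((d - c) / 2 ^ n < del)%R).
  { destruct (pow_lt_1_zero (/ 2)%R ltac:(rewrite Rabs_pos_eq; lra) (del / ((b - a) + (d - c) + 1))%R)
      as [n Hn]. { apply Rdiv_lt_0_compat; lra. }
    exists n. specialize (Hn n ltac:(lia)). rewrite Rabs_pos_eq in Hn.
    2: { apply pow_le; lra. }
    rewrite pow_inv in Hn. unfold Rdiv.
    apply (Rmult_lt_compat_r ((b - a) + (d - c) + 1)) in Hn; [|lra].
    replace (del / (b - a + (d - c) + 1) * (b - a + (d - c) + 1))%R with del in Hn by (field; lra).
    assert (0 < / 2 ^ n)%R by (apply Rinv_0_lt_compat, pow_lt; lra). split; nra. }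
  destruct Small as [n [s1 s2]]. destruct (I' n) as [h1 [h2 [h3 [h4 [h5 [h6 [h7 _]]]]]]].
  pose proof (Lu n). pose proof (Lv n).
  apply h5. apply K; lra.
Qed.
End Cousin.

Lemma Cmod_le_abs (w : C) : (Cmod w <= Rabs (Re w) + Rabs (Im w))%R.
Proof.
  destruct w as [x y]. unfold Re, Im; simpl.
  replace ((x, y) : C) with (RtoC x + (0%R, y)) by (unfold RtoC, Cplus; simpl; f_equal; ring).
  eapply Rle_trans; [apply Cmod_triangle|]. rewrite Cmod_R, Cmod_im. lra.
Qed.

Definition holo_on (f : C -> C) (a b c d : R) : Prop :=
  forall x y, a <= x <= b -> c <= y <= d -> holo f (x, y).

Lemma holo_on_cont (f : C -> C) (a b c d a' b' c' d' : R) :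
  holo_on f a b c d -> (a <= a')%R -> (b' <= b)%R -> (c <= c')%R -> (d' <= d)%R ->
  cont_bd f a' b' c' d'.
Proof.
  intros H Ha Hb Hc Hd [x y] [Hx [Hy _]]. unfold Re, Im in *; simpl in *.
  apply holo_ccont. apply H; lra.
Qed.

Lemma goursat (f : C -> C) (a b c d : R) :
  (a <= b)%R -> (c <= d)%R -> holo_on f a b c d -> contour_int f a b c d = 0.
Proof.
  intros Hab Hcd Hf. pose proof (fun a' b' c' d' => holo_on_cont _ _ _ _ _ a' b' c' d' Hf) as Cf.
  (* The square of the half-perimeter is additive under quartering: each quarter has exactly a
     fourth of it. Hence this bound is inherited from the quarters. *)
  assert (E : forall e, (0 < e)%R -> (Cmod (contour_int f a b c d) <= e * ((b - a) + (d - c)) ^ 2)%R).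
  { intros e He.
    refine (cousin_rect (fun a' b' c' d' => (a <= a')%R -> (b' <= b)%R -> (c <= c')%R ->
      (d' <= d)%R -> (Cmod (contour_int f a' b' c' d') <= e * ((b' - a') + (d' - c')) ^ 2)%R)
      _ a b c d Hab Hcd _ _ _ _ _); try lra.
    - intros a' b' c' d' h1 h2 k1 k2 k3 k4 g1 g2 g3 g4.
      set (m := ((a' + b') / 2)%R) in *. set (n := ((c' + d') / 2)%R) in *.
      assert (a' <= m <= b')%R by (unfold m; lra). assert (c' <= n <= d')%R by (unfold n; lra).
      rewrite (contour_int_split_x f a' m b'), (contour_int_split_y f a' m c' n d'), (contour_int_split_y f m b' c' n d');
        try lra; try (apply Cf; lra).
      specialize (k1 ltac:(lra) ltac:(lra) ltac:(lra) ltac:(lra)).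
      specialize (k2 ltac:(lra) ltac:(lra) ltac:(lra) ltac:(lra)).
      specialize (k3 ltac:(lra) ltac:(lra) ltac:(lra) ltac:(lra)).
      specialize (k4 ltac:(lra) ltac:(lra) ltac:(lra) ltac:(lra)).
      eapply Rle_trans; [apply Cmod_triangle|].
      pose proof (Cmod_triangle (contour_int f a' m c' n) (contour_int f a' m n d')).
      pose proof (Cmod_triangle (contour_int f m b' c' n) (contour_int f m b' n d')).
      replace (m - a')%R with ((b' - a') / 2)%R in * by (unfold m; field).
      replace (b' - m)%R with ((b' - a') / 2)%R in * by (unfold m; field).
      replace (n - c')%R with ((d' - c') / 2)%R in * by (unfold n; field).
      replace (d' - n)%R with ((d' - c') / 2)%R in * by (unfold n; field).
      nra.
    - intros u v Hu Hv. destruct (Hf u v Hu Hv) as [q [Hq E]].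
      destruct (Hq (e / 2)%R ltac:(lra)) as [del [Hdel K]].
      exists (del / 2)%R. split; [lra|].
      intros a' b' c' d' h1 h2 h3 h4 h5 h6 g1 g2 g3 g4.
      set (z := (u, v) : C) in *.
      (* The affine part of [f] at [z] integrates to 0. The rest is at most [e / 2] times the
         half-perimeter, and the length of the contour is twice the half-perimeter. *)
      assert (Eq : contour_int f a' b' c' d' = contour_int (fun w => (q w - q z) * (w - z)) a' b' c' d').
      { transitivity (contour_int (fun w => (f z - q z * z + q z * w) + (q w - q z) * (w - z)) a' b' c' d').
        - apply contour_int_ext; [lra|lra|]. intros w _. rewrite (E w). ring.
        - rewrite (contour_int_plus (fun w => f z - q z * z + q z * w)), contour_int_affine; try lra.
          + ring.
          + intros w _. apply ccont_plus; [apply ccont_const|].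
            apply ccont_mult; auto using ccont_const, ccont_id.
          + intros [x y] [Hx [Hy _]]; unfold Re, Im in Hx, Hy; simpl in Hx, Hy.
            apply (ccont_ext_loc (fun w => f w + (-(1)) * (f z - q z * z + q z * w)) _ _ 1); [lra| |].
            * intros w _. rewrite (E w). ring.
            * apply ccont_plus; [apply holo_ccont, Hf; lra|].
              repeat first [apply ccont_plus|apply ccont_mult|apply ccont_const|apply ccont_id]. }
      rewrite Eq.
      assert (Bd : forall w, on_boundary a' b' c' d' w ->
        (Cmod ((q w - q z) * (w - z)) <= e / 2 * ((b' - a') + (d' - c')))%R).
      { intros w [w1 [w2 _]]. rewrite Cmod_mult.
        assert (T : (Cmod (w - z) <= (b' - a') + (d' - c'))%R).
        { eapply Rle_trans; [apply Cmod_le_abs|]. unfold z, Re, Im in *.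
          destruct w as [x y]; simpl in *.
          apply Rplus_le_compat; apply Rabs_le; lra. }
        specialize (K w ltac:(lra)). apply Rmult_le_compat; try apply Cmod_ge_0; lra. }
      eapply Rle_trans;
        [apply (contour_int_bound _ a' b' c' d' (e / 2 * ((b' - a') + (d' - c')))%R); [lra|lra| |exact Bd]|].
      + intros [x y] [Hx [Hy _]]; unfold Re, Im in Hx, Hy; simpl in Hx, Hy.
        apply (ccont_ext_loc (fun w => f w + (-(1)) * (f z - q z * z + q z * w)) _ _ 1); [lra| |].
        * intros w _. rewrite (E w). ring.
        * apply ccont_plus; [apply holo_ccont, Hf; lra|].
          repeat first [apply ccont_plus|apply ccont_mult|apply ccont_const|apply ccont_id].
      + apply Req_le. field. }
  apply Cmod_eq_0. apply Rle_antisym; [|apply Cmod_ge_0].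
  apply le_epsilon. intros e He. rewrite Rplus_0_l.
  set (L := ((b - a) + (d - c))%R) in *. assert (0 <= L)%R by (unfold L; lra).
  assert (0 < L ^ 2 + 1)%R by nra.
  specialize (E (e / (L ^ 2 + 1))%R ltac:(apply Rdiv_lt_0_compat; lra)).
  eapply Rle_trans; [exact E|]. apply Rmult_le_reg_r with (L ^ 2 + 1)%R; [lra|].
  replace (e / (L ^ 2 + 1) * L ^ 2 * (L ^ 2 + 1))%R with (e * L ^ 2)%R by (field; lra). nra.
Qed.

(** * The maximum principle and its variants with nodes *)

Lemma RInt_between (f : R -> R) (a b m M : R) :
  a <= b -> ex_RInt f a b -> (forall x, a <= x <= b -> m <= f x <= M) ->
  ((b - a) * m <= RInt f a b <= (b - a) * M)%R.
Proof.
  intros Hab Hf H. split.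
  - replace ((b - a) * m)%R with (RInt (fun _ => m) a b)
      by (rewrite RInt_const; reflexivity).
    apply RInt_le; auto; [apply ex_RInt_const|]. intros x Hx. apply H; lra.
  - replace ((b - a) * M)%R with (RInt (fun _ => M) a b)
      by (rewrite RInt_const; reflexivity).
    apply RInt_le; auto; [apply ex_RInt_const|]. intros x Hx. apply H; lra.
Qed.

Lemma holo_cauchy_kernel (z w : C) : w <> z -> holo (fun w => / (w - z)) w.
Proof.
  intros N. apply holo_inv; [|now apply Cminus_neq0].
  apply holo_minus; [apply holo_id|apply holo_const].
Qed.

(* The exact value is [2 * PI * Ci]. *)
Lemma contour_int_kernel_ge (x0 y0 r eta : R) :
  0 < eta -> 0 <= r ->
  (4 * r <= Cmod (contour_int (fun w : C => RtoC r * / (w - (x0, y0)))%C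
     (x0 - eta) (x0 + eta) (y0 - eta) (y0 + eta)))%R.
Proof.
  intros He Hr.
  assert (Cb : cont_bd (fun w : C => RtoC r * / (w - (x0, y0)))%C
    (x0 - eta) (x0 + eta) (y0 - eta) (y0 + eta)).
  { intros w Hw. apply ccont_mult; [apply ccont_const|]. apply holo_ccont.
    apply holo_cauchy_kernel. intros ->. unfold on_boundary, Re, Im in Hw; simpl in Hw. lra. }
  set (f := fun w : C => RtoC r * / (w - (x0, y0))) in *.
  eapply Rle_trans; [|eapply Rle_trans; [apply Rle_abs|]].
  2: { eapply Rle_trans; [|apply Rmax_Cmod]. apply Rmax_r. }
  (* On each side, the integrand contributes [r] times this kernel to the imaginary part of the
     integral; a side has length [2 * eta], so the lower bound yields at least [r] per side. *)
  assert (E1 : forall t, (Rabs t <= eta)%R -> (/ (2 * eta) <= eta / (t ^ 2 + eta ^ 2) <= / eta)%R).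
  { intros t Ht. apply Rabs_le_between in Ht.
    assert (0 < t ^ 2 + eta ^ 2)%R by nra. split.
    - apply Rmult_le_reg_r with (2 * eta * (t ^ 2 + eta ^ 2))%R; [repeat apply Rmult_lt_0_compat; lra|].
      replace (/ (2 * eta) * (2 * eta * (t ^ 2 + eta ^ 2)))%R with (t ^ 2 + eta ^ 2)%R by (field; lra).
      replace (eta / (t ^ 2 + eta ^ 2) * (2 * eta * (t ^ 2 + eta ^ 2)))%R with (2 * eta * eta)%R
        by (field; lra). nra.
    - apply Rmult_le_reg_r with (eta * (t ^ 2 + eta ^ 2))%R; [repeat apply Rmult_lt_0_compat; lra|].
      replace (/ eta * (eta * (t ^ 2 + eta ^ 2)))%R with (t ^ 2 + eta ^ 2)%R by (field; lra).
      replace (eta / (t ^ 2 + eta ^ 2) * (eta * (t ^ 2 + eta ^ 2)))%R with (eta * eta)%R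
        by (field; lra). nra. }
  assert (X1 : ex_cint (fun x => f (x, y0 - eta)%R) (x0 - eta) (x0 + eta))
    by (apply (cont_bd_row f _ _ _ _ _ _ _ Cb); auto; lra).
  assert (X2 : ex_cint (fun x => f (x, y0 + eta)%R) (x0 - eta) (x0 + eta))
    by (apply (cont_bd_row f _ _ _ _ _ _ _ Cb); auto; lra).
  assert (X3 : ex_cint (fun y => f (x0 + eta, y)%R) (y0 - eta) (y0 + eta))
    by (apply (cont_bd_col f _ _ _ _ _ _ _ Cb); auto; lra).
  assert (X4 : ex_cint (fun y => f (x0 - eta, y)%R) (y0 - eta) (y0 + eta))
    by (apply (cont_bd_col f _ _ _ _ _ _ _ Cb); auto; lra).
  unfold contour_int.
  set (A := cint (fun x => f (x, y0 - eta)%R) (x0 - eta) (x0 + eta)).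
  set (B := cint (fun x => f (x, y0 + eta)%R) (x0 - eta) (x0 + eta)).
  set (C1 := cint (fun y => f (x0 + eta, y)%R) (y0 - eta) (y0 + eta)).
  set (D := cint (fun y => f (x0 - eta, y)%R) (y0 - eta) (y0 + eta)).
  replace (snd (A - B + Ci * (C1 - D))) with (snd A - snd B + fst C1 - fst D)%R
    by (unfold Cminus, Cplus, Cmult, Copp, Ci; simpl; ring).
  assert (b1 : (r <= snd A)%R).
  { unfold A. rewrite cint_snd by exact X1.
    assert (K := RInt_between (fun x => snd (f (x, y0 - eta)%R)) (x0 - eta) (x0 + eta)
      (r * / (2 * eta)) (r * / eta) ltac:(lra) (ex_cint_snd _ _ _ X1)).
    replace ((x0 + eta - (x0 - eta)) * (r * / (2 * eta)))%R with r in K by (field; lra).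
    apply K. intros x Hx. pose proof (E1 (x - x0)%R ltac:(apply Rabs_le; lra)).
    replace (snd (f (x, y0 - eta)%R)) with (r * (eta / ((x - x0) ^ 2 + eta ^ 2)))%R.
    - split; apply Rmult_le_compat_l; lra.
    - unfold f, RtoC, Cinv, Cminus, Cplus, Cmult, Copp; simpl.
      pose proof (pow2_ge_0 (x - x0)). field. apply Rgt_not_eq; nra. }
  assert (b2 : (snd B <= - r)%R).
  { unfold B. rewrite cint_snd by exact X2.
    assert (K := RInt_between (fun x => snd (f (x, y0 + eta)%R)) (x0 - eta) (x0 + eta)
      (- (r * / eta)) (- (r * / (2 * eta))) ltac:(lra) (ex_cint_snd _ _ _ X2)).
    replace ((x0 + eta - (x0 - eta)) * (- (r * / (2 * eta))))%R with (- r)%R in K by (field; lra).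
    apply K. intros x Hx. pose proof (E1 (x - x0)%R ltac:(apply Rabs_le; lra)).
    replace (snd (f (x, y0 + eta)%R)) with (- (r * (eta / ((x - x0) ^ 2 + eta ^ 2))))%R.
    - split; apply Ropp_le_contravar; apply Rmult_le_compat_l; lra.
    - unfold f, RtoC, Cinv, Cminus, Cplus, Cmult, Copp; simpl.
      pose proof (pow2_ge_0 (x - x0)). field. apply Rgt_not_eq; nra. }
  assert (b3 : (r <= fst C1)%R).
  { unfold C1. rewrite cint_fst by exact X3.
    assert (K := RInt_between (fun y => fst (f (x0 + eta, y)%R)) (y0 - eta) (y0 + eta)
      (r * / (2 * eta)) (r * / eta) ltac:(lra) (ex_cint_fst _ _ _ X3)).
    replace ((y0 + eta - (y0 - eta)) * (r * / (2 * eta)))%R with r in K by (field; lra).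
    apply K. intros y Hx. pose proof (E1 (y - y0)%R ltac:(apply Rabs_le; lra)).
    replace (fst (f (x0 + eta, y)%R)) with (r * (eta / ((y - y0) ^ 2 + eta ^ 2)))%R.
    - split; apply Rmult_le_compat_l; lra.
    - unfold f, RtoC, Cinv, Cminus, Cplus, Cmult, Copp; simpl.
      pose proof (pow2_ge_0 (y - y0)). field. apply Rgt_not_eq; nra. }
  assert (b4 : (fst D <= - r)%R).
  { unfold D. rewrite cint_fst by exact X4.
    assert (K := RInt_between (fun y => fst (f (x0 - eta, y)%R)) (y0 - eta) (y0 + eta)
      (- (r * / eta)) (- (r * / (2 * eta))) ltac:(lra) (ex_cint_fst _ _ _ X4)).
    replace ((y0 + eta - (y0 - eta)) * (- (r * / (2 * eta))))%R with (- r)%R in K by (field; lra).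
    apply K. intros y Hx. pose proof (E1 (y - y0)%R ltac:(apply Rabs_le; lra)).
    replace (fst (f (x0 - eta, y)%R)) with (- (r * (eta / ((y - y0) ^ 2 + eta ^ 2))))%R.
    - split; apply Ropp_le_contravar; apply Rmult_le_compat_l; lra.
    - unfold f, RtoC, Cinv, Cminus, Cplus, Cmult, Copp; simpl.
      pose proof (pow2_ge_0 (y - y0)). field. apply Rgt_not_eq; nra. }
  lra.
Qed.

Lemma boundary_dist (a b c d x0 y0 rho : R) (w : C) :
  (rho <= x0 - a)%R -> (rho <= b - x0)%R -> (rho <= y0 - c)%R -> (rho <= d - y0)%R ->
  on_boundary a b c d w -> (rho <= Cmod (w - (x0, y0)))%R.
Proof.
  intros H1 H2 H3 H4 [_ [_ Hw]]. destruct w as [x y]; unfold Re, Im in Hw; simpl in Hw.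
  eapply Rle_trans; [|apply Rmax_Cmod]. simpl.
  destruct Hw as [Hw|[Hw|Hw]].
  - eapply Rle_trans; [|apply Rmax_l]. rewrite <- Rabs_Ropp. eapply Rle_trans; [|apply Rle_abs]. lra.
  - eapply Rle_trans; [|apply Rmax_l]. eapply Rle_trans; [|apply Rle_abs]. lra.
  - eapply Rle_trans; [|apply Rmax_r]. destruct Hw.
    + rewrite <- Rabs_Ropp. eapply Rle_trans; [|apply Rle_abs]. lra.
    + eapply Rle_trans; [|apply Rle_abs]. lra.
Qed.

(** A substitute for Cauchy's formula; what matters is that [K] does not depend on [f]. Goursat's
    theorem shrinks the contour of [f w / (w - z)] to a small square around [z], where the integral
    is bounded below by a multiple of the modulus of [f z], while on the outer boundary it is
    bounded above through [M]. *)
Lemma cauchy_bound (a b c d x0 y0 : R) :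
  (a < x0 < b)%R -> (c < y0 < d)%R -> exists K, (0 < K)%R /\
  forall (f : C -> C) M, holo_on f a b c d ->
    (forall w, on_boundary a b c d w -> Cmod (f w) <= M) -> (Cmod (f (x0, y0)) <= K * M)%R.
Proof.
  intros Hx Hy.
  set (rho := Rmin (Rmin (x0 - a) (b - x0)) (Rmin (y0 - c) (d - y0))).
  assert (Hrho : 0 < rho /\ (rho <= x0 - a)%R /\ (rho <= b - x0)%R /\ (rho <= y0 - c)%R /\ (rho <= d - y0)%R).
  { unfold rho. repeat split.
    - repeat apply Rmin_pos; lra.
    - eapply Rle_trans; [apply Rmin_l|apply Rmin_l].
    - eapply Rle_trans; [apply Rmin_l|apply Rmin_r].
    - eapply Rle_trans; [apply Rmin_r|apply Rmin_l].
    - eapply Rle_trans; [apply Rmin_r|apply Rmin_r]. }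
  clearbody rho. destruct Hrho as [R0 [R1 [R2 [R3 R4]]]].
  set (L := (2 * ((b - a) + (d - c)))%R).
  assert (0 < L)%R by (unfold L; lra).
  exists (L / (3 * rho))%R. split; [apply Rdiv_lt_0_compat; lra|].
  intros f M Hf HM. set (z := (x0, y0) : C).
  set (r := Cmod (f z)). assert (Pr : (0 <= r)%R) by apply Cmod_ge_0.
  assert (PM : (0 <= M)%R).
  { eapply Rle_trans; [apply Cmod_ge_0|apply (HM (a, c))]. unfold on_boundary, Re, Im; simpl. lra. }
  destruct (Req_dec r 0) as [E|N].
  { rewrite E. apply Rmult_le_pos; [|exact PM]. apply Rlt_le, Rdiv_lt_0_compat; lra. }
  assert (Pr' : (0 < r)%R) by lra.
  (* This factor makes the value at [z] the nonnegative real [r * r], the form required by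
     [contour_int_kernel_ge]. *)
  set (g := fun w => Cconj (f z) * f w).
  assert (Hg : holo_on g a b c d).
  { intros x y h1 h2. apply holo_mult; [apply holo_const|auto]. }
  assert (Gz : g z = RtoC (r * r)).
  { unfold g, r. rewrite Cmult_comm, <- Cmod2_conj. f_equal. ring. }
  set (u := fun w => g w * / (w - z)).
  assert (Hu : forall x y, a <= x <= b -> c <= y <= d -> (x, y) <> z -> holo u (x, y)).
  { intros x y h1 h2 n. apply holo_mult; [auto|now apply holo_cauchy_kernel]. }
  destruct (Hg x0 y0 ltac:(lra) ltac:(lra)) as [q [Hq Eq]]. fold z in Hq, Eq.
  destruct (Hq 1%R ltac:(lra)) as [del [Hdel Kd]].
  set (B := (Cmod (q z) + 1)%R). assert (PB : (0 < B)%R) by (unfold B; pose proof (Cmod_ge_0 (q z)); lra).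
  (* The three bounds keep the square inside the rectangle, keep it where [q] is bounded by [B], and
     limit the error [8 * eta * B] to [r * r]. Of the lower bound [4 * (r * r)] three quarters
     survive, whence the 3 in [K]. *)
  set (eta := Rmin (Rmin (rho / 2) (del / 4)) (r * r / (8 * B))).
  assert (He : 0 < eta /\ (eta <= rho / 2)%R /\ (eta <= del / 4)%R /\ (eta <= r * r / (8 * B))%R).
  { unfold eta. repeat split.
    - repeat apply Rmin_pos; try lra. apply Rdiv_lt_0_compat; nra.
    - eapply Rle_trans; [apply Rmin_l|apply Rmin_l].
    - eapply Rle_trans; [apply Rmin_l|apply Rmin_r].
    - apply Rmin_r. }
  clearbody eta. destruct He as [He0 [He1 [He2 He3]]].
  assert (Cu : forall a' b' c' d', (a <= a' <= b')%R -> (b' <= b)%R -> (c <= c' <= d')%R -> (d' <= d)%R ->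
     ~ on_boundary a' b' c' d' z -> cont_bd u a' b' c' d').
  { intros a' b' c' d' h1 h2 h3 h4 n [x y] Hw. apply holo_ccont. apply Hu.
    - destruct Hw as [Hw1 [Hw2 _]]; unfold Re, Im in *; simpl in *. lra.
    - destruct Hw as [Hw1 [Hw2 _]]; unfold Re, Im in *; simpl in *. lra.
    - intros E. rewrite E in Hw. contradiction. }
  assert (Z : forall a' b' c' d', (a <= a' <= b')%R -> (b' <= b)%R -> (c <= c' <= d')%R -> (d' <= d)%R ->
     ~ ((a' <= x0 <= b')%R /\ (c' <= y0 <= d')%R) -> contour_int u a' b' c' d' = 0).
  { intros a' b' c' d' h1 h2 h3 h4 n. apply goursat; [lra|lra|]. intros x y k1 k2.
    apply Hu; try lra. intros E. unfold z in E. injection E as -> ->. tauto. }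
  assert (Esmall : contour_int u a b c d = contour_int u (x0 - eta) (x0 + eta) (y0 - eta) (y0 + eta)).
  { rewrite (contour_int_split_x u a (x0 - eta) b), (contour_int_split_x u (x0 - eta) (x0 + eta) b),
      (contour_int_split_y u (x0 - eta) (x0 + eta) c (y0 - eta) d),
      (contour_int_split_y u (x0 - eta) (x0 + eta) (y0 - eta) (y0 + eta) d); try lra;
      try (apply Cu; try lra; unfold on_boundary, z, Re, Im; simpl; lra).
    rewrite (Z a (x0 - eta)%R), (Z (x0 + eta)%R b), (Z (x0 - eta)%R (x0 + eta)%R c),
      (Z (x0 - eta)%R (x0 + eta)%R (y0 + eta)%R); try lra. ring. }
  assert (Elow : (4 * (r * r) - 8 * eta * B <= Cmod (contour_int u a b c d))%R).
  { rewrite Esmall.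
    rewrite (contour_int_ext u (fun w : C => RtoC (r * r) * / (w - z) + (g w - g z) * / (w - z))).
    2,3: lra. 2: { intros w _. unfold u. rewrite Gz. ring. }
    assert (NZ : forall w, on_boundary (x0 - eta) (x0 + eta) (y0 - eta) (y0 + eta) w -> w <> z).
    { intros w Hw ->. unfold on_boundary, z, Re, Im in Hw; simpl in Hw. lra. }
    assert (C2 : cont_bd (fun w => (g w - g z) * / (w - z)) (x0 - eta) (x0 + eta) (y0 - eta) (y0 + eta)).
    { intros w Hw. apply holo_ccont. apply holo_mult; [|apply holo_cauchy_kernel; auto].
      apply holo_minus; [|apply holo_const]. destruct w as [x y].
      destruct Hw as [Hw1 [Hw2 _]]; unfold Re, Im in *; simpl in *. apply Hg; lra. }
    rewrite contour_int_plus; try lra; [| |exact C2].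
    2: { intros w Hw. apply holo_ccont. apply holo_mult; [apply holo_const|apply holo_cauchy_kernel; auto]. }
    pose proof (contour_int_kernel_ge x0 y0 (r * r) eta He0 ltac:(nra)) as K1. fold z in K1.
    assert (K2 : (Cmod (contour_int (fun w => (g w - g z) * / (w - z))%C (x0 - eta) (x0 + eta) (y0 - eta) (y0 + eta))
      <= 8 * eta * B)%R).
    { replace (8 * eta * B)%R
        with (2 * (((x0 + eta) - (x0 - eta)) + ((y0 + eta) - (y0 - eta))) * B)%R by ring.
      apply contour_int_bound; [lra|lra|exact C2|]. intros w Hw.
      replace ((g w - g z) * / (w - z)) with (q w).
      2: { rewrite (Eq w). field. apply Cminus_neq0. auto. }
      assert (D : (Cmod (w - z) < del)%R).
      { eapply Rle_lt_trans; [apply Cmod_le_abs|]. destruct w as [x y].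
        destruct Hw as [Hw1 [Hw2 _]]; unfold z, Re, Im in *; simpl in *.
        assert (Rabs (x + - x0) <= eta)%R by (apply Rabs_le; lra).
        assert (Rabs (y + - y0) <= eta)%R by (apply Rabs_le; lra). lra. }
      specialize (Kd w D). pose proof (Cmod_triangle_inv (q w) (q z)). unfold B. lra. }
    match goal with |- (_ <= Cmod (?P + ?Q))%R => pose proof (Cmod_triangle_inv P (-Q)) as T end.
    match type of T with (_ <= Cmod (?P - - ?Q))%R => replace (P - - Q) with (P + Q) in T by ring end.
    rewrite Cmod_opp in T. lra. }
  assert (Eup : (Cmod (contour_int u a b c d) <= L * (r * M / rho))%R).
  { apply contour_int_bound; [lra|lra| |].
    - apply Cu; try lra. unfold on_boundary, z, Re, Im; simpl. lra.
    - intros w Hw. pose proof (boundary_dist _ _ _ _ x0 y0 rho w R1 R2 R3 R4 Hw) as D. fold z in D.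
      assert (w - z <> 0) by (apply Cmod_gt_0; lra).
      unfold u, g. rewrite !Cmod_mult, Cmod_inv, Cmod_conj by assumption. fold r.
      unfold Rdiv. apply Rmult_le_compat.
      + apply Rmult_le_pos; [lra|apply Cmod_ge_0].
      + apply Rlt_le, Rinv_0_lt_compat. lra.
      + apply Rmult_le_compat_l; [lra|auto].
      + apply Rinv_le_contravar; lra. }
  assert (8 * eta * B <= r * r)%R.
  { replace (r * r)%R with (8 * (r * r / (8 * B)) * B)%R by (field; lra).
    apply Rmult_le_compat_r; lra. }
  replace (L / (3 * rho) * M)%R with (L * M / rho / 3)%R by (field; lra).
  replace (L * (r * M / rho))%R with (r * (L * M / rho))%R in Eup by (field; lra).
  assert (3 * (r * r) <= r * (L * M / rho))%R by lra.
  apply Rmult_le_reg_l with (3 * r)%R; [lra|]. nra.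
Qed.

(** Landau's trick: [cauchy_bound] for [q * g ^ N] costs a factor independent of [N], which cannot
    compensate geometric growth if the modulus of [g] exceeds [m] at the point. Only the products
    have to be differentiable, so [g] may be a quotient with poles on paper at the zeros of [q]. *)
Lemma max_principle_weighted (g q : C -> C) (a b c d x0 y0 m B : R) :
  (a < x0 < b)%R -> (c < y0 < d)%R ->
  (forall N, holo_on (fun w => q w * g w ^ N) a b c d) ->
  q (x0, y0) <> 0 ->
  (forall w, on_boundary a b c d w -> (Cmod (g w) <= m)%R /\ (Cmod (q w) <= B)%R) ->
  (Cmod (g (x0, y0)) <= m)%R.
Proof.
  intros Hx Hy Hh Hq Hb.
  destruct (cauchy_bound a b c d x0 y0 Hx Hy) as [K [HK Kb]].
  assert (Hac : on_boundary a b c d (a, c)) by (unfold on_boundary, Re, Im; simpl; lra).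
  assert (Pm : (0 <= m)%R) by (eapply Rle_trans; [apply Cmod_ge_0|apply (Hb _ Hac)]).
  assert (PB : (0 <= B)%R) by (eapply Rle_trans; [apply Cmod_ge_0|apply (Hb _ Hac)]).
  apply Cmod_gt_0 in Hq.
  set (z := (x0, y0) : C) in *. set (s := Cmod (g z)).
  assert (P : forall N, (Cmod (q z) * s ^ N <= K * (B * m ^ N))%R).
  { intros N. unfold s. rewrite <- Cmod_pow, <- Cmod_mult.
    apply (Kb (fun w => q w * g w ^ N)); [apply Hh|]. intros w Hw.
    rewrite Cmod_mult, Cmod_pow. destruct (Hb w Hw).
    apply Rmult_le_compat; auto using Cmod_ge_0, pow_le. apply pow_incr. split; auto using Cmod_ge_0. }
  destruct (Rle_or_lt s m) as [|Hs]; [assumption|exfalso].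
  set (t := (m / s)%R).
  assert (Ht : (0 <= t < 1)%R).
  { unfold t. split; [apply Rdiv_le_0_compat; lra|]. apply Rlt_div_l; lra. }
  destruct (pow_lt_1_zero t ltac:(rewrite Rabs_pos_eq; lra) (Cmod (q z) / (K * B + 1))%R) as [N HN].
  { apply Rdiv_lt_0_compat; [lra|]. nra. }
  specialize (HN N ltac:(lia)). rewrite Rabs_pos_eq in HN by (apply pow_le; lra).
  specialize (P N). replace m with (t * s)%R in P by (unfold t; field; lra).
  rewrite Rpow_mult_distr in P.
  assert (Ps : (0 < s ^ N)%R) by (apply pow_lt; lra).
  apply Rlt_div_r in HN; [|nra].
  assert (0 <= t ^ N)%R by (apply pow_le; lra).
  assert (Cmod (q z) <= K * B * t ^ N)%R.
  { apply Rmult_le_reg_r with (s ^ N)%R; [lra|]. lra. }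
  nra.
Qed.

Lemma max_principle (f : C -> C) (a b c d x0 y0 m : R) :
  (a < x0 < b)%R -> (c < y0 < d)%R -> holo_on f a b c d ->
  (forall w, on_boundary a b c d w -> (Cmod (f w) <= m)%R) ->
  (Cmod (f (x0, y0)) <= m)%R.
Proof.
  intros Hx Hy Hf Hb.
  apply (max_principle_weighted f (fun _ => 1) a b c d x0 y0 m 1); auto.
  - intros N x y h1 h2. apply holo_mult; [apply holo_const|]. apply holo_pow. auto.
  - intros E. injection E. lra.
  - intros w Hw. split; [auto|]. rewrite Cmod_1. lra.
Qed.

(** Otherwise [/ (f w - v)] would be holomorphic and larger inside than on the boundary. This
    replaces Rouche's theorem and the open mapping theorem. *)
Lemma value_attained (f : C -> C) (a b c d x0 y0 rho : R) (v : C) :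
  (a < x0 < b)%R -> (c < y0 < d)%R -> holo_on f a b c d -> 0 < rho ->
  (forall w, on_boundary a b c d w -> (rho <= Cmod (f w - v))%R) ->
  (Cmod (f (x0, y0) - v) < rho)%R ->
  exists x y, (a <= x <= b)%R /\ (c <= y <= d)%R /\ f (x, y) = v.
Proof.
  intros Hx Hy Hf Hr Hb Hz. apply NNPP. intros N.
  assert (NV : forall x y, (a <= x <= b)%R -> (c <= y <= d)%R -> f (x, y) - v <> 0).
  { intros x y h1 h2 E. apply N. exists x, y. repeat split; try lra.
    replace v with (f (x, y) - (f (x, y) - v)) by ring. rewrite E. ring. }
  assert (K := max_principle (fun w => / (f w - v)) a b c d x0 y0 (/ rho) Hx Hy).
  simpl in K. rewrite Cmod_inv in K by (apply NV; lra).
  assert (Hd := NV x0 y0 ltac:(lra) ltac:(lra)). apply Cmod_gt_0 in Hd.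
  enough (/ Cmod (f (x0, y0) - v) <= / rho)%R.
  { apply Rinv_lt_contravar in Hz; [lra|]. now apply Rmult_lt_0_compat. }
  apply K.
  - intros x y h1 h2. apply holo_inv; [|auto]. apply holo_minus; [auto|apply holo_const].
  - intros w Hw. specialize (Hb w Hw). rewrite Cmod_inv by (apply Cmod_gt_0; lra).
    apply Rinv_le_contravar; lra.
Qed.

(* Multiplying by [w - x] makes powers of the difference quotient differentiable at the
   node [x], so that no removable singularity theorem is needed. *)
Lemma holo_node (u v k : C -> C) (x : C) (N : nat) :
  holo u x -> u x = 0 -> ccont v x -> ccont k x ->
  holo (fun w => (w - x) * v w * (u w / (w - x) * k w) ^ N) x.
Proof.
  intros [s [Hs Es]] Ux Hv Hk.
  exists (fun w => v w * (s w * k w) ^ N). split.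
  - apply ccont_mult; [exact Hv|]. induction N; simpl; [apply ccont_const|].
    apply ccont_mult; [now apply ccont_mult|exact IHN].
  - intros w. destruct (classic (w = x)) as [->|n]; [ring|].
    replace (u w / (w - x)) with (s w).
    + ring.
    + rewrite (Es w), Ux. field. now apply Cminus_neq0.
Qed.

(** The factor [h] allows division by a Blaschke factor of the half-plane instead of [w - x]. *)
Lemma schwarz_one_node (f h : C -> C) (a b c d x0 y0 m : R) (x : C) :
  (a < x0 < b)%R -> (c < y0 < d)%R -> holo_on f a b c d -> holo_on h a b c d ->
  f x = 0 -> (x0, y0) <> x ->
  (forall w, on_boundary a b c d w -> (Cmod (f w / (w - x) * h w) <= m)%R) ->
  (Cmod (f (x0, y0) / ((x0, y0) - x) * h (x0, y0)) <= m)%R.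
Proof.
  intros Hx Hy Hf Hh Ux N Hb.
  apply (max_principle_weighted (fun w => f w / (w - x) * h w) (fun w => w - x) a b c d x0 y0 m
    ((b - a) + (d - c) + (Cmod ((a, c) - x)))); auto.
  - intros n u v h1 h2. destruct (classic (((u, v) : C) = x)) as [<-|n1].
    + apply (holo_ext_loc (fun w => (w - (u, v)) * (fun _ => 1) w * (f w / (w - (u, v)) * h w) ^ n) _ _ 1);
        [lra|intros; ring|].
      apply holo_node; auto using ccont_const. apply holo_ccont. auto.
    + assert (holo (fun w => w - x) (u, v)) by (apply holo_minus; [apply holo_id|apply holo_const]).
      apply holo_mult; [assumption|]. apply holo_pow. apply holo_mult; [|auto].
      apply holo_div; auto. now apply Cminus_neq0.
  - now apply Cminus_neq0.
  - intros w Hw. split; [auto|]. eapply Rle_trans; [apply (Cmod_split w (a, c))|].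
    apply Rplus_le_compat_r. eapply Rle_trans; [apply Cmod_le_abs|].
    destruct w as [x1 y1]. destruct Hw as [Hw1 [Hw2 _]]; unfold Re, Im in *; simpl in *.
    apply Rplus_le_compat; apply Rabs_le; lra.
Qed.

Lemma schwarz_two_nodes (f : C -> C) (a b c d x0 y0 m : R) (x y : C) :
  (a < x0 < b)%R -> (c < y0 < d)%R -> holo_on f a b c d ->
  f x = 0 -> f y = 0 -> x <> y -> 
  ~ on_boundary a b c d x -> ~ on_boundary a b c d y ->
  (forall w, on_boundary a b c d w -> (Cmod (f w) <= m * (Cmod (w - x) * Cmod (w - y)))%R) ->
  (Cmod (f (x0, y0)) <= m * (Cmod ((x0, y0) - x) * Cmod ((x0, y0) - y)))%R.
Proof.
  intros Hx Hy Hf Ux Uy Nxy Bx By Hb.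
  destruct (classic (((x0, y0) : C) = x)) as [->|N1].
  { rewrite Ux. replace (x - x) with (RtoC 0) by ring. rewrite Cmod_0. lra. }
  destruct (classic (((x0, y0) : C) = y)) as [->|N2].
  { rewrite Uy. replace (y - y) with (RtoC 0) by ring. rewrite Cmod_0. lra. }
  assert (Hid : forall p z, holo (fun w => w - p) z).
  { intros. apply holo_minus; [apply holo_id|apply holo_const]. }
  enough (E : (Cmod (f (x0, y0) / ((x0, y0) - x) * / ((x0, y0) - y)) <= m)%R).
  { unfold Cdiv in E. rewrite !Cmod_mult, !Cmod_inv in E by now apply Cminus_neq0.
    pose proof (Cmod_pos_neq _ _ N1) as P1. pose proof (Cmod_pos_neq _ _ N2) as P2.
    set (p := Cmod ((x0, y0) - x)) in *. set (q := Cmod ((x0, y0) - y)) in *.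
    replace (Cmod (f (x0, y0))) with (Cmod (f (x0, y0)) * / p * / q * (p * q))%R by (field; lra).
    apply Rmult_le_compat_r; [|exact E]. apply Rmult_le_pos; lra. }
  set (S := ((b - a) + (d - c))%R).
  assert (Bd : forall p w, on_boundary a b c d w -> (Cmod (w - p) <= S + Cmod ((a, c) - p))%R).
  { intros p w Hw. eapply Rle_trans; [apply (Cmod_split w (a, c))|].
    apply Rplus_le_compat_r. eapply Rle_trans; [apply Cmod_le_abs|].
    destruct w as [x1 y1]. destruct Hw as [Hw1 [Hw2 _]]; unfold Re, Im, S in *; simpl in *.
    apply Rplus_le_compat; apply Rabs_le; lra. }
  apply (max_principle_weighted (fun w => f w / (w - x) * / (w - y)) (fun w => (w - x) * (w - y))
    a b c d x0 y0 m ((S + Cmod ((a, c) - x)) * (S + Cmod ((a, c) - y)))); auto.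
  - intros n u v h1 h2. destruct (classic (((u, v) : C) = x)) as [E1|n1].
    { rewrite <- E1 in *. apply holo_node; auto; apply holo_ccont; auto.
      apply holo_inv; auto. now apply Cminus_neq0. }
    destruct (classic (((u, v) : C) = y)) as [E1|n2].
    { rewrite <- E1 in *.
      apply (holo_ext_loc (fun w => (w - (u, v)) * (w - x) * (f w / (w - (u, v)) * / (w - x)) ^ n) _ _ 1);
        [lra|intros; unfold Cdiv; f_equal; [ring|f_equal; ring]|].
      apply holo_node; auto; apply holo_ccont; auto.
      apply holo_inv; auto. apply Cminus_neq0. auto. }
    apply holo_mult; [now apply holo_mult|]. apply holo_pow.
    apply holo_mult; [apply holo_div; auto; now apply Cminus_neq0|].
    apply holo_inv; auto. now apply Cminus_neq0.
  - apply Cmult_neq_0; now apply Cminus_neq0.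
  - intros w Hw. split.
    + assert (n1 : w <> x) by (intros ->; contradiction).
      assert (n2 : w <> y) by (intros ->; contradiction).
      unfold Cdiv. rewrite !Cmod_mult, !Cmod_inv by now apply Cminus_neq0.
      pose proof (Cmod_pos_neq _ _ n1) as P1. pose proof (Cmod_pos_neq _ _ n2) as P2.
      specialize (Hb w Hw).
      set (p := Cmod (w - x)) in *. set (q := Cmod (w - y)) in *.
      apply Rmult_le_reg_r with (p * q)%R; [now apply Rmult_lt_0_compat|].
      replace (Cmod (f w) * / p * / q * (p * q))%R with (Cmod (f w)) by (field; lra). exact Hb.
    + rewrite Cmod_mult. apply Rmult_le_compat; auto using Cmod_ge_0.
Qed.

(** * The Schwarz-Pick inequality in the half-plane *)

(** Turns the pseudo-hyperbolic distance of the half-plane, the modulus of (p - q) / (p + conj q),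
    into an expression in [Cmod (p - q)] and the product of the real parts. *)
Lemma Cmod_plus_conj (p q : C) :
  (Cmod (p + Cconj q) ^ 2 = Cmod (p - q) ^ 2 + 4 * (Re p * Re q))%R.
Proof. rewrite !Cmod2_alt. destruct p, q; unfold Re, Im; simpl. ring. Qed.

Lemma Cmod_le_sq (z w : C) : (Cmod z ^ 2 <= Cmod w ^ 2)%R -> (Cmod z <= Cmod w)%R.
Proof. intros H. pose proof (Cmod_ge_0 z). pose proof (Cmod_ge_0 w). nra. Qed.

Lemma Re_le (z : C) : (Re z <= Cmod z)%R.
Proof. eapply Rle_trans; [apply Rle_abs|apply re_le_Cmod]. Qed.

Lemma Re_plus (z w : C) : Re (z + w) = (Re z + Re w)%R.
Proof. reflexivity. Qed.

Lemma Re_minus (z w : C) : Re (z - w) = (Re z - Re w)%R.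
Proof. reflexivity. Qed.

(** The Blaschke quotient of [f] at [f a], divided by that of the identity at [a], is bounded by
    [sqrt (1 + k)] on the boundary of a large rectangle in the half-plane; then [k] tends to 0. *)
Lemma schwarz_pick_strict (f : C -> C) (a b : C) :
  (forall w, 0 < Re w -> holo f w) -> (forall w, 0 < Re w -> 0 < Re (f w)) ->
  0 < Re a -> 0 < Re b ->
  (Cmod (f a - f b) ^ 2 * (Re a * Re b) <= Cmod (a - b) ^ 2 * (Re (f a) * Re (f b)))%R.
Proof.
  intros Hf Hp Ha Hb.
  destruct (classic (b = a)) as [->|N].
  { replace (f a - f a) with (RtoC 0) by ring. replace (a - a) with (RtoC 0) by ring.
    rewrite Cmod_0. nra. }
  set (al := Re a) in *.
  assert (Den : forall w, 0 < Re w -> f w + Cconj (f a) <> 0).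
  { intros w Hw E. apply (f_equal Re) in E. unfold Cconj in E; simpl in E.
    pose proof (Hp w Hw). pose proof (Hp a Ha). unfold Re in *; simpl in *. lra. }
  assert (K : forall k, (0 < k)%R ->
    (Cmod (f b - f a) ^ 2 * Cmod (b + Cconj a) ^ 2
     <= (1 + k) * (Cmod (b - a) ^ 2 * Cmod (f b + Cconj (f a)) ^ 2))%R).
  { intros k Hk.
    (* On the side near the imaginary axis the distance to [a] is at least [al / 2], and
       [eta <= k * al / 16] gives [4 * eta * al <= k * (al / 2) ^ 2]. *)
    set (eta := (Rmin (Rmin (al / 2) (k * al / 16)) (Re b / 2))%R).
    assert (He : 0 < eta /\ (eta <= al / 2)%R /\ (eta <= k * al / 16)%R /\ (eta <= Re b / 2)%R).
    { unfold eta. repeat split.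
      - repeat apply Rmin_pos; try lra. assert (0 < k * al)%R by now apply Rmult_lt_0_compat. lra.
      - eapply Rle_trans; [apply Rmin_l|apply Rmin_l].
      - eapply Rle_trans; [apply Rmin_l|apply Rmin_r].
      - apply Rmin_r. }
    clearbody eta. destruct He as [He0 [He1 [He2 He3]]].
    assert (PX : (0 <= 8 * al / k)%R) by (apply Rdiv_le_0_compat; lra).
    (* On the other three sides the distance to [a] is at least [X] and the real part at most
       [2 * X], so [8 * al <= k * X] is enough. *)
    set (X := (al + 8 * al / k + Cmod (b - a) + 1)%R).
    pose proof (Cmod_ge_0 (b - a)) as Pba.
    assert (kX : (8 * al <= k * X)%R).
    { apply Rle_trans with (k * (8 * al / k))%R; [right; field; lra|]. unfold X.
      apply Rmult_le_compat_l; lra. }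
    assert (Bre : (Rabs (Re (b - a)) <= Cmod (b - a))%R) by apply re_le_Cmod.
    assert (Bim : (Rabs (Im (b - a)) <= Cmod (b - a))%R).
    { eapply Rle_trans; [apply (Rmax_r (Rabs (fst (b - a))))|apply Rmax_Cmod]. }
    apply Rabs_le_between in Bre, Bim.
    assert (Eb : ((Re b, Im b) : C) = b) by now destruct b.
    pose proof (schwarz_one_node (fun w => (f w - f a) / (f w + Cconj (f a))) (fun w => w + Cconj a)
      eta (al + X) (Im a - X) (Im a + X) (Re b) (Im b) (sqrt (1 + k)) a) as S.
    cbv beta in S. rewrite Eb in S.
    assert (S' : (Cmod ((f b - f a) / (f b + Cconj (f a)) / (b - a) * (b + Cconj a)) <= sqrt (1 + k))%R).
    { apply S; clear S.
      - rewrite Re_minus in Bre. fold al in Bre. unfold X. lra.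
      - replace (Im (b - a)) with (Im b - Im a)%R in Bim by reflexivity. unfold X. lra.
      - intros x y h1 h2.
        assert (Hw : 0 < Re (x, y)) by (unfold Re; simpl; lra).
        apply holo_div; [|
          |apply Den, Hw].
        + apply holo_minus; [apply Hf, Hw|apply holo_const].
        + apply holo_plus; [apply Hf, Hw|apply holo_const].
      - intros x y h1 h2. apply holo_plus; [apply holo_id|apply holo_const].
      - unfold Cdiv. ring.
      - exact N.
      - intros w Hw.
        assert (Hw0 : 0 < Re w) by (destruct Hw as [Hw _]; lra).
        assert (Bd : (4 * (Re w * al) <= k * Cmod (w - a) ^ 2)%R).
        { assert (Far : (X <= Cmod (w - a))%R -> (Re w <= al + X)%R ->
            (4 * (Re w * al) <= k * Cmod (w - a) ^ 2)%R).
          { intros h1 h2. assert (0 < X)%R by (unfold X; lra).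
            apply Rle_trans with (k * X ^ 2)%R.
            - apply Rle_trans with (8 * al * X)%R; [|nra].
              assert (Re w <= 2 * X)%R by (unfold X in *; lra). nra.
            - apply Rmult_le_compat_l; [lra|]. apply pow_incr. lra. }
          destruct Hw as [Hw1 [Hw2 [Hw3|Hw3]]].
          - rewrite Hw3. rewrite Cmod2_alt.
            assert (al ^ 2 / 4 <= Re (w - a) ^ 2)%R.
            { rewrite Re_minus, Hw3. fold al. nra. }
            apply Rle_trans with (k * (al ^ 2 / 4))%R; [nra|].
            apply Rmult_le_compat_l; [lra|]. pose proof (pow2_ge_0 (Im (w - a))). lra.
          - apply Far; [|lra].
            eapply Rle_trans; [|apply Rmax_Cmod]. destruct w as [x y], a as [a1 a2].
            unfold al, Re, Im in *; simpl in *.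
            destruct Hw3 as [h3|[h3|h3]]; rewrite h3.
            + eapply Rle_trans; [|apply Rmax_l]. eapply Rle_trans; [|apply Rle_abs]. lra.
            + eapply Rle_trans; [|apply Rmax_r]. rewrite <- Rabs_Ropp.
              eapply Rle_trans; [|apply Rle_abs]. lra.
            + eapply Rle_trans; [|apply Rmax_r]. eapply Rle_trans; [|apply Rle_abs]. lra. }
        assert (Nw : w <> a).
        { intros ->. replace (a - a) with (RtoC 0) in Bd by ring. rewrite Cmod_0 in Bd. fold al in Bd. nra. }
        pose proof (Cmod_pos_neq _ _ Nw) as Pw.
        pose proof (Den w Hw0) as Dw. apply Cmod_gt_0 in Dw as Pd.
        assert (L1 : (Cmod (f w - f a) <= Cmod (f w + Cconj (f a)))%R).
        { apply Cmod_le_sq. rewrite Cmod_plus_conj. pose proof (Hp w Hw0). pose proof (Hp a Ha). nra. }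
        assert (L2 : (Cmod (w + Cconj a) <= sqrt (1 + k) * Cmod (w - a))%R).
        { apply Rsqr_incr_0_var; [|apply Rmult_le_pos; [apply sqrt_pos|lra]].
          rewrite Rsqr_mult, Rsqr_sqrt by lra. unfold Rsqr.
          pose proof (Cmod_plus_conj w a) as E. fold al in E. nra. }
        unfold Cdiv. rewrite !Cmod_mult, !Cmod_inv by (try apply Cminus_neq0; auto).
        set (u1 := Cmod (f w - f a)) in *. set (u2 := Cmod (f w + Cconj (f a))) in *.
        set (u3 := Cmod (w - a)) in *. set (u4 := Cmod (w + Cconj a)) in *.
        replace (u1 * / u2 * / u3 * u4)%R with ((u1 / u2) * (u4 / u3))%R by (field; lra).
        rewrite <- (Rmult_1_l (sqrt (1 + k))). 
        assert (0 <= u1)%R by apply Cmod_ge_0. assert (0 <= u4)%R by apply Cmod_ge_0.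
        apply Rmult_le_compat.
        + apply Rdiv_le_0_compat; lra.
        + apply Rdiv_le_0_compat; lra.
        + apply Rle_div_l; lra.
        + apply Rle_div_l; lra. }
    clear S. pose proof (Den b Hb) as Db. apply Cmod_gt_0 in Db as Pd.
    pose proof (Cmod_pos_neq _ _ N) as Pb.
    unfold Cdiv in S'. rewrite !Cmod_mult, !Cmod_inv in S' by (try apply Cminus_neq0; auto).
    set (u1 := Cmod (f b - f a)) in *. set (u2 := Cmod (f b + Cconj (f a))) in *.
    set (u3 := Cmod (b - a)) in *. set (u4 := Cmod (b + Cconj a)) in *.
    assert (0 <= u1)%R by apply Cmod_ge_0. assert (0 <= u4)%R by apply Cmod_ge_0.
    assert (S2 : (u1 * u4 <= sqrt (1 + k) * (u3 * u2))%R).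
    { replace (u1 * u4)%R with (u1 * / u2 * / u3 * u4 * (u3 * u2))%R by (field; lra).
      apply Rmult_le_compat_r; [nra|exact S']. }
    assert (S3 : ((u1 * u4) ^ 2 <= (sqrt (1 + k) * (u3 * u2)) ^ 2)%R) by (apply pow_incr; nra).
    rewrite !Rpow_mult_distr in S3. rewrite <- (Rsqr_pow2 (sqrt _)), Rsqr_sqrt in S3 by lra. lra. }
  assert (K0 : (Cmod (f b - f a) ^ 2 * Cmod (b + Cconj a) ^ 2
     <= Cmod (b - a) ^ 2 * Cmod (f b + Cconj (f a)) ^ 2)%R).
  { set (Y := (Cmod (b - a) ^ 2 * Cmod (f b + Cconj (f a)) ^ 2)%R) in *.
    assert (0 <= Y)%R by (unfold Y; apply Rmult_le_pos; apply pow2_ge_0).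
    apply le_epsilon. intros e He. eapply Rle_trans; [apply (K (e / (Y + 1))%R)|].
    - apply Rdiv_lt_0_compat; lra.
    - assert (e / (Y + 1) * Y <= e)%R; [|lra].
      apply Rmult_le_reg_r with (Y + 1)%R; [lra|].
      replace (e / (Y + 1) * Y * (Y + 1))%R with (e * Y)%R by (field; lra). nra. }
  rewrite !Cmod_plus_conj in K0. rewrite (Cmod_sym (f a)), (Cmod_sym a).
  fold al in K0. nra.
Qed.

Lemma schwarz_pick (f : C -> C) (a b : C) :
  (forall w, 0 < Re w -> holo f w) -> (forall w, 0 < Re w -> 0 <= Re (f w)) ->
  0 < Re a -> 0 < Re b ->
  (Cmod (f a - f b) ^ 2 * (Re a * Re b) <= Cmod (a - b) ^ 2 * (Re (f a) * Re (f b)))%R.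
Proof.
  intros Hf Hp Ha Hb.
  set (u := Re (f a)). set (v := Re (f b)). set (D := (Cmod (a - b) ^ 2)%R).
  assert (0 <= u)%R by (apply Hp, Ha). assert (0 <= v)%R by (apply Hp, Hb).
  assert (0 <= D)%R by apply pow2_ge_0.
  apply le_epsilon. intros e He.
  set (A := (D * (u + v + 1) + 1)%R). assert (1 <= A)%R by (unfold A; nra).
  set (t := Rmin 1 (e / A)). assert (Ht : 0 < t) by (apply Rmin_pos; [lra|apply Rdiv_lt_0_compat; lra]).
  assert (t <= 1)%R by apply Rmin_l.
  assert (t * A <= e)%R.
  { replace e with (e / A * A)%R by (field; lra). apply Rmult_le_compat_r; [lra|apply Rmin_r]. }
  pose proof (schwarz_pick_strict (fun w => f w + t) a b) as K. cbv beta in K.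
  replace (f a + t - (f b + t)) with (f a - f b) in K by ring.
  rewrite !Re_plus in K. unfold RtoC in K. simpl (Re (_, _)) in K. fold u v D in K.
  eapply Rle_trans; [apply K; auto|].
  - intros w Hw. apply holo_plus; [auto|apply holo_const].
  - intros w Hw. rewrite Re_plus. specialize (Hp w Hw). simpl. lra.
  - unfold A in *. clearbody t. unfold Re; simpl.
    assert (D * ((u + t) * (v + t)) <= D * (u * v + t * (u + v + 1)))%R.
    { apply Rmult_le_compat_l; [lra|]. nra. }
    nra.
Qed.

(** * A Bloch-type theorem and interpolation *)

(** The supremum norm, whose balls are squares. *)
Definition Cmax (w : C) : R := Rmax (Rabs (Re w)) (Rabs (Im w)).

Lemma Cmax_le_iff (w : C) (r : R) :
  (Cmax w <= r)%R <-> (- r <= Re w <= r)%R /\ (- r <= Im w <= r)%R.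
Proof.
  unfold Cmax. split.
  - intros H. split; apply Rabs_le_between; eapply Rle_trans; eauto; [apply Rmax_l|apply Rmax_r].
  - intros [H1 H2]. apply Rmax_lub; now apply Rabs_le_between.
Qed.

Lemma Cmax_lt_iff (w : C) (r : R) :
  (Cmax w < r)%R <-> (- r < Re w < r)%R /\ (- r < Im w < r)%R.
Proof.
  unfold Cmax. split.
  - intros H. split; apply Rabs_lt_between; eapply Rle_lt_trans; eauto; [apply Rmax_l|apply Rmax_r].
  - intros [H1 H2]. apply Rmax_lub_lt; now apply Rabs_lt_between.
Qed.

Lemma Cmax_ge_0 (w : C) : (0 <= Cmax w)%R.
Proof. unfold Cmax. eapply Rle_trans; [apply Rabs_pos|apply Rmax_l]. Qed.

Lemma Cmax_0 : Cmax 0 = 0%R.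
Proof. unfold Cmax, Re, Im; simpl. rewrite Rabs_R0. apply Rmax_left; lra. Qed.

Lemma Cmax_le_Cmod (w : C) : (Cmax w <= Cmod w)%R.
Proof. apply Rmax_Cmod. Qed.

Lemma Cmod_le_2Cmax (w : C) : (Cmod w <= 2 * Cmax w)%R.
Proof.
  eapply Rle_trans; [apply Cmod_le_abs|]. unfold Cmax.
  pose proof (Rmax_l (Rabs (Re w)) (Rabs (Im w))). pose proof (Rmax_r (Rabs (Re w)) (Rabs (Im w))). lra.
Qed.

Lemma Cmax_plus (z w : C) : (Cmax (z + w) <= Cmax z + Cmax w)%R.
Proof.
  unfold Cmax, Re, Im; simpl. apply Rmax_lub; (eapply Rle_trans; [apply Rabs_triang|]);
    apply Rplus_le_compat; try apply Rmax_l; apply Rmax_r.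
Qed.

Lemma Cmax_split (z w u : C) : (Cmax (z - u) <= Cmax (z - w) + Cmax (w - u))%R.
Proof. replace (z - u) with ((z - w) + (w - u)) by ring. apply Cmax_plus. Qed.

Lemma Cmax_opp (w : C) : Cmax (- w) = Cmax w.
Proof. unfold Cmax, Re, Im; simpl. now rewrite !Rabs_Ropp. Qed.

Lemma Cmax_sym (z w : C) : Cmax (z - w) = Cmax (w - z).
Proof. rewrite <- Cmax_opp. f_equal. ring. Qed.

Lemma Cmax_scal (t : R) (w : C) : (0 <= t)%R -> Cmax (t * w) = (t * Cmax w)%R.
Proof.
  intros Ht. unfold Cmax, Re, Im; simpl.
  replace (t * fst w - 0 * snd w)%R with (t * fst w)%R by ring.
  replace (t * snd w + 0 * fst w)%R with (t * snd w)%R by ring.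
  rewrite !Rabs_mult, (Rabs_pos_eq t Ht). now rewrite RmaxRmult.
Qed.

Definition holo_box (f : C -> C) (a : C) (r : R) : Prop :=
  forall w, (Cmax (w - a) <= r)%R -> holo f w.

Lemma holo_box_on (f : C -> C) (a : C) (r : R) :
  holo_box f a r -> holo_on f (Re a - r) (Re a + r) (Im a - r) (Im a + r).
Proof.
  intros H x y Hx Hy. apply H. apply Cmax_le_iff. unfold Re, Im in *; simpl. lra.
Qed.

Lemma boundary_box (a w : C) (r : R) :
  (0 <= r)%R -> on_boundary (Re a - r) (Re a + r) (Im a - r) (Im a + r) w -> Cmax (w - a) = r.
Proof.
  intros Hr [H1 [H2 H3]]. apply Rle_antisym.
  - apply Cmax_le_iff. unfold Re, Im in *; simpl. lra.
  - apply Rnot_lt_le. intros H. apply Cmax_lt_iff in H. unfold Re, Im in *; simpl in *. lra.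
Qed.

Lemma box_coord (a z : C) (r : R) : (Cmax (z - a) < r)%R ->
  (Re a - r < Re z < Re a + r)%R /\ (Im a - r < Im z < Im a + r)%R.
Proof. intros H. apply Cmax_lt_iff in H. unfold Re, Im in *; simpl in *. lra. Qed.

Lemma C_eta (z : C) : (Re z, Im z) = z.
Proof. now destruct z. Qed.

Lemma one_node_box (f : C -> C) (a x z : C) (r m : R) :
  holo_box f a r -> f x = 0 -> z <> x -> (Cmax (z - a) < r)%R ->
  (forall w, Cmax (w - a) = r -> (Cmod (f w / (w - x)) <= m)%R) ->
  (Cmod (f z / (z - x)) <= m)%R.
Proof.
  intros Hf Ux N Hz Hb. apply box_coord in Hz as Hz'.
  pose proof (Cmax_ge_0 (z - a)).
  replace (f z / (z - x)) with (f z / (z - x) * 1) by ring. rewrite <- (C_eta z).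
  apply (schwarz_one_node f (fun _ => 1) (Re a - r) (Re a + r) (Im a - r) (Im a + r));
    try (apply Hz'); auto.
  - now apply holo_box_on.
  - intros u v _ _. apply holo_const.
  - now rewrite C_eta.
  - intros w Hw. rewrite Cmult_1_r. apply Hb. apply boundary_box; [lra|auto].
Qed.

Lemma two_nodes_box (f : C -> C) (a x y z : C) (r m : R) :
  holo_box f a r -> f x = 0 -> f y = 0 -> x <> y ->
  (Cmax (x - a) < r)%R -> (Cmax (y - a) < r)%R -> (Cmax (z - a) < r)%R ->
  (forall w, Cmax (w - a) = r -> (Cmod (f w) <= m * (Cmod (w - x) * Cmod (w - y)))%R) ->
  (Cmod (f z) <= m * (Cmod (z - x) * Cmod (z - y)))%R.
Proof.
  intros Hf Ux Uy N Hx Hy Hz Hb. apply box_coord in Hz as Hz'.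
  pose proof (Cmax_ge_0 (z - a)). rewrite <- (C_eta z).
  apply (schwarz_two_nodes f (Re a - r) (Re a + r) (Im a - r) (Im a + r));
    try (apply Hz'); auto.
  - now apply holo_box_on.
  - intros B. apply boundary_box in B; lra.
  - intros B. apply boundary_box in B; lra.
  - intros w Hw. apply Hb. apply boundary_box; [lra|auto].
Qed.

Lemma value_attained_box (f : C -> C) (a v : C) (r rho : R) :
  (0 < r)%R -> holo_box f a r -> (0 < rho)%R ->
  (forall w, Cmax (w - a) = r -> (rho <= Cmod (f w - v))%R) ->
  (Cmod (f a - v) < rho)%R ->
  exists w, (Cmax (w - a) <= r)%R /\ f w = v.
Proof.
  intros Hr Hf Hrho Hb Ha.
  destruct (value_attained f (Re a - r) (Re a + r) (Im a - r) (Im a + r) (Re a) (Im a) rho v)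
    as [x [y [Hx [Hy E]]]]; auto; try lra.
  - now apply holo_box_on.
  - intros w Hw. apply Hb. apply boundary_box; [lra|auto].
  - now rewrite C_eta.
  - exists (x, y). split; [|exact E]. apply Cmax_le_iff. unfold Re, Im in *; simpl. lra.
Qed.

Lemma holo_box_bounded (f : C -> C) (a : C) (r : R) :
  (0 <= r)%R -> holo_box f a r -> exists M, forall w, (Cmax (w - a) <= r)%R -> (Cmod (f w) <= M)%R.
Proof.
  intros Hr Hf.
  assert (K : exists M, forall w, (Re a - r <= Re w <= Re a + r)%R -> (Im a - r <= Im w <= Im a + r)%R ->
    (Cmod (f w) <= M)%R).
  { apply (cousin_rect (fun a' b' c' d' => exists M, forall w, (a' <= Re w <= b')%R -> (c' <= Im w <= d')%R ->
      (Cmod (f w) <= M)%R)); try lra.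
    - intros a1 b1 c1 d1 h1 h2 [M1 k1] [M2 k2] [M3 k3] [M4 k4].
      exists (Rmax (Rmax M1 M2) (Rmax M3 M4)). intros w w1 w2.
      pose proof (Rmax_l M1 M2). pose proof (Rmax_r M1 M2).
      pose proof (Rmax_l M3 M4). pose proof (Rmax_r M3 M4).
      pose proof (Rmax_l (Rmax M1 M2) (Rmax M3 M4)). pose proof (Rmax_r (Rmax M1 M2) (Rmax M3 M4)).
      destruct (Rle_or_lt (Re w) ((a1 + b1) / 2)); destruct (Rle_or_lt (Im w) ((c1 + d1) / 2)).
      + specialize (k1 w ltac:(lra) ltac:(lra)). lra.
      + specialize (k2 w ltac:(lra) ltac:(lra)). lra.
      + specialize (k3 w ltac:(lra) ltac:(lra)). lra.
      + specialize (k4 w ltac:(lra) ltac:(lra)). lra.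
    - intros u v Hu Hv. assert (Hz : holo f (u, v)).
      { apply Hf. apply Cmax_le_iff. unfold Re, Im in *; simpl. lra. }
      apply holo_ccont in Hz. destruct (Hz 1%R ltac:(lra)) as [del [Hd K]].
      exists (del / 2)%R. split; [lra|]. intros a1 b1 c1 d1 h1 h2 h3 h4 h5 h6.
      exists (Cmod (f (u, v)) + 1)%R. intros w w1 w2.
      assert (D : (Cmod (w - (u, v)) < del)%R).
      { eapply Rle_lt_trans; [apply Cmod_le_abs|]. unfold Re, Im in *; simpl.
        assert (Rabs (fst w + - u) < del / 2)%R by (apply Rabs_lt_between; lra).
        assert (Rabs (snd w + - v) < del / 2)%R by (apply Rabs_lt_between; lra). lra. }
      specialize (K w D). pose proof (Cmod_triangle_inv (f w) (f (u, v))). lra. }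
  destruct K as [M K]. exists M. intros w Hw. apply Cmax_le_iff in Hw.
  apply K; unfold Re, Im in *; simpl in *; lra.
Qed.

Lemma chain_bound (g : nat -> C) (B : R) (n : nat) :
  (forall j, (j < n)%nat -> (Cmod (g (S j) - g j) <= B)%R) ->
  (Cmod (g n - g 0%nat) <= INR n * B)%R.
Proof.
  induction n; intros H.
  - simpl. replace (g 0%nat - g 0%nat) with (RtoC 0) by ring. rewrite Cmod_0. lra.
  - rewrite S_INR. eapply Rle_trans; [apply (Cmod_split _ (g n))|].
    specialize (H n ltac:(lia)) as H1. specialize (IHn ltac:(intros; apply H; lia)). lra.
Qed.

(* A Bloch-type theorem: if [f] oscillated too much, its image would contain a disc of
   radius greater than 1, hence two values differing by 1. The box of nearly maximal
   relative oscillation plays the role of the point maximizing |f'| in Bloch's proof. *)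
Lemma oscillation_bound (f : C -> C) (a : C) (rho : R) :
  (0 < rho)%R -> holo_box f a rho ->
  (forall b b', (Cmax (b - a) <= rho)%R -> (Cmax (b' - a) <= rho)%R -> f b' <> f b + 1) ->
  forall z, (Cmax (z - a) <= rho / 4)%R -> (Cmod (f z - f a) <= 24000)%R.
Proof.
  intros Hrho Hf NG.
  destruct (holo_box_bounded f a rho ltac:(lra) Hf) as [M0 HM].
  (* Oscillation is measured on squares whose size is proportional to the distance of the centre [b]
     from the boundary, as (1 - |z|) |f'(z)| is in Bloch's theorem. A nearly extremal [b] then
     controls [f] at all neighbouring centres. *)
  set (E := fun s => exists b z, (Cmax (b - a) < rho)%R /\
    (Cmax (z - b) <= (rho - Cmax (b - a)) / 4)%R /\ s = Cmod (f z - f b)).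
  assert (Ha0 : Cmax (a - a) = 0%R) by (replace (a - a) with (RtoC 0) by ring; apply Cmax_0).
  destruct (completeness E) as [S [HS1 HS2]].
  { exists (M0 + M0)%R. intros s [b [z [h1 [h2 ->]]]].
    pose proof (Cmax_split z b a). pose proof (Cmax_ge_0 (b - a)).
    pose proof (Cmod_minus_le (f z) (f b)).
    pose proof (HM z ltac:(lra)). pose proof (HM b ltac:(lra)). lra. }
  { exists (Cmod (f a - f a)). exists a, a. rewrite Ha0. repeat split; lra. }
  assert (Osc : forall b z, (Cmax (b - a) < rho)%R -> (Cmax (z - b) <= (rho - Cmax (b - a)) / 4)%R ->
    (Cmod (f z - f b) <= S)%R).
  { intros b z h1 h2. apply HS1. exists b, z. auto. }
  enough (HS : (S <= 24000)%R).
  { intros z Hz. eapply Rle_trans; [apply Osc|exact HS]; rewrite Ha0; lra. }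
  apply Rnot_lt_le. intros HS.
  assert (Ex : exists b z, (Cmax (b - a) < rho)%R /\ (Cmax (z - b) <= (rho - Cmax (b - a)) / 4)%R /\
    (S / 2 < Cmod (f z - f b))%R).
  { apply NNPP. intros N. assert (S <= S / 2)%R; [|lra]. apply HS2. intros s [b [z [h1 [h2 ->]]]].
    apply Rnot_lt_le. intros h3. apply N. exists b, z. auto. }
  destruct Ex as [b [z [Hb [Hz Hbz]]]].
  set (t := (rho - Cmax (b - a))%R) in *. assert (Ht : (0 < t)%R) by (unfold t; lra).
  assert (Hbb : Cmax (b - b) = 0%R) by (replace (b - b) with (RtoC 0) by ring; apply Cmax_0).
  (* Four equal steps lead from [b] to [w]. Each has size at most [t / 8], a quarter of the distance
     to the boundary still guaranteed within [t / 2] of [b]. *)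
  assert (In : forall w, (Cmax (w - b) <= t / 2)%R -> (Cmod (f w - f b) <= 4 * S)%R).
  { intros w Hw.
    pose proof (chain_bound (fun j => f (b + (INR j / 4)%R * (w - b))) S 4) as K. cbv beta in K.
    replace (b + (INR 4 / 4)%R * (w - b)) with w in K
      by (replace (INR 4 / 4)%R with 1%R by (simpl; field); ring).
    replace (b + (INR 0 / 4)%R * (w - b)) with b in K
      by (replace (INR 0 / 4)%R with 0%R by (simpl; field); ring).
    replace (INR 4) with 4%R in K by (simpl; ring). apply K. clear K.
    intros j Hj. assert (Hj' : (0 <= INR j <= 3)%R).
    { split; [apply pos_INR|]. replace 3%R with (INR 3) by (simpl; ring). apply le_INR. lia. }
    assert (D : (Cmax (b + (INR j / 4)%R * (w - b) - b) <= t / 2)%R).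
    { replace (b + (INR j / 4)%R * (w - b) - b) with ((INR j / 4)%R * (w - b)) by ring.
      rewrite Cmax_scal by lra. pose proof (Cmax_ge_0 (w - b)). nra. }
    pose proof (Cmax_split (b + (INR j / 4)%R * (w - b)) b a) as D2.
    apply Osc; [unfold t in *; lra|].
    replace (b + (INR (Datatypes.S j) / 4)%R * (w - b) - (b + (INR j / 4)%R * (w - b)))
      with ((1 / 4)%R * (w - b)).
    - rewrite Cmax_scal by lra. unfold t in *. lra.
    - rewrite S_INR. replace ((INR j + 1) / 4)%R with (1 / 4 + INR j / 4)%R by field.
      rewrite RtoC_plus. ring. }
  (* The segment from [b] to [z] is cut into [n] pieces, one of which carries at least the average
     variation. With [n > 3000] this piece is so short that the secant through its ends [x], [y]
     approximates [f] on the square of radius [t / 6000] around [x]. *)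
  destruct (INR_unbounded 3000) as [n Hn].
  assert (Pn : (0 < INR n)%R) by lra.
  set (g := fun j => b + (INR j / INR n)%R * (z - b)).
  assert (Ex : exists j, (j < n)%nat /\ (S / (2 * INR n) < Cmod (f (g (Datatypes.S j)) - f (g j)))%R).
  { apply NNPP. intros N.
    pose proof (chain_bound (fun j => f (g j)) (S / (2 * INR n)) n) as K. cbv beta in K.
    replace (g n) with z in K
      by (unfold g; replace (INR n / INR n)%R with 1%R by (field; lra); ring).
    replace (g 0%nat) with b in K
      by (unfold g; replace (INR 0 / INR n)%R with 0%R by (simpl; field; lra); ring).
    assert (Cmod (f z - f b) <= INR n * (S / (2 * INR n)))%R.
    { apply K. intros j Hj. apply Rnot_lt_le. intros h. apply N. exists j. auto. }
    replace (INR n * (S / (2 * INR n)))%R with (S / 2)%R in H by (field; lra). lra. }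
  destruct Ex as [j [Hj Hxy]]. set (x := g j) in *. set (y := g (Datatypes.S j)) in *.
  assert (G : forall i, (i <= n)%nat -> (Cmax (g i - b) <= t / 4)%R).
  { intros i Hi. unfold g. apply le_INR in Hi. pose proof (pos_INR i).
    assert (0 <= INR i / INR n <= 1)%R.
    { split; [apply Rdiv_le_0_compat; lra|apply Rle_div_l; lra]. }
    replace (b + (INR i / INR n)%R * (z - b) - b) with ((INR i / INR n)%R * (z - b)) by ring.
    rewrite Cmax_scal by lra. pose proof (Cmax_ge_0 (z - b)). nra. }
  assert (Hx : (Cmax (x - b) <= t / 4)%R) by (apply G; lia).
  assert (Hy : (Cmax (y - b) <= t / 4)%R) by (apply G; lia).
  assert (Nxy : y <> x).
  { intros e. rewrite e in Hxy. replace (f x - f x) with (RtoC 0) in Hxy by ring.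
    rewrite Cmod_0 in Hxy. assert (0 < S / (2 * INR n))%R by (apply Rdiv_lt_0_compat; lra). lra. }
  assert (Dxy : (Cmod (y - x) <= t / (2 * INR n))%R).
  { eapply Rle_trans; [apply Cmod_le_2Cmax|]. unfold x, y, g.
    replace (b + (INR (Datatypes.S j) / INR n)%R * (z - b) - (b + (INR j / INR n)%R * (z - b)))
      with ((1 / INR n)%R * (z - b)).
    - rewrite Cmax_scal by (apply Rdiv_le_0_compat; lra).
      replace (t / (2 * INR n))%R with (2 * (1 / INR n * (t / 4)))%R by (field; lra).
      apply Rmult_le_compat_l; [lra|]. apply Rmult_le_compat_l; [|exact Hz].
      apply Rdiv_le_0_compat; lra.
    - rewrite S_INR. replace ((INR j + 1) / INR n)%R with (1 / INR n + INR j / INR n)%R by (field; lra).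
      rewrite RtoC_plus. ring. }
  pose proof (Cmod_pos_neq _ _ Nxy) as Pyx.
  set (s := (f y - f x) / (y - x)).
  assert (Hfb : holo_box f b (t / 2)).
  { intros w Hw. apply Hf. pose proof (Cmax_split w b a). unfold t in *. lra. }
  assert (Slo : (S / t <= Cmod s)%R).
  { unfold s. rewrite Cmod_div by now apply Cminus_neq0.
    apply (proj1 (Rle_div_r _ _ _ Pyx)). eapply Rle_trans; [|apply Rlt_le, Hxy].
    replace (S / (2 * INR n))%R with (S / t * (t / (2 * INR n)))%R by (field; lra).
    apply Rmult_le_compat_l; [apply Rdiv_le_0_compat; lra|exact Dxy]. }
  assert (Fx : forall w, Cmax (w - b) = (t / 2)%R -> (Cmod (f w - f x) <= 8 * S)%R).
  { intros w Hw. pose proof (Cmod_split (f w) (f b) (f x)) as T. rewrite (Cmod_sym (f b)) in T.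
    pose proof (In w ltac:(lra)). pose proof (In x ltac:(lra)). lra. }
  assert (Far : forall p w, (Cmax (p - b) <= t / 4)%R -> Cmax (w - b) = (t / 2)%R ->
    (t / 4 <= Cmod (w - p) <= 3 / 2 * t)%R).
  { intros p w Hp Hw. pose proof (Cmax_split w p b). pose proof (Cmax_split w b p) as K.
    rewrite (Cmax_sym b) in K.
    pose proof (Cmod_le_2Cmax (w - p)). pose proof (Cmax_le_Cmod (w - p)). lra. }
  assert (Shi : (Cmod s <= 32 * S / t)%R).
  { unfold s.
    apply (one_node_box (fun w => f w - f x) b x y (t / 2) (32 * S / t)); auto.
    - intros w Hw. apply holo_minus; [apply Hfb; auto|apply holo_const].
    - ring.
    - lra.
    - intros w Hw. destruct (Far x w Hx Hw) as [F1 F2]. specialize (Fx w Hw).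
      rewrite Cmod_div by (apply Cmod_gt_0; lra). apply Rle_div_l; [lra|].
      eapply Rle_trans; [exact Fx|].
      apply Rle_trans with (32 * S / t * (t / 4))%R; [right; field; lra|].
      apply Rmult_le_compat_l; [apply Rdiv_le_0_compat; lra|lra]. }
  set (u := fun w => f w - f x - s * (w - x)).
  (* Interpolation error of the secant. On the boundary [u] is at most [8 * S + 48 * S] and both
     distances are at least [t / 4]; 896 is 56 times 16. *)
  assert (Ub : forall w, (Cmax (w - b) < t / 2)%R ->
    (Cmod (u w) <= 896 * S / t ^ 2 * (Cmod (w - x) * Cmod (w - y)))%R).
  { intros w Hw. apply (two_nodes_box u b x y w (t / 2)); auto; try lra.
    - intros v Hv. unfold u. apply holo_minus.
      + apply holo_minus; [apply Hfb; auto|apply holo_const].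
      + apply holo_mult; [apply holo_const|]. apply holo_minus; [apply holo_id|apply holo_const].
    - unfold u. ring.
    - unfold u, s. field. now apply Cminus_neq0.
    - clear w Hw. intros w Hw. destruct (Far x w Hx Hw) as [F1 F2], (Far y w Hy Hw) as [F3 F4].
      specialize (Fx w Hw). unfold u. eapply Rle_trans; [apply Cmod_minus_le|]. rewrite Cmod_mult.
      assert (Cmod s * Cmod (w - x) <= 48 * S)%R.
      { apply Rle_trans with (32 * S / t * (3 / 2 * t))%R; [|right; field; lra].
        apply Rmult_le_compat; auto using Cmod_ge_0. }
      apply Rle_trans with (896 * S / t ^ 2 * (t / 4 * (t / 4)))%R.
      + apply Rle_trans with (56 * S)%R; [lra|right; field; lra].
      + apply Rmult_le_compat_l; [apply Rdiv_le_0_compat; [lra|apply pow_lt; lra]|].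
        apply Rmult_le_compat; lra. }
  (* On this square the secant term outweighs the error twofold, so [f w] stays [S / 12000] away
     from [f x] on the boundary. The value [f x + 1] is attained once [S / 12000 - 1 > 1], which is
     where 24000 comes from. *)
  destruct (value_attained_box f x (f x + 1) (t / 6000) (S / 12000 - 1)) as [b' [Hb' Eb']].
  - lra.
  - intros w Hw. apply Hfb. pose proof (Cmax_split w x b). lra.
  - lra.
  - intros w Hw.
    pose proof (Cmax_le_Cmod (w - x)) as L1. pose proof (Cmod_le_2Cmax (w - x)) as L2.
    rewrite Hw in L1, L2.
    assert (L3 : (Cmod (w - y) <= t / 2000)%R).
    { eapply Rle_trans; [apply (Cmod_split w x)|]. rewrite (Cmod_sym x).
      assert (t / (2 * INR n) <= t / 6000)%R.
      { apply Rmult_le_compat_l; [lra|]. apply Rinv_le_contravar; lra. }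
      lra. }
    assert (L4 : (Cmax (w - b) < t / 2)%R) by (pose proof (Cmax_split w x b); lra).
    specialize (Ub w L4).
    assert (L5 : (Cmod (u w) <= S / (2 * t) * Cmod (w - x))%R).
    { eapply Rle_trans; [exact Ub|].
      apply Rle_trans with (896 * S / t ^ 2 * (Cmod (w - x) * (t / 2000)))%R.
      - apply Rmult_le_compat_l; [apply Rdiv_le_0_compat; [lra|apply pow_lt; lra]|].
        apply Rmult_le_compat_l; [apply Cmod_ge_0|exact L3].
      - replace (896 * S / t ^ 2 * (Cmod (w - x) * (t / 2000)))%R
          with (896 / 1000 * (S / (2 * t) * Cmod (w - x)))%R by (field; lra).
        assert (0 <= S / (2 * t) * Cmod (w - x))%R.
        { apply Rmult_le_pos; [apply Rdiv_le_0_compat; lra|apply Cmod_ge_0]. }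
        lra. }
    assert (L6 : (S / t * Cmod (w - x) <= Cmod s * Cmod (w - x))%R).
    { apply Rmult_le_compat_r; [apply Cmod_ge_0|exact Slo]. }
    assert (L7 : (S / 12000 <= S / (2 * t) * Cmod (w - x))%R).
    { apply Rle_trans with (S / (2 * t) * (t / 6000))%R; [right; field; lra|].
      apply Rmult_le_compat_l; [apply Rdiv_le_0_compat; lra|exact L1]. }
    replace (f w - (f x + 1)) with (s * (w - x) - (1 - u w)) by (unfold u; ring).
    eapply Rle_trans; [|apply Cmod_triangle_inv]. rewrite Cmod_mult.
    pose proof (Cmod_minus_le 1 (u w)) as L8. rewrite Cmod_1 in L8.
    replace (S / (2 * t))%R with (S / t / 2)%R in * by (field; lra). lra.
  - replace (f x - (f x + 1)) with (- (1)) by ring. rewrite Cmod_m1. lra.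
  - apply (NG x b'); [| |exact Eb'].
    + pose proof (Cmax_split x b a). unfold t in *. lra.
    + pose proof (Cmax_split b' x a). pose proof (Cmax_split x b a). unfold t in *. lra.
Qed.

(* The linear growth given by [oscillation_bound] makes the interpolation error at the
   nodes 0 and 1, where F agrees with the identity, of order 1 / r. *)
Lemma nearly_identity : exists K, (0 < K)%R /\ forall (F : C -> C) (r : R),
  (4 <= r)%R -> holo_box F 0 r -> F 0 = 0 -> F 1 = 1 ->
  (forall b b', (Cmax b <= r)%R -> (Cmax b' <= r)%R -> (Cmod (b' - b) <= / 2 + / 4)%R -> F b' <> F b + 1) ->
  forall z, (Cmax z < r / 2)%R -> (Cmod (F z - z) <= K / r * (Cmod z * Cmod (z - 1)))%R.
Proof.
  set (D := 24000%R). assert (HD : (D = 24000)%R) by reflexivity.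
  exists (8 * (13 * D + 1))%R. split; [lra|]. intros F r HR HF F0 F1 NG z Hz.
  assert (E0 : forall w, w - 0 = w) by (intros; ring).
  (* Two points of a square of radius 1/6 are at distance at most 2/3, hence within the range 3/4
     where a difference of 1 is excluded; [oscillation_bound] then covers a quarter of that
     radius. *)
  assert (Loc : forall a w, (Cmax a <= r / 2)%R -> (Cmax (w - a) <= / 24)%R -> (Cmod (F w - F a) <= D)%R).
  { intros a w Ha Hw.
    apply (oscillation_bound F a (/ 6)); [lra| | |lra].
    - intros v Hv. apply HF. rewrite E0. replace v with ((v - a) + a) by ring.
      pose proof (Cmax_plus (v - a) a). lra.
    - intros b b' h1 h2.
      pose proof (Cmax_plus (b - a) a) as k1. replace (b - a + a) with b in k1 by ring.
      pose proof (Cmax_plus (b' - a) a) as k2. replace (b' - a + a) with b' in k2 by ring.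
      apply NG; try lra.
      eapply Rle_trans; [apply Cmod_le_2Cmax|].
      pose proof (Cmax_split b' a b) as k3. rewrite (Cmax_sym a) in k3. lra. }
  (* More than [12 * r] equal steps from 0 to [w] have size at most 1/24 each. *)
  assert (Gr : forall w, Cmax w = (r / 2)%R -> (Cmod (F w) <= D * (13 * r))%R).
  { intros w Hw. destruct (nfloor_ex (12 * r)%R ltac:(lra)) as [n [Hn1 Hn2]].
    set (m := Datatypes.S n).
    assert (Hm : (12 * r < INR m <= 13 * r)%R) by (unfold m; rewrite S_INR; lra). clearbody m.
    pose proof (chain_bound (fun j => F ((INR j / INR m)%R * w)) D m) as K. cbv beta in K.
    replace (RtoC (INR m / INR m) * w) with w in K
      by (replace (INR m / INR m)%R with 1%R by (field; lra); ring).
    replace (RtoC (INR 0 / INR m) * w) with (RtoC 0) in K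
      by (replace (INR 0 / INR m)%R with 0%R by (change (INR 0) with 0%R; field; lra); ring).
    rewrite F0, E0 in K. eapply Rle_trans; [apply K|].
    - intros j Hj. apply Loc.
      + apply lt_INR in Hj. pose proof (pos_INR j).
        assert (0 <= INR j / INR m <= 1)%R.
        { split; [apply Rdiv_le_0_compat; lra|apply Rle_div_l; lra]. }
        rewrite Cmax_scal by lra. pose proof (Cmax_ge_0 w). nra.
      + rewrite S_INR. replace ((INR j + 1) / INR m)%R with (1 / INR m + INR j / INR m)%R by (field; lra).
        rewrite RtoC_plus.
        replace ((RtoC (1 / INR m) + RtoC (INR j / INR m)) * w - RtoC (INR j / INR m) * w)
          with (RtoC (1 / INR m) * w) by ring.
        rewrite Cmax_scal by (apply Rdiv_le_0_compat; lra). rewrite Hw.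
        replace (1 / INR m * (r / 2))%R with ((r / 2) / INR m)%R by (field; lra).
        apply Rle_div_l; lra.
    - nra. }
  rewrite <- (E0 z) at 3.
  apply (two_nodes_box (fun w => F w - w) 0 0 1 z (r / 2)).
  - intros w Hw. apply holo_minus; [apply HF; lra|apply holo_id].
  - rewrite F0. ring.
  - rewrite F1. ring.
  - intros e. injection e. lra.
  - rewrite E0, Cmax_0. lra.
  - rewrite E0. pose proof (Cmax_le_Cmod 1). rewrite Cmod_1 in *. lra.
  - now rewrite E0.
  - intros w Hw. rewrite E0 in *. specialize (Gr w Hw).
    pose proof (Cmax_le_Cmod w) as k1. pose proof (Cmod_le_2Cmax w) as k2. rewrite Hw in k1, k2.
    pose proof (Cmod_triangle_inv w 1) as k3. rewrite Cmod_1 in k3.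
    (* The distances to the nodes 0 and 1 are at least [r / 2] and, as [r >= 4], at least [r / 4];
       this accounts for the factor 8 in the constant. *)
    apply Rle_trans with (8 * (13 * D + 1) / r * (r / 2 * (r / 4)))%R.
    + eapply Rle_trans; [apply Cmod_minus_le|].
      replace (8 * (13 * D + 1) / r * (r / 2 * (r / 4)))%R with ((13 * D + 1) * r)%R by (field; lra). lra.
    + apply Rmult_le_compat_l; [apply Rdiv_le_0_compat; lra|]. apply Rmult_le_compat; lra.
Qed.

(** * Self-maps of the half-plane *)

Lemma Re_diff_le (z w : C) : (Re z - Cmod (z - w) <= Re w)%R.
Proof. pose proof (Re_le (z - w)) as H. rewrite Re_minus in H. lra. Qed.

(* The integral over a period does not depend on the height. *)
Lemma periodic_translation (g : C -> C) (X Y a b : R) (d : C) :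
  (forall x y, (X - Rabs a - 1 <= x <= X + Rabs a + 1)%R -> (Y - Rabs b <= y <= Y + Rabs b)%R ->
     holo g (x, y) /\ g ((x + 1)%R, y) = g (x, y)) ->
  (forall x, (X <= x <= X + 1)%R -> g ((x + a)%R, (Y + b)%R) = g (x, Y) + d) ->
  d = 0.
Proof.
  intros Hg Hd. pose proof (Rabs_pos a). pose proof (Rabs_pos b).
  pose proof (Rle_abs a) as a1. pose proof (Rle_abs (- a)) as a2. rewrite Rabs_Ropp in a2.
  pose proof (Rle_abs b) as b1. pose proof (Rle_abs (- b)) as b2. rewrite Rabs_Ropp in b2.
  set (J := fun y => cint (fun x => g (x, y)) X (X + 1)).
  (* Goursat's theorem on a rectangle one period wide: the vertical sides cancel. *)
  assert (G : forall c d', (c <= d')%R -> (Y - Rabs b <= c)%R -> (d' <= Y + Rabs b)%R -> J c = J d').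
  { intros c d' h1 h2 h3.
    assert (Z : contour_int g X (X + 1) c d' = 0).
    { apply goursat; try lra. intros x y k1 k2. apply Hg; lra. }
    unfold contour_int in Z. rewrite (cint_ext (fun y => g ((X + 1)%R, y)) (fun y => g (X, y))) in Z.
    - fold (J c) (J d') in Z.
      replace (J c)
        with (J c - J d' + Ci * (cint (fun y => g (X, y)) c d' - cint (fun y => g (X, y)) c d') + J d')
        by ring.
      rewrite Z. ring.
    - intros y Hy. rewrite Rmin_left, Rmax_right in Hy by lra. apply Hg; lra. }
  assert (E1 : J Y = J (Y + b)%R).
  { destruct (Rle_or_lt 0 b); [apply G; lra|symmetry; apply G; lra]. }
  assert (Ex : forall y u v, (Y - Rabs b <= y <= Y + Rabs b)%R ->
    (X - Rabs a - 1 <= u <= X + Rabs a + 1)%R -> (X - Rabs a - 1 <= v <= X + Rabs a + 1)%R ->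
    ex_cint (fun x => g (x, y)) u v).
  { intros y u v h1 h2 h3. apply ccont_row. intros x Hx. apply holo_ccont. apply Hg; [|lra].
    destruct (Rle_or_lt u v);
      [rewrite Rmin_left, Rmax_right in Hx by lra|rewrite Rmin_right, Rmax_left in Hx by lra]; lra. }
  (* By periodicity, shifting the window by [a] does not change the integral. Integrating the
     hypothesis on [d] over a period then gives [J Y + d = J (Y + b)]. *)
  assert (E2 : cint (fun x => g ((x + a)%R, (Y + b)%R)) X (X + 1) = J (Y + b)%R).
  { rewrite (cint_shift (fun x => g (x, (Y + b)%R)) a X (X + 1)) by (apply Ex; lra).
    rewrite <- (cint_chasles _ (X + a) X), <- (cint_chasles _ X (X + 1) (X + 1 + a)) by (apply Ex; lra).
    replace (cint (fun x => g (x, (Y + b)%R)) (X + 1) (X + 1 + a))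
      with (cint (fun x => g (x, (Y + b)%R)) X (X + a)).
    - fold (J (Y + b)%R).
      rewrite (Cplus_comm (J _)), Cplus_assoc, (cint_chasles _ (X + a) X) by (apply Ex; lra).
      rewrite cint_point. ring.
    - replace (X + 1 + a)%R with (X + a + 1)%R by ring.
      rewrite <- (cint_shift (fun x => g (x, (Y + b)%R)) 1 X (X + a)) by (apply Ex; lra).
      apply cint_ext. intros x Hx. symmetry. apply Hg; [|lra].
      destruct (Rle_or_lt X (X + a));
        [rewrite Rmin_left, Rmax_right in Hx by lra|rewrite Rmin_right, Rmax_left in Hx by lra]; lra. }
  rewrite (cint_ext _ (fun x => g (x, Y) + d)) in E2.
  - rewrite (cint_plus (fun x => g (x, Y)) (fun _ => d)) in E2;
      [|apply Ex; lra|apply ex_cint_const].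
    rewrite cint_const, <- E1 in E2. fold (J Y) in E2.
    apply (f_equal (fun v => v - J Y)) in E2.
    replace (X + 1 - X)%R with 1%R in E2 by ring. ring_simplify in E2. exact E2.
  - intros x Hx. rewrite Rmin_left, Rmax_right in Hx by lra. apply Hd. lra.
Qed.

Section HalfPlane.
Variables Phi k : C -> C.
Hypothesis Phi_holo : forall w, 0 < Re w -> holo Phi w.
Hypothesis Phi_Re : forall w, 0 < Re w -> (Re w <= Re (Phi w))%R.

Lemma displacement_schwarz_pick (a b : C) : 0 < Re a -> 0 < Re b ->
  (Cmod ((Phi a - a) - (Phi b - b)) ^ 2 * (Re a * Re b)
   <= Cmod (a - b) ^ 2 * (Cmod (Phi a - a) * Cmod (Phi b - b)))%R.
Proof.
  intros Ha Hb.
  eapply Rle_trans; [apply (schwarz_pick (fun w => Phi w - w) a b); auto|].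
  - intros w Hw. apply holo_minus; [auto|apply holo_id].
  - intros w Hw. rewrite Re_minus. specialize (Phi_Re w Hw). lra.
  - apply Rmult_le_compat_l; [apply pow2_ge_0|].
    apply Rmult_le_compat; try apply Re_le; rewrite Re_minus;
      [specialize (Phi_Re a Ha)|specialize (Phi_Re b Hb)]; lra.
Qed.

(* [Psi] maps the pair (w, Phi w) to (Psi w, Phi (Psi w)) and contracts hyperbolic distances. *)
Lemma step_commute (Psi : C -> C) (w : C) (s : R) :
  (forall w, 0 < Re w -> holo Psi w) -> (forall w, 0 < Re w -> 0 < Re (Psi w)) ->
  Psi (Phi w) = Phi (Psi w) -> 0 < Re w -> (0 <= s <= / 2)%R ->
  (Cmod (Phi w - w) <= s * Re w)%R ->
  (Cmod (Phi (Psi w) - Psi w) <= 2 * s * Re (Psi w))%R.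
Proof.
  intros Hh Hp Hc Hw Hs HP. pose proof (Phi_Re w Hw) as H1.
  pose proof (schwarz_pick Psi (Phi w) w Hh ltac:(intros v Hv; specialize (Hp v Hv); lra)
    ltac:(lra) Hw) as K.
  rewrite Hc in K. pose proof (Hp w Hw) as H2. pose proof (Phi_Re (Psi w) H2) as H3.
  set (X := Re (Psi w)) in *. set (P := Cmod (Phi (Psi w) - Psi w)) in *.
  assert (PP : (0 <= P)%R) by apply Cmod_ge_0.
  assert (H4 : (Re (Phi (Psi w)) <= X + P)%R).
  { pose proof (Re_le (Phi (Psi w) - Psi w)) as T. rewrite Re_minus in T. fold X P in T. lra. }
  set (r := Re w) in *. set (r' := Re (Phi w)) in *. set (q := Cmod (Phi w - w)) in *.
  assert (0 <= q)%R by apply Cmod_ge_0.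
  (* The unknown step [P] also enters the right side of Schwarz-Pick through the real part of
     [Phi (Psi w)]. The resulting quadratic inequality forces [P <= 2 * s * X] when [s <= / 2]. *)
  assert (Q : (P ^ 2 <= s ^ 2 * (X * (X + P)))%R).
  { apply Rmult_le_reg_r with (r' * r)%R; [nra|].
    eapply Rle_trans; [exact K|].
    apply Rle_trans with ((s * r) ^ 2 * ((X + P) * X))%R.
    - apply Rmult_le_compat; [apply pow2_ge_0|nra|apply pow_incr; lra|].
      apply Rmult_le_compat_r; lra.
    - replace ((s * r) ^ 2 * ((X + P) * X))%R with (s ^ 2 * (X * (X + P)) * (r * r))%R by ring.
      apply Rmult_le_compat_l; [|nra]. apply Rmult_le_pos; [apply pow2_ge_0|nra]. }
  apply Rnot_lt_le. intros C1.
  assert (0 <= s * X)%R by nra.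
  assert (s ^ 2 * (X * P) <= P * P / 4)%R.
  { assert (s * X <= P / 2)%R by lra. assert (s * (s * X) <= / 2 * (P / 2))%R by (apply Rmult_le_compat; lra).
    nra. }
  assert ((s * X) * (s * X) <= P / 2 * (P / 2))%R by (apply Rmult_le_compat; lra).
  assert (0 < P)%R by lra. nra.
Qed.

(** If [Phi a = Phi b], the displacements differ by exactly [b - a], and Schwarz-Pick for the
    displacement would need their product to be at least [Re a * Re b]. *)
Lemma Phi_inj_step (a b : C) : 0 < Re a -> 0 < Re b ->
  (Cmod (Phi a - a) < Re a)%R -> (Cmod (Phi b - b) < Re b)%R -> Phi a = Phi b -> a = b.
Proof.
  intros Ha Hb Pa Pb E. apply NNPP. intros N.
  pose proof (displacement_schwarz_pick a b Ha Hb) as K.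
  replace (Phi a - a - (Phi b - b)) with (b - a) in K by (rewrite E; ring).
  rewrite (Cmod_sym b a) in K. pose proof (Cmod_pos_neq _ _ N) as P.
  assert (Cmod (Phi a - a) * Cmod (Phi b - b) < Re a * Re b)%R.
  { apply Rmult_le_0_lt_compat; auto using Cmod_ge_0. }
  assert (0 < Cmod (a - b) ^ 2)%R by (apply pow_lt; lra). nra.
Qed.

Lemma iter_Phi_Re (n : nat) (w : C) : 0 < Re w -> (Re w <= Re (Nat.iter n Phi w))%R.
Proof.
  intros Hw. induction n; simpl; [lra|].
  assert (0 < Re (Nat.iter n Phi w))%R by lra. specialize (Phi_Re _ H). lra.
Qed.

Lemma iter_Phi_holo (n : nat) (w : C) : 0 < Re w -> holo (Nat.iter n Phi) w.
Proof.
  intros Hw. induction n; simpl; [apply holo_id|].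
  apply (holo_comp Phi (Nat.iter n Phi)); [auto|]. apply Phi_holo.
  pose proof (iter_Phi_Re n w Hw). lra.
Qed.

Lemma iter_comm (A : Type) (f : A -> A) (n : nat) (x : A) : Nat.iter n f (f x) = f (Nat.iter n f x).
Proof. induction n; simpl; congruence. Qed.

Lemma step_iter (n : nat) (w : C) (s : R) : 0 < Re w -> (0 <= s <= / 2)%R ->
  (Cmod (Phi w - w) <= s * Re w)%R ->
  (Cmod (Phi (Nat.iter n Phi w) - Nat.iter n Phi w) <= 2 * s * Re (Nat.iter n Phi w))%R.
Proof.
  intros Hw Hs H. apply (step_commute (Nat.iter n Phi)); auto.
  - intros v Hv. now apply iter_Phi_holo.
  - intros v Hv. pose proof (iter_Phi_Re n v Hv). lra.
  - apply iter_comm.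
Qed.

(** The threshold 1/3 can at most double along the orbit, so every iterate stays in the range of
    [Phi_inj_step]. *)
Definition good (w : C) : Prop := 0 < Re w /\ (Cmod (Phi w - w) <= / 3 * Re w)%R.

Lemma iter_Phi_inj (a b : C) (n : nat) : good a -> good b -> Nat.iter n Phi a = Nat.iter n Phi b -> a = b.
Proof.
  intros [Ha Pa] [Hb Pb]. induction n; [auto|]. simpl. intros E. apply IHn.
  pose proof (iter_Phi_Re n a Ha). pose proof (iter_Phi_Re n b Hb).
  pose proof (step_iter n a (/ 3) Ha ltac:(lra) Pa). pose proof (step_iter n b (/ 3) Hb ltac:(lra) Pb).
  apply Phi_inj_step; auto; lra.
Qed.

(** * The Koenigs function where steps are small *)

Hypothesis k_holo : forall w, 0 < Re w -> holo k w.
Hypothesis k_Phi : forall w, 0 < Re w -> k (Phi w) = k w + 1.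
(** Injectivity on an absorbing domain, expressed through orbits; on the whole half-plane [k] may
    fail to be injective. *)
Hypothesis k_fibre : forall a b, 0 < Re a -> 0 < Re b -> k a = k b ->
  exists n, Nat.iter n Phi a = Nat.iter n Phi b.

Lemma k_inj (a b : C) : good a -> good b -> k a = k b -> a = b.
Proof.
  intros Ha Hb E. destruct (k_fibre a b) as [n Hn]; try apply Ha; try apply Hb; auto.
  now apply iter_Phi_inj with n.
Qed.

Lemma displacement_neq0 (z : C) : 0 < Re z -> Phi z - z <> 0.
Proof.
  intros Hz E. pose proof (k_Phi z Hz) as K. replace (Phi z) with z in K.
  - apply (f_equal (fun v => v - k z)) in K. replace (k z - k z) with (RtoC 0) in K by ring.
    replace (k z + 1 - k z) with (RtoC 1) in K by ring. injection K. lra.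
  - replace (Phi z) with (z + (Phi z - z)) by ring. rewrite E. ring.
Qed.

(** Schwarz-Pick bounds the change of displacement through its unknown value at [w]. A first use
    shows that this value is at most twice the one at [z]; inserting that gives the Lipschitz
    bound. *)
Lemma displacement_near (z w : C) : 0 < Re z -> (Cmod (w - z) <= Re z / 4)%R ->
  0 < Re w /\
  (Cmod ((Phi w - w) - (Phi z - z)) * Re z <= 2 * Cmod (Phi z - z) * Cmod (w - z))%R.
Proof.
  intros Hz D. pose proof (Re_diff_le z w) as Hw. rewrite Cmod_sym in Hw.
  assert (Hw' : (3 / 4 * Re z <= Re w)%R) by lra. split; [lra|].
  pose proof (displacement_schwarz_pick w z ltac:(lra) Hz) as K.
  pose proof (Cmod_triangle_inv (Phi w - w) (Phi z - z)) as T.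
  set (E := Cmod (Phi w - w - (Phi z - z))) in *.
  set (u := Cmod (Phi w - w)) in *. set (v := Cmod (Phi z - z)) in *.
  set (r := Re z) in *. set (d := Cmod (w - z)) in *.
  assert (0 <= E)%R by apply Cmod_ge_0. assert (0 <= u)%R by apply Cmod_ge_0.
  assert (0 <= v)%R by apply Cmod_ge_0. assert (0 <= d)%R by apply Cmod_ge_0.
  assert (K1 : (E ^ 2 * r ^ 2 <= 4 / 3 * d ^ 2 * (u * v))%R).
  { assert (E ^ 2 * (3 / 4 * r * r) <= E ^ 2 * (Re w * r))%R.
    { apply Rmult_le_compat_l; [apply pow2_ge_0|]. apply Rmult_le_compat_r; lra. }
    nra. }
  assert (0 < r ^ 2)%R by (apply pow_lt; lra).
  assert (K2 : (E ^ 2 <= / 12 * (u * v))%R).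
  { assert (d ^ 2 <= (r / 4) ^ 2)%R by (apply pow_incr; lra).
    apply Rmult_le_reg_r with (r ^ 2)%R; [lra|]. eapply Rle_trans; [exact K1|].
    assert (0 <= u * v)%R by nra. nra. }
  assert (K3 : (u <= 2 * v)%R).
  { apply Rnot_lt_le. intros C1. assert (u / 2 <= E)%R by lra.
    assert (u / 2 * (u / 2) <= E * E)%R by (apply Rmult_le_compat; lra).
    assert (0 < u)%R by lra. nra. }
  assert (K4 : ((E * r) ^ 2 <= (2 * v * d) ^ 2)%R).
  { rewrite Rpow_mult_distr. eapply Rle_trans; [exact K1|].
    assert (0 <= d ^ 2)%R by apply pow2_ge_0.
    assert (u * v <= 2 * v * v)%R by nra.
    apply Rle_trans with (4 / 3 * d ^ 2 * (2 * v * v))%R; [apply Rmult_le_compat_l; lra|].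
    replace ((2 * v * d) ^ 2)%R with (4 * (d ^ 2 * (v * v)))%R by ring.
    assert (0 <= d ^ 2 * (v * v))%R by (apply Rmult_le_pos; nra). nra. }
  apply Rnot_lt_le. intros C1.
  assert (0 <= 2 * v * d)%R by (repeat apply Rmult_le_pos; lra). nra.
Qed.

(* [deep R z]: the hyperbolic length of the step from [z] to [Phi z] is of order at most 1 / r. *)
Definition deep (r : R) (z : C) : Prop :=
  0 < Re z /\ (40 * r * Cmod (Phi z - z) <= Re z)%R.

Lemma deep_near (r : R) (z t : C) : (4 <= r)%R -> deep r z -> (Cmax t <= r)%R ->
  let w := z + (Phi z - z) * t in
  good w /\ (Cmod ((Phi w - w) - (Phi z - z)) <= / 10 * Cmod (Phi z - z))%R /\
  (0.95 * Re z <= Re w)%R.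
Proof.
  intros HR [Hz Hd] Ht w. pose proof (Cmod_ge_0 (Phi z - z)) as Pv.
  assert (D : (Cmod (w - z) <= Re z / 20)%R).
  { unfold w. replace (z + (Phi z - z) * t - z) with ((Phi z - z) * t) by ring.
    rewrite Cmod_mult. pose proof (Cmod_le_2Cmax t).
    apply Rle_trans with (Cmod (Phi z - z) * (2 * r))%R; [apply Rmult_le_compat_l; lra|nra]. }
  destruct (displacement_near z w Hz ltac:(lra)) as [Hw K].
  pose proof (Re_diff_le z w) as Hw2. rewrite Cmod_sym in Hw2.
  assert (K2 : (Cmod ((Phi w - w) - (Phi z - z)) <= / 10 * Cmod (Phi z - z))%R).
  { apply Rmult_le_reg_r with (Re z); [lra|]. eapply Rle_trans; [exact K|].
    apply Rle_trans with (2 * Cmod (Phi z - z) * (Re z / 20))%R; [apply Rmult_le_compat_l; lra|nra]. }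
  repeat split; try lra.
  pose proof (Cmod_triangle_inv (Phi w - w) (Phi z - z)).
  assert (160 * Cmod (Phi z - z) <= Re z)%R by nra. lra.
Qed.

Lemma good_Phi (w : C) : 0 < Re w -> (Cmod (Phi w - w) <= / 6 * Re w)%R -> good (Phi w).
Proof.
  intros Hw H. pose proof (Phi_Re w Hw). split; [lra|].
  pose proof (step_iter 1 w (/ 6) Hw ltac:(lra) H) as K. simpl in K. lra.
Qed.

Lemma linearization : exists K, (0 < K)%R /\ forall z r, (4 <= r)%R -> deep r z ->
  forall t, (Cmax t < r / 2)%R ->
  (Cmod (k (z + (Phi z - z) * t) - k z - t) <= K / r * (Cmod t * Cmod (t - 1)))%R.
Proof.
  destruct nearly_identity as [K [HK N]]. exists K. split; [exact HK|].
  intros z r HR Hdeep t Ht. pose proof Hdeep as [Hz Hd].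
  set (P := Phi z - z) in *.
  assert (NP : P <> 0) by now apply displacement_neq0. apply Cmod_gt_0 in NP as PP.
  apply (N (fun t => k (z + P * t) - k z) r HR); [| | | |exact Ht].
  - intros w Hw. replace (w - 0) with w in Hw by ring.
    destruct (deep_near r z w HR Hdeep Hw) as [[G _] _]. fold P in G.
    apply holo_minus; [|apply holo_const].
    apply (holo_comp k (fun t => z + P * t)); [|now apply k_holo].
    apply holo_plus; [apply holo_const|]. apply holo_mult; [apply holo_const|apply holo_id].
  - replace (z + P * 0) with z by ring. ring.
  - replace (z + P * 1) with (Phi z) by (unfold P; ring). rewrite k_Phi by exact Hz. ring.
  (* By injectivity of [k] the second point must be the image under [Phi] of the first, so [b' - b]
     has modulus at least 0.9. This exceeds 3/4, the distance within which [nearly_identity] wants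
     such pairs excluded. *)
  - intros b b' Hb Hb' D E.
    destruct (deep_near r z b HR Hdeep Hb) as [[G1 _] [G2 G3]].
    destruct (deep_near r z b' HR Hdeep Hb') as [G' _].
    fold P in G1, G2, G3, G'. set (w := z + P * b) in *.
    pose proof (Cmod_triangle_inv (Phi w - w) P) as T1.
    pose proof (Cmod_triangle_inv P (Phi w - w)) as T2. rewrite (Cmod_sym P) in T2.
    assert (160 * Cmod P <= Re z)%R by nra.
    assert (Gw : good (Phi w)) by (apply good_Phi; [lra|lra]).
    assert (Ew : z + P * b' = Phi w).
    { apply k_inj; auto. rewrite k_Phi by exact G1.
      apply (f_equal (fun v => v + k z)) in E. ring_simplify in E. rewrite E. unfold w. ring. }
    assert (E2 : P * (b' - b) = Phi w - w) by (rewrite <- Ew; unfold w; ring).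
    apply (f_equal Cmod) in E2. rewrite Cmod_mult in E2.
    assert (Cmod P * Cmod (b' - b) <= Cmod P * (/ 2 + / 4))%R by (apply Rmult_le_compat_l; lra).
    lra.
Qed.

Lemma local_surjectivity (T : R) : (0 <= T)%R -> exists R0 K, (4 <= R0)%R /\ (0 <= K)%R /\
  forall z r, (R0 <= r)%R -> deep r z -> forall v, (Cmod v <= T)%R ->
  exists t, (Cmax t <= r)%R /\ k (z + (Phi z - z) * t) = k z + v /\ (Cmod (t - v) <= K / r)%R.
Proof.
  intros HT. destruct linearization as [K [HK L]].
  set (B := (K * ((T + 2) * (T + 3)))%R).
  assert (HB : (0 < B)%R) by (unfold B; repeat apply Rmult_lt_0_compat; lra).
  (* The terms in [T] place the unit square around [v] inside the range of [linearization]; [4 * B]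
     keeps the deviation from the identity on it below 1/4, so that the value [v] is attained. *)
  exists (2 * T + 5 + 4 * B)%R, B. split; [lra|]. split; [lra|]. intros z r HR Hd v Hv.
  pose proof Hd as [Hz _].
  assert (Bd : forall t, (Cmax (t - v) <= 1)%R -> (Cmax t < r / 2)%R /\
    (Cmod (k (z + (Phi z - z) * t) - k z - t) <= B / r)%R).
  { intros t Ht. pose proof (Cmax_plus (t - v) v) as E1. pose proof (Cmod_triangle (t - v) v) as E2.
    replace (t - v + v) with t in E1, E2 by ring.
    pose proof (Cmod_le_2Cmax (t - v)). pose proof (Cmax_le_Cmod v).
    pose proof (Cmod_minus_le t 1) as E3. rewrite Cmod_1 in E3.
    assert (Ht2 : (Cmax t < r / 2)%R) by lra. split; [exact Ht2|].
    eapply Rle_trans; [apply (L z r); auto; lra|]. unfold B.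
    replace (K * ((T + 2) * (T + 3)) / r)%R with (K / r * ((T + 2) * (T + 3)))%R by (field; lra).
    apply Rmult_le_compat_l; [apply Rdiv_le_0_compat; lra|].
    apply Rmult_le_compat; try apply Cmod_ge_0; lra. }
  assert (HBR : (B / r <= / 4)%R) by (apply Rle_div_l; lra).
  set (F := fun t => k (z + (Phi z - z) * t) - k z).
  destruct (value_attained_box F v v 1 (/ 2)) as [t [Ht E]]; try lra.
  - intros w Hw. destruct (Bd w Hw) as [Hw2 _].
    destruct (deep_near r z w ltac:(lra) Hd ltac:(lra)) as [[G _] _].
    unfold F. apply holo_minus; [|apply holo_const].
    apply (holo_comp k (fun t => z + (Phi z - z) * t)); [|now apply k_holo].
    apply holo_plus; [apply holo_const|]. apply holo_mult; [apply holo_const|apply holo_id].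
  - intros w Hw. destruct (Bd w ltac:(lra)) as [_ Hw2]. fold (F w) in Hw2.
    pose proof (Cmax_le_Cmod (w - v)).
    pose proof (Cmod_triangle_inv (w - v) (w - F w)) as E1.
    replace (w - v - (w - F w)) with (F w - v) in E1 by ring. rewrite (Cmod_sym w (F w)) in E1. 
    unfold F in *. lra.
  - destruct (Bd v) as [_ Hw2]; [|unfold F; lra].
    replace (v - v) with (RtoC 0) by ring. rewrite Cmax_0. lra.
  - destruct (Bd t Ht) as [Ht2 Ht3]. unfold F in E.
    exists t. split; [lra|]. split; [rewrite <- E; ring|].
    rewrite E, Cmod_sym in Ht3. exact Ht3.
Qed.

Lemma centralizer_displacement (Psi : C -> C) (c : C) :
  (forall w, 0 < Re w -> holo Psi w) -> (forall w, 0 < Re w -> 0 < Re (Psi w)) ->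
  (forall w, 0 < Re w -> Psi (Phi w) = Phi (Psi w)) ->
  (forall w, 0 < Re w -> k (Psi w) = k w + c) ->
  exists R0 K, (4 <= R0)%R /\ (0 <= K)%R /\ forall z r, (R0 <= r)%R -> deep r z ->
  (Cmod ((Psi z - z) - c * (Phi z - z)) <= K / r * Cmod (Phi z - z))%R.
Proof.
  intros Hh Hp Hc Hk. destruct (local_surjectivity (Cmod c) (Cmod_ge_0 c)) as [R0 [K [HR0 [HK S]]]].
  exists R0, K. split; [exact HR0|]. split; [exact HK|]. intros z r HR Hd.
  destruct (S z r HR Hd c ltac:(lra)) as [t [Ht [E1 E2]]].
  destruct (deep_near r z t ltac:(lra) Hd Ht) as [G _].
  pose proof Hd as [Hz Hd2].
  assert (Ew : Psi z = z + (Phi z - z) * t).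
  { apply k_inj; auto.
    - split; [auto|].
      assert (160 * Cmod (Phi z - z) <= Re z)%R by (pose proof (Cmod_ge_0 (Phi z - z)); nra).
      pose proof (step_commute Psi z (/ 160) Hh Hp (Hc z Hz) Hz ltac:(lra) ltac:(lra)).
      specialize (Hp z Hz). lra.
    - now rewrite E1, Hk. }
  rewrite Ew. replace (z + (Phi z - z) * t - z - c * (Phi z - z)) with ((t - c) * (Phi z - z)) by ring.
  rewrite Cmod_mult. apply Rmult_le_compat_r; [apply Cmod_ge_0|exact E2].
Qed.

(* The inverse of [k] on good points; an arbitrary value elsewhere. *)
Definition k_inv (s : C) : C := epsilon (inhabits (RtoC 0)) (fun w => good w /\ k w = s).

Lemma k_inv_k (w : C) (s : C) : good w -> k w = s -> k_inv s = w.
Proof.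
  intros G E. assert (Q : good (k_inv s) /\ k (k_inv s) = s).
  { unfold k_inv. apply epsilon_spec. now exists w. }
  destruct Q as [Q1 Q2]. apply k_inj; auto. congruence.
Qed.

Lemma k_inv_holo : exists R0, (4 <= R0)%R /\ forall w r, (R0 <= r)%R -> deep r w -> holo k_inv (k w).
Proof.
  destruct linearization as [K [HK L]].
  (* For [t] in the unit square the deviation from the identity is at most [K / r] times 3 times the
     modulus of [t]; with [12 * K <= r] a quarter of that modulus is lost, which gives [Flo]. *)
  exists (12 * K + 6)%R. split; [lra|]. intros w r HR Hd. pose proof Hd as [Hw _].
  set (P := Phi w - w).
  assert (NP : P <> 0) by now apply displacement_neq0. apply Cmod_gt_0 in NP as PP.
  set (F := fun t => k (w + P * t) - k w).
  assert (Hin : forall t, (Cmax t <= 1)%R -> good (w + P * t)).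
  { intros t Ht. apply (deep_near r w t); auto; lra. }
  assert (Flo : forall t, (Cmax t <= 1)%R -> (3 / 4 * Cmod t <= Cmod (F t))%R).
  { intros t Ht. pose proof (L w r ltac:(lra) Hd t ltac:(lra)) as E. fold P in E. fold (F t) in E.
    pose proof (Cmod_le_2Cmax t). pose proof (Cmod_minus_le t 1) as E3. rewrite Cmod_1 in E3.
    pose proof (Cmod_ge_0 t).
    assert (K / r * (Cmod t * Cmod (t - 1)) <= / 12 * (Cmod t * 3))%R.
    { apply Rmult_le_compat; [apply Rdiv_le_0_compat; lra| |apply Rle_div_l; lra|].
      - apply Rmult_le_pos; auto using Cmod_ge_0.
      - apply Rmult_le_compat_l; lra. }
    pose proof (Cmod_triangle_inv t (t - F t)) as E4.
    replace (t - (t - F t)) with (F t) in E4 by ring. rewrite (Cmod_sym t (F t)) in E4. lra. }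
  assert (HF : forall t, (Cmax t <= 1)%R -> holo F t).
  { intros t Ht. unfold F. apply holo_minus; [|apply holo_const].
    apply (holo_comp k (fun t => w + P * t)); [|now apply k_holo, Hin].
    apply holo_plus; [apply holo_const|]. apply holo_mult; [apply holo_const|apply holo_id]. }
  assert (F0 : F 0 = 0).
  { unfold F. replace (w + P * 0) with w by ring. ring. }
  assert (Gw : good w).
  { replace w with (w + P * 0) by ring. apply Hin. rewrite Cmax_0. lra. }
  assert (Inv : forall s, (Cmod (s - k w) < / 4)%R -> exists t, (Cmax t <= 4 * Cmod (s - k w))%R /\
    F t = s - k w /\ k_inv s = w + P * t).
  { intros s Hs. enough (E : exists t, (Cmax t <= 4 * Cmod (s - k w))%R /\ F t = s - k w).
    { destruct E as [t [E1 E2]]. exists t. split; [exact E1|]. split; [exact E2|].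
      apply k_inv_k; [apply Hin; lra|]. unfold F in E2.
      replace (k (w + P * t)) with (k (w + P * t) - k w + k w) by ring. rewrite E2. ring. }
    destruct (classic (s = k w)) as [->|N].
    { exists 0. rewrite Cmax_0, F0.
      replace (k w - k w) with (RtoC 0) by ring. rewrite Cmod_0. split; [lra|auto]. }
    pose proof (Cmod_pos_neq _ _ N) as Pd. set (d := Cmod (s - k w)) in *.
    (* By [Flo], [F] has modulus at least [3 * d] on the boundary of this square, hence distance at
       least [2 * d] from the target, which lies at distance [d] from [F 0]. *)
    destruct (value_attained_box F 0 (s - k w) (4 * d) (3 / 2 * d)) as [t [Ht E]]; try lra.
    - intros t Ht. apply HF. replace (t - 0) with t in Ht by ring. lra.
    - intros t Ht. replace (t - 0) with t in Ht by ring.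
      pose proof (Flo t ltac:(lra)). pose proof (Cmax_le_Cmod t).
      pose proof (Cmod_triangle_inv (F t) (s - k w)). fold d in H1. lra.
    - rewrite F0. replace (0 - (s - k w)) with (- (s - k w)) by ring. rewrite Cmod_opp. fold d. lra.
    - exists t. replace (t - 0) with t in Ht by ring. auto. }
  assert (Ci : ccont k_inv (k w)).
  { intros e He. exists (Rmin (/ 4) (e / (8 * Cmod P)))%R.
    split; [apply Rmin_pos; [lra|apply Rdiv_lt_0_compat; lra]|]. intros s Hs.
    pose proof (Rmin_l (/ 4) (e / (8 * Cmod P))). pose proof (Rmin_r (/ 4) (e / (8 * Cmod P))).
    destruct (Inv s ltac:(lra)) as [t [E1 [_ E2]]]. rewrite E2, (k_inv_k w) by auto.
    replace (w + P * t - w) with (P * t) by ring. rewrite Cmod_mult.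
    pose proof (Cmod_le_2Cmax t).
    replace e with (Cmod P * (8 * (e / (8 * Cmod P))))%R by (field; lra).
    apply Rmult_lt_compat_l; lra. }
  destruct (HF 0 ltac:(rewrite Cmax_0; lra)) as [q [Hq Eq]].
  assert (Eq' : forall t, F t = q t * t) by (intros t; rewrite Eq, F0; ring).
  assert (Q0 : q 0 <> 0).
  { intros Z. destruct (Hq (/ 2)%R ltac:(lra)) as [del [Hdel Kd]].
    set (m := Rmin (del / 2) 1). assert (0 < m)%R by (apply Rmin_pos; lra).
    pose proof (Rmin_l (del / 2) 1) as m1. pose proof (Rmin_r (del / 2) 1) as m2. fold m in m1, m2.
    assert (Cm : Cmod m = m) by (rewrite Cmod_R; apply Rabs_pos_eq; lra).
    specialize (Kd m). replace (m - 0) with (RtoC m) in Kd by ring. rewrite Cm, Z in Kd.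
    replace (q m - 0) with (q m) in Kd by ring. specialize (Kd ltac:(lra)).
    assert (Cx : (Cmax m <= 1)%R) by (eapply Rle_trans; [apply Cmax_le_Cmod|lra]).
    pose proof (Flo m Cx) as E. rewrite Eq', Cmod_mult, Cm in E. nra. }
  (* With [t = (k_inv s - w) / P] one has [s - k w = q t * t]; solving for [t] exhibits the
     difference quotient of the inverse. *)
  apply (holo_ext_loc (fun s => w + P * / q ((k_inv s - w) / P) * (s - k w)) _ _ (/ 4)); [lra| |].
  - intros s Hs. destruct (Inv s Hs) as [t [E1 [E2 E3]]].
    replace ((k_inv s - w) / P) with t by (rewrite E3; field; exact NP).
    assert (NZ : q t <> 0).
    { intros Z. assert (Ft : F t = 0) by (rewrite Eq', Z; ring).
      pose proof (Flo t ltac:(lra)) as E. rewrite Ft, Cmod_0 in E. pose proof (Cmod_ge_0 t).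
      assert (Cmod t = 0%R) by lra. apply Cmod_eq_0 in H0. rewrite H0 in Z. contradiction. }
    rewrite E3, <- E2, Eq'. field. exact NZ.
  - exists (fun s => P * / q ((k_inv s - w) / P)). split; [|intros s; ring].
    assert (E0 : (k_inv (k w) - w) / P = 0).
    { rewrite (k_inv_k w) by auto. unfold Cdiv. ring. }
    apply ccont_mult; [apply ccont_const|]. apply ccont_inv; [|now rewrite E0].
    apply (ccont_comp q (fun s => (k_inv s - w) / P)); [|now rewrite E0].
    apply ccont_mult; [|apply ccont_const]. apply ccont_plus; [exact Ci|apply ccont_const].
Qed.


Lemma linearizer_coefficient (Psi h : C -> C) (c c1 c2 : C) :
  (forall w, 0 < Re w -> holo Psi w) -> (forall w, 0 < Re w -> 0 < Re (Psi w)) ->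
  (forall w, 0 < Re w -> Psi (Phi w) = Phi (Psi w)) ->
  (forall w, 0 < Re w -> k (Psi w) = k w + c) ->
  (forall r, exists z, deep r z) ->
  (forall w, 0 < Re w -> holo h w) ->
  (forall w, 0 < Re w -> h (Phi w) = h w + c1) ->
  (forall w, 0 < Re w -> h (Psi w) = h w + c2) ->
  c2 = c1 * c.
Proof.
  intros Hh Hp Hc Hk Hdeep hh hPhi hPsi.
  set (a := Re c). set (b := Im c).
  (* Covers all offsets from [k z] that [periodic_translation] visits. *)
  set (T := (Rabs a + 1 + Rabs b)%R).
  assert (HT : (0 <= T)%R) by (unfold T; pose proof (Rabs_pos a); pose proof (Rabs_pos b); lra).
  destruct (local_surjectivity T HT) as [R0 [K [HR0 [_ S]]]].
  destruct k_inv_holo as [R1 [HR1 HI]].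
  (* Passing from [z] to a nearby point costs a factor 1.1 in the displacement and 0.95 in the real
     part; the factor 2 absorbs both and leaves the point deep at level [R1]. *)
  set (r := (R0 + 2 * R1)%R).
  destruct (Hdeep r) as [z Hz].
  assert (Pt : forall v, (Cmod v <= T)%R -> exists w, k w = k z + v /\ deep R1 w /\ good w).
  { intros v Hv. destruct (S z r ltac:(unfold r; lra) Hz v Hv) as [t [Ht [E1 _]]].
    destruct (deep_near r z t ltac:(unfold r; lra) Hz Ht) as [G [D1 D2]].
    set (w := z + (Phi z - z) * t) in *. exists w. split; [exact E1|]. split; [|exact G].
    split; [apply G|]. destruct Hz as [_ Hz2]. unfold r in Hz2.
    pose proof (Cmod_triangle_inv (Phi w - w) (Phi z - z)).
    pose proof (Cmod_ge_0 (Phi z - z)). pose proof (Cmod_ge_0 (Phi w - w)).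
    assert (Cmod (Phi w - w) <= 1.1 * Cmod (Phi z - z))%R by lra.
    assert (80 * R1 * Cmod (Phi z - z) <= Re z)%R by nra.
    assert (40 * R1 * Cmod (Phi w - w) <= 40 * R1 * (1.1 * Cmod (Phi z - z)))%R
      by (apply Rmult_le_compat_l; lra).
    nra. }
  set (g := fun s => h (k_inv s) - c1 * s).
  assert (gw : forall w s, good w -> k w = s -> g s = h w - c1 * s).
  { intros w s G E. unfold g. now rewrite (k_inv_k w s). }
  assert (small : forall w, deep R1 w -> (Cmod (Phi w - w) <= / 160 * Re w)%R).
  { intros w [_ Hd]. pose proof (Cmod_ge_0 (Phi w - w)). nra. }
  assert (D0 : c2 - c1 * c = 0).
  { apply (periodic_translation g (Re (k z)) (Im (k z)) a b).
    - intros x y Hx Hy.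
      destruct (Pt ((x, y) - k z)) as [w [E [Dw G]]].
      { eapply Rle_trans; [apply Cmod_le_abs|]. unfold T, Re, Im in *; simpl in *.
        apply Rplus_le_compat; apply Rabs_le; lra. }
      replace (k z + ((x, y) - k z)) with ((x, y) : C) in E 
        by (apply eq_sym; change (@eq C (k z + ((x, y) - k z)) (x, y)); ring).
      split.
      + unfold g. apply holo_minus; [|apply holo_mult; [apply holo_const|apply holo_id]].
        apply (holo_comp h k_inv); rewrite <- E; [now apply (HI w R1); [lra|]|].
        rewrite (k_inv_k w) by auto. apply hh, G.
      + pose proof (small w Dw). pose proof G as [G1 _].
        assert (GP : good (Phi w)) by (apply good_Phi; lra).
        rewrite (gw (Phi w)); [|exact GP|].
        * rewrite (gw w) by auto. rewrite hPhi by exact G1.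
          replace (((x + 1)%R, y) : C) with ((x, y) + 1)
            by (unfold Cplus; simpl; f_equal; ring).
          ring.
        * rewrite k_Phi, E by exact G1. unfold Cplus; simpl; f_equal; ring.
    - intros x Hx.
      destruct (Pt ((x, Im (k z)) - k z)) as [w [E [Dw G]]].
      { eapply Rle_trans; [apply Cmod_le_abs|]. unfold T, Re, Im in *; simpl in *.
        pose proof (Rabs_pos a). pose proof (Rabs_pos b).
        replace (snd (k z) + - snd (k z))%R with 0%R by ring. rewrite Rabs_R0.
        assert (Rabs (x + - fst (k z)) <= 1)%R by (apply Rabs_le; lra). unfold a, b, Re, Im in *. lra. }
      replace (k z + ((x, Im (k z)) - k z)) with ((x, Im (k z)) : C) in E
        by (apply eq_sym; change (@eq C (k z + ((x, Im (k z)) - k z)) (x, Im (k z))); ring).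
      pose proof (small w Dw). pose proof G as [G1 _].
      assert (GP : good (Psi w)).
      { split; [auto|]. specialize (Hp w G1) as P1.
        pose proof (step_commute Psi w (/ 160) Hh Hp (Hc w G1) G1 ltac:(lra) ltac:(lra)). lra. }
      assert (Ec : (((x + a)%R, (Im (k z) + b)%R) : C) = (x, Im (k z)) + c).
      { unfold a, b, Re, Im, Cplus; simpl. f_equal; ring. }
      rewrite Ec. rewrite (gw (Psi w)), (gw w); auto.
      + rewrite hPsi by exact G1. ring.
      + now rewrite Hk, E. }
  replace c2 with (c2 - c1 * c + c1 * c) by ring. rewrite D0. ring.
Qed.

End HalfPlane.

(** * Transfer to the disc *)

Lemma locally_Cmod (z : C) (P : C -> Prop) :
  @locally C_UniformSpace z P <->
  exists del, (0 < del)%R /\ forall w, Cmod (w - z) < del -> P w.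
Proof.
  split.
  - intros [d Hd]. exists d. split; [apply cond_pos|]. intros w Hw. apply Hd.
    pose proof (Rmax_Cmod (w - z)) as M.
    pose proof (Rmax_l (Rabs (fst (w - z))) (Rabs (snd (w - z)))).
    pose proof (Rmax_r (Rabs (fst (w - z))) (Rabs (snd (w - z)))).
    assert (Rabs (Re (w - z)) < d)%R by (unfold Re; lra). assert (Rabs (Im (w - z)) < d)%R by (unfold Im; lra).
    split; assumption.
  - intros [d [Hd K]]. exists (mkposreal (d / 2) ltac:(lra)). intros w [H1 H2].
    apply K. eapply Rle_lt_trans; [apply Cmod_le_abs|].
    assert (Rabs (Re (w - z)) < d / 2)%R by exact H1.
    assert (Rabs (Im (w - z)) < d / 2)%R by exact H2. lra.
Qed.

Lemma angular_lim_iff (f : C -> C) (tau l : C) :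
  angular_lim f tau l <->
  forall M, (1 < M)%R -> forall eps, (0 < eps)%R -> exists del, (0 < del)%R /\
    forall z, stolz tau M z -> Cmod (z - tau) < del -> Cmod (f z - l) < eps.
Proof.
  split.
  - intros H M HM e He.
    assert (L : @locally C_UniformSpace l (fun v => Cmod (v - l) < e)).
    { apply locally_Cmod. exists e. auto. }
    specialize (H M HM _ L). unfold filtermap, within in H. apply locally_Cmod in H.
    destruct H as [d [Hd K]]. exists d. auto.
  - intros H M HM P HP. apply locally_Cmod in HP. destruct HP as [e [He K]].
    destruct (H M HM e He) as [d [Hd K2]]. unfold filtermap, within. apply locally_Cmod.
    exists d. auto.
Qed.

Section Disc.
Variable tau : C.
Hypothesis Htau : Cmod tau = 1.

Definition toH (z : C) : C := (tau + z) / (tau - z).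
Definition toD (w : C) : C := tau * (w - 1) / (w + 1).

Lemma tau_neq0 : tau <> 0.
Proof. apply Cmod_gt_0. rewrite Htau. lra. Qed.

Lemma tau_minus_neq0 (z : C) : unit_disc z -> tau - z <> 0.
Proof. intros Hz E. unfold unit_disc in Hz. replace z with (tau - (tau - z)) in Hz by ring.
  rewrite E in Hz. replace (tau - 0) with tau in Hz by ring. lra.
Qed.

Lemma succ_neq0 (w : C) : 0 < Re w -> w + 1 <> 0.
Proof. intros Hw E. apply (f_equal Re) in E. rewrite Re_plus in E. unfold Re in *; simpl in E. lra. Qed.

(** The real part of the Cayley transform is the Poisson kernel with pole [tau]. *)
Lemma Re_toH (z : C) : unit_disc z -> (Re (toH z) * Cmod (tau - z) ^ 2 = 1 - Cmod z ^ 2)%R.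
Proof.
  intros Hz. apply tau_minus_neq0 in Hz as N. apply Cmod_gt_0 in N.
  assert (E : (Cmod tau ^ 2 = 1)%R) by (rewrite Htau; ring).
  rewrite Cmod2_alt in *. rewrite Cmod2_alt. rewrite <- E. unfold toH.
  assert (D : (0 < Re (tau - z) ^ 2 + Im (tau - z) ^ 2)%R).
  { rewrite <- Cmod2_alt. now apply pow_lt. }
  destruct tau as [a b], z as [x y]. unfold Cdiv, Cinv, Cplus, Cminus, Cmult, Copp, Re, Im in *; simpl in *.
  field. lra.
Qed.

Lemma toH_Re_pos (z : C) : unit_disc z -> 0 < Re (toH z).
Proof.
  intros Hz. pose proof (Re_toH z Hz) as E. apply tau_minus_neq0 in Hz as N. apply Cmod_gt_0 in N.
  unfold unit_disc in Hz. pose proof (Cmod_ge_0 z).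
  assert (0 < Cmod (tau - z) ^ 2)%R by now apply pow_lt.
  apply Rmult_lt_reg_r with (Cmod (tau - z) ^ 2)%R; [assumption|]. rewrite E. nra.
Qed.

Lemma toH_toD (w : C) : 0 < Re w -> toH (toD w) = w.
Proof.
  intros Hw. pose proof (succ_neq0 w Hw). pose proof tau_neq0. unfold toH, toD.
  assert (E : tau - tau * (w - 1) / (w + 1) = 2 * tau / (w + 1)) by (field; auto).
  assert (T2 : RtoC 2 <> 0) by (intros e; injection e; lra).
  rewrite E. field. auto.
Qed.

Lemma toH_succ (z : C) : unit_disc z -> toH z + 1 = 2 * tau / (tau - z).
Proof. intros Hz. apply tau_minus_neq0 in Hz. unfold toH. field. auto. Qed.

Lemma toD_toH (z : C) : unit_disc z -> toD (toH z) = z.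
Proof.
  intros Hz. apply tau_minus_neq0 in Hz as N. pose proof tau_neq0.
  assert (T2 : RtoC 2 <> 0) by (intros e; injection e; lra).
  unfold toD. rewrite toH_succ by exact Hz. unfold toH. field. auto.
Qed.

Lemma toD_disc (w : C) : 0 < Re w -> unit_disc (toD w).
Proof.
  intros Hw. apply succ_neq0 in Hw as N. unfold unit_disc, toD.
  rewrite Cmod_div, Cmod_mult, Htau by exact N. apply Cmod_gt_0 in N as P.
  apply Rlt_div_l; [exact P|]. rewrite !Rmult_1_l.
  pose proof (Cmod_plus_conj w 1) as E. replace (Cconj 1) with (RtoC 1) in E
    by (unfold Cconj, RtoC; simpl; f_equal; ring).
  replace (Re 1) with 1%R in E by reflexivity.
  pose proof (Cmod_ge_0 (w - 1)). nra.
Qed.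

Lemma toD_holo (w : C) : 0 < Re w -> holo toD w.
Proof.
  intros Hw. unfold toD. apply holo_div; [| |now apply succ_neq0].
  - apply holo_mult; [apply holo_const|]. apply holo_minus; [apply holo_id|apply holo_const].
  - apply holo_plus; [apply holo_id|apply holo_const].
Qed.

Lemma toH_holo (z : C) : unit_disc z -> holo toH z.
Proof.
  intros Hz. unfold toH. apply holo_div; [| |now apply tau_minus_neq0].
  - apply holo_plus; [apply holo_const|apply holo_id].
  - apply holo_minus; [apply holo_const|apply holo_id].
Qed.

Lemma toD_minus (a b : C) : 0 < Re a -> 0 < Re b ->
  toD a - toD b = 2 * tau * (a - b) / ((a + 1) * (b + 1)).
Proof.
  intros Ha Hb. apply succ_neq0 in Ha, Hb. unfold toD. field. auto.
Qed.

Lemma Cmod_toD_minus (a b : C) : 0 < Re a -> 0 < Re b ->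
  (Cmod (toD a - toD b) = 2 * Cmod (a - b) / (Cmod (a + 1) * Cmod (b + 1)))%R.
Proof.
  intros Ha Hb. rewrite toD_minus by auto. apply succ_neq0 in Ha, Hb.
  rewrite Cmod_div by (now apply Cmult_neq_0). rewrite !Cmod_mult, Htau, Cmod_R, Rabs_pos_eq by lra.
  field. split; apply Rgt_not_eq, Cmod_gt_0; auto.
Qed.

(** With [Cmod_toD_minus], this identifies the pseudo-hyperbolic distance of the disc with that of
    the half-plane: the denominators cancel. *)
Lemma Cmod_toD_conj (a b : C) : 0 < Re a -> 0 < Re b ->
  (Cmod (1 - Cconj (toD b) * toD a) = 2 * Cmod (a + Cconj b) / (Cmod (a + 1) * Cmod (b + 1)))%R.
Proof.
  intros Ha Hb. pose proof (toD_disc a Ha) as Da. pose proof (toD_disc b Hb) as Db.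
  assert (Pa := succ_neq0 a Ha). assert (Pb := succ_neq0 b Hb).
  apply Cmod_gt_0 in Pa as Qa. apply Cmod_gt_0 in Pb as Qb.
  assert (Nb : Cconj b + 1 <> 0).
  { apply succ_neq0. exact Hb. }
  assert (Cb : (Cmod (Cconj b + 1) = Cmod (b + 1))%R).
  { rewrite <- Cmod_conj. f_equal. destruct b; unfold Cconj, Cplus; simpl; f_equal; ring. }
  assert (TT : Cconj tau * tau = 1).
  { rewrite Cmult_comm, <- Cmod2_conj, Htau. unfold RtoC; f_equal; ring. }
  assert (E : Cconj (toD b) = Cconj tau * (Cconj b - 1) / (Cconj b + 1)).
  { assert (E2 : toD b * (b + 1) = tau * (b - 1)) by (unfold toD; field; auto).
    apply (f_equal Cconj) in E2.
    assert (CM : forall u v, Cconj (u * v) = Cconj u * Cconj v).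
    { intros [u1 u2] [v1 v2]. unfold Cconj, Cmult; simpl; f_equal; ring. }
    rewrite !CM in E2.
    replace (Cconj (b + 1)) with (Cconj b + 1) in E2
      by (destruct b; unfold Cconj, Cplus; simpl; f_equal; ring).
    replace (Cconj (b - 1)) with (Cconj b - 1) in E2
      by (destruct b; unfold Cconj, Cminus, Cplus, Copp; simpl; f_equal; ring).
    rewrite <- E2. field. exact Nb. }
  rewrite E. unfold toD.
  replace (1 - Cconj tau * (Cconj b - 1) / (Cconj b + 1) * (tau * (a - 1) / (a + 1)))
    with (2 * (a + Cconj b) / ((a + 1) * (Cconj b + 1))).
  - rewrite Cmod_div by (now apply Cmult_neq_0). rewrite !Cmod_mult, Cb, Cmod_R, Rabs_pos_eq by lra.
    reflexivity.
  - replace (Cconj tau * (Cconj b - 1) / (Cconj b + 1) * (tau * (a - 1) / (a + 1)))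
      with ((Cconj tau * tau) * ((Cconj b - 1) * (a - 1) / ((Cconj b + 1) * (a + 1)))) by (field; auto).
    rewrite TT. field. auto.
Qed.

Lemma hyp_dist_step (a b : C) : 0 < Re a -> 0 < Re b ->
  (Cmod (a - b) <= 2 * hyp_dist (toD a) (toD b) * Cmod (a + Cconj b))%R.
Proof.
  intros Ha Hb. unfold hyp_dist.
  assert (Pa := succ_neq0 a Ha). assert (Pb := succ_neq0 b Hb). apply Cmod_gt_0 in Pa, Pb.
  assert (Pc : (0 < Cmod (a + Cconj b))%R).
  { eapply Rlt_le_trans; [|apply Re_le]. rewrite Re_plus. unfold Cconj, Re in *; simpl. lra. }
  assert (N : 1 - Cconj (toD b) * toD a <> 0).
  { apply Cmod_gt_0. rewrite Cmod_toD_conj by auto. apply Rdiv_lt_0_compat; [lra|].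
    now apply Rmult_lt_0_compat. }
  rewrite Cmod_div, Cmod_toD_minus, Cmod_toD_conj by auto.
  set (p := Cmod (a - b)). set (q := Cmod (a + Cconj b)) in *.
  assert (Pp : (0 <= p)%R) by apply Cmod_ge_0.
  assert (Hpq : (p < q)%R).
  { pose proof (Cmod_plus_conj a b) as E. fold p q in E.
    assert (0 < Re a * Re b)%R by now apply Rmult_lt_0_compat. nra. }
  replace (2 * p / (Cmod (a + 1) * Cmod (b + 1)) / (2 * q / (Cmod (a + 1) * Cmod (b + 1))))%R
    with (p / q)%R by (field; repeat split; lra).
  set (t := (p / q)%R).
  assert (Ht : (0 <= t < 1)%R).
  { unfold t. split; [apply Rdiv_le_0_compat; lra|apply Rlt_div_l; lra]. }
  assert (Y : (0 < (1 + t) / (1 - t))%R) by (apply Rdiv_lt_0_compat; lra).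
  (* This is ln y >= 1 - 1/y for y = (1 + t) / (1 - t), whose right side 2t / (1 + t) is at least
     [t]. *)
  pose proof (exp_ineq1_le (- ln ((1 + t) / (1 - t)))) as X.
  rewrite exp_Ropp, exp_ln in X by exact Y.
  replace (/ ((1 + t) / (1 - t)))%R with ((1 - t) / (1 + t))%R in X by (field; lra).
  assert (Z : (t <= 1 - (1 - t) / (1 + t))%R).
  { apply Rmult_le_reg_r with (1 + t)%R; [lra|].
    replace ((1 - (1 - t) / (1 + t)) * (1 + t))%R with (2 * t)%R by (field; lra). nra. }
  replace p with (t * q)%R by (unfold t; field; lra).
  apply Rmult_le_compat_r; lra.
Qed.

Definition conj_H (f : C -> C) (w : C) : C := toH (f (toD w)).

Lemma conj_H_holo (f : C -> C) (w : C) : holomorphic_self_map f -> 0 < Re w -> holo (conj_H f) w.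
Proof.
  intros [Hf Hs] Hw. pose proof (toD_disc w Hw) as D.
  apply (holo_comp toH (fun w => f (toD w))); [|now apply toH_holo, Hs].
  apply (holo_comp f toD); [now apply toD_holo|]. now apply ex_derive_holo, Hf.
Qed.

Lemma conj_H_Re (f : C -> C) (w : C) : holomorphic_self_map f -> 0 < Re w -> 0 < Re (conj_H f w).
Proof. intros [Hf Hs] Hw. apply toH_Re_pos, Hs, toD_disc, Hw. Qed.

Lemma toD_conj_H (f : C -> C) (w : C) : holomorphic_self_map f -> 0 < Re w ->
  toD (conj_H f w) = f (toD w).
Proof. intros [Hf Hs] Hw. apply toD_toH, Hs, toD_disc, Hw. Qed.

Lemma iter_disc (f : C -> C) (n : nat) (z : C) :
  holomorphic_self_map f -> unit_disc z -> unit_disc (Nat.iter n f z).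
Proof. intros [_ Hs] Hz. induction n; simpl; auto. Qed.

Lemma iter_conj_H (f : C -> C) (n : nat) (w : C) : holomorphic_self_map f -> 0 < Re w ->
  Nat.iter n (conj_H f) w = toH (Nat.iter n f (toD w)).
Proof.
  intros Hf Hw. induction n; simpl; [symmetry; now apply toH_toD|].
  rewrite IHn. unfold conj_H. rewrite toD_toH; auto. apply iter_disc; auto using toD_disc.
Qed.

(** The Cayley transform takes a Stolz angle into a sector around the positive axis. *)
Lemma stolz_toH (M : R) (z : C) : stolz tau M z -> (Cmod (toH z + 1) <= 2 * M * Re (toH z))%R.
Proof.
  intros [Hz HM]. pose proof (Re_toH z Hz) as E. pose proof (toH_Re_pos z Hz) as P.
  apply tau_minus_neq0 in Hz as N. rewrite toH_succ by exact Hz.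
  rewrite Cmod_div, Cmod_mult, Htau, Cmod_R, Rabs_pos_eq by (auto; lra).
  apply Cmod_gt_0 in N. set (d := Cmod (tau - z)) in *.
  unfold unit_disc in Hz. pose proof (Cmod_ge_0 z) as Pz. set (r := Cmod z) in *.
  apply Rle_div_l; [exact N|].
  apply Rmult_le_reg_r with d; [exact N|].
  replace (2 * M * Re (toH z) * d * d)%R with (2 * M * (Re (toH z) * d ^ 2))%R by ring.
  rewrite E. nra.
Qed.

(** * Angular derivative 1 at [tau] and small steps in the half-plane *)

Section Parabolic.
Variable phi : C -> C.
Hypothesis phi_self : holomorphic_self_map phi.
Hypothesis phi_deriv : angular_derivative phi tau 1.

Notation Phi := (conj_H phi).

Lemma angular_quotient (z : C) : unit_disc z ->
  (phi z - tau) / (z - tau) * (Phi (toH z) + 1) = toH z + 1.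
Proof.
  intros Hz. unfold conj_H. rewrite toD_toH by exact Hz.
  destruct phi_self as [_ Hs]. rewrite !toH_succ by auto.
  assert (N1 := tau_minus_neq0 z Hz). assert (N2 := tau_minus_neq0 _ (Hs z Hz)).
  assert (N3 : z - tau <> 0).
  { intros E. apply N1. replace (tau - z) with (- (z - tau)) by ring. rewrite E. ring. }
  field. auto.
Qed.

(** The quotient defining the angular derivative is (w + 1) / (Phi w + 1), so its limit 1 makes the
    displacement small compared with [Phi w + 1]; [eps <= / 2] permits replacing this by twice
    [w + 1]. *)
Lemma displacement_angular (M eps : R) : (1 < M)%R -> (0 < eps <= / 2)%R ->
  exists del, (0 < del)%R /\ forall z, stolz tau M z -> Cmod (z - tau) < del ->
  (Cmod (Phi (toH z) - toH z) <= 2 * eps * Cmod (toH z + 1))%R.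
Proof.
  intros HM He. pose proof (proj1 (angular_lim_iff _ _ _) phi_deriv M HM eps ltac:(lra)) as [d [Hd K]].
  exists d. split; [exact Hd|]. intros z Hz Dz. specialize (K z Hz Dz). cbv beta in K.
  pose proof (angular_quotient z (proj1 Hz)) as Q.
  set (q := (phi z - tau) / (z - tau)) in *. set (w := toH z) in *.
  assert (E : Phi w - w = (1 - q) * (Phi w + 1)).
  { replace ((1 - q) * (Phi w + 1)) with (Phi w + 1 - q * (Phi w + 1)) by ring. rewrite Q. ring. }
  pose proof (Cmod_triangle (w + 1) (Phi w - w)) as T.
  replace (w + 1 + (Phi w - w)) with (Phi w + 1) in T by ring.
  rewrite E in *. rewrite Cmod_mult in *. rewrite (Cmod_sym 1 q) in *.
  pose proof (Cmod_ge_0 (Phi w + 1)). pose proof (Cmod_ge_0 (q - 1)).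
  assert (Cmod (q - 1) * Cmod (Phi w + 1) <= eps * Cmod (Phi w + 1))%R by (apply Rmult_le_compat_r; lra).
  assert (eps * Cmod (Phi w + 1) <= / 2 * Cmod (Phi w + 1))%R by (apply Rmult_le_compat_r; lra).
  assert (Cmod (Phi w + 1) <= 2 * Cmod (w + 1))%R by lra.
  assert (eps * Cmod (Phi w + 1) <= eps * (2 * Cmod (w + 1)))%R by (apply Rmult_le_compat_l; lra).
  lra.
Qed.

Lemma toD_real (x : R) : (1 < x)%R ->
  stolz tau 2 (toD x) /\ (Cmod (toD x - tau) <= 2 / x)%R.
Proof.
  intros Hx.
  assert (Hre : 0 < Re x) by (unfold Re; simpl; lra).
  pose proof (succ_neq0 x Hre) as N.
  assert (E1 : toD x - tau = - (tau * (2 / (x + 1)))) by (unfold toD; field; auto).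
  assert (C2 : Cmod (2 / (x + 1)) = (2 / (x + 1))%R).
  { rewrite <- RtoC_plus, <- RtoC_div by lra. rewrite Cmod_R. apply Rabs_pos_eq.
    apply Rdiv_le_0_compat; lra. }
  assert (D : (Cmod (toD x - tau) = 2 / (x + 1))%R).
  { rewrite E1, Cmod_opp, Cmod_mult, Htau, C2. ring. }
  assert (E2 : (Cmod (toD x) = (x - 1) / (x + 1))%R).
  { unfold toD. rewrite Cmod_div, Cmod_mult, Htau by exact N.
    rewrite <- RtoC_plus, <- RtoC_minus, !Cmod_R, !Rabs_pos_eq by lra. field. lra. }
  split; [split|].
  - now apply toD_disc.
  - rewrite Cmod_sym, D, E2. apply Rmult_lt_reg_r with (x + 1)%R; [lra|].
    replace (2 / (x + 1) * (x + 1))%R with 2%R by (field; lra).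
    replace (2 * (1 - (x - 1) / (x + 1)) * (x + 1))%R with 4%R by (field; lra). lra.
  - rewrite D. apply Rmult_le_compat_l; [lra|]. apply Rinv_le_contravar; lra.
Qed.

(* Julia's lemma: let the first point of the Schwarz-Pick inequality tend to infinity
   along the real axis. *)
Lemma Phi_Re_incr (w : C) : 0 < Re w -> (Re w <= Re (Phi w))%R.
Proof.
  intros Hw. pose proof (conj_H_Re phi w phi_self Hw) as Hv.
  set (u := Re w) in *. set (v := Re (Phi w)) in *.
  apply le_epsilon. intros e He.
  (* The limit inequality will read [(1 - 4 * eta) * u <= (1 + 7 * eta) * v], so [eta] must make
     [4 * eta * u + 7 * eta * v] at most [e]. *)
  set (eta := Rmin (/ 4) (e / (8 * u + 8 * v))).
  assert (Het : 0 < eta) by (apply Rmin_pos; [lra|apply Rdiv_lt_0_compat; lra]).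
  pose proof (Rmin_l (/ 4) (e / (8 * u + 8 * v))) as e1.
  pose proof (Rmin_r (/ 4) (e / (8 * u + 8 * v))) as e2. fold eta in e1, e2.
  assert (e3 : (eta * (8 * u + 8 * v) <= e)%R).
  { replace e with (e / (8 * u + 8 * v) * (8 * u + 8 * v))%R by (field; lra).
    apply Rmult_le_compat_r; lra. }
  clearbody eta.
  destruct (displacement_angular 2 (eta / 4) ltac:(lra) ltac:(lra)) as [d [Hd K]].
  pose proof (Cmod_ge_0 w) as Pw. pose proof (Cmod_ge_0 (Phi w)) as Pv.
  (* Large enough for [toD x] to be within [d] of [tau], and for [w] and [Phi w] to be negligible
     against [eta * x]. *)
  set (x := (2 + 3 / d + (Cmod w + Cmod (Phi w) + 1) / eta)%R).
  assert (x1 : (0 <= 3 / d)%R) by (apply Rdiv_le_0_compat; lra).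
  assert (x2 : (0 <= (Cmod w + Cmod (Phi w) + 1) / eta)%R) by (apply Rdiv_le_0_compat; lra).
  assert (Hx : (2 <= x)%R) by (unfold x; lra).
  assert (xd : (3 <= x * d)%R).
  { apply Rle_trans with (3 / d * d)%R; [right; field; lra|]. apply Rmult_le_compat_r; unfold x; lra. }
  assert (xe : (Cmod w + Cmod (Phi w) + 1 <= x * eta)%R).
  { apply Rle_trans with ((Cmod w + Cmod (Phi w) + 1) / eta * eta)%R; [right; field; lra|].
    apply Rmult_le_compat_r; unfold x; lra. }
  clearbody x.
  assert (Hre : 0 < Re x) by (unfold Re; simpl; lra).
  destruct (toD_real x ltac:(lra)) as [S1 S2].
  assert (Dx : (Cmod (toD x - tau) < d)%R).
  { eapply Rle_lt_trans; [exact S2|]. apply Rlt_div_l; lra. }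
  specialize (K (toD x) S1 Dx). rewrite toH_toD in K by exact Hre.
  rewrite <- RtoC_plus, Cmod_R, Rabs_pos_eq in K by lra.
  assert (K' : (Cmod (Phi x - x) <= eta * x)%R) by nra.
  pose proof (schwarz_pick Phi x w (fun v Hv => conj_H_holo phi v phi_self Hv)
    (fun v Hv => Rlt_le _ _ (conj_H_Re phi v phi_self Hv)) Hre Hw) as SP.
  fold u v in SP. replace (Re x) with x in SP by reflexivity.
  assert (A1 : (x * (1 - 2 * eta) <= Cmod (Phi x - Phi w))%R).
  { pose proof (Cmod_split x (Phi x) 0) as T1. replace (x - 0) with (RtoC x) in T1 by ring.
    rewrite Cmod_R, Rabs_pos_eq in T1 by lra. replace (Phi x - 0) with (Phi x) in T1 by ring.
    rewrite (Cmod_sym x) in T1.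
    pose proof (Cmod_triangle_inv (Phi x) (Phi w)). lra. }
  assert (A2 : (Cmod (x - w) <= x * (1 + eta))%R).
  { pose proof (Cmod_minus_le x w) as T1. rewrite Cmod_R, Rabs_pos_eq in T1 by lra. lra. }
  assert (A3 : (Re (Phi x) <= x * (1 + eta))%R).
  { pose proof (Re_le (Phi x - x)) as T1. rewrite Re_minus in T1.
    replace (Re x) with x in T1 by reflexivity. lra. }
  assert (B1 : ((x * (1 - 2 * eta)) ^ 2 * (x * u) <= (x * (1 + eta)) ^ 2 * (x * (1 + eta) * v))%R).
  { eapply Rle_trans; [|eapply Rle_trans; [exact SP|]].
    - apply Rmult_le_compat_r; [nra|]. apply pow_incr. split; [nra|lra].
    - pose proof (conj_H_Re phi x phi_self Hre).
      apply Rmult_le_compat; [apply pow2_ge_0|nra|apply pow_incr; split; [apply Cmod_ge_0|lra]|].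
      apply Rmult_le_compat_r; lra. }
  assert (B2 : ((1 - 2 * eta) ^ 2 * u <= (1 + eta) ^ 3 * v)%R).
  { assert (0 < x ^ 3)%R by (apply pow_lt; lra).
    apply Rmult_le_reg_l with (x ^ 3)%R; [assumption|].
    replace (x ^ 3 * ((1 - 2 * eta) ^ 2 * u))%R with ((x * (1 - 2 * eta)) ^ 2 * (x * u))%R by ring.
    replace (x ^ 3 * ((1 + eta) ^ 3 * v))%R with ((x * (1 + eta)) ^ 2 * (x * (1 + eta) * v))%R by ring.
    exact B1. }
  assert (C1 : ((1 - 4 * eta) * u <= (1 - 2 * eta) ^ 2 * u)%R) by (apply Rmult_le_compat_r; nra).
  assert (C2 : ((1 + eta) ^ 3 * v <= (1 + 7 * eta) * v)%R) by (apply Rmult_le_compat_r; nra).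
  nra.
Qed.

Lemma deep_stolz (M r : R) : (1 < M)%R -> (1 <= r)%R ->
  exists del, (0 < del)%R /\ forall z, stolz tau M z -> Cmod (z - tau) < del -> deep Phi r (toH z).
Proof.
  (* 40 from [deep], 2 from [displacement_angular] and [2 * M] from the sector multiply to
     [160 * M]. *)
  intros HM Hr. set (eps := (/ (160 * M * r))%R).
  assert (Hp : (0 < 160 * M * r)%R) by (repeat apply Rmult_lt_0_compat; lra).
  assert (E1 : (160 * M * r * eps = 1)%R) by (unfold eps; field; lra).
  assert (E0 : (0 < eps)%R) by now apply Rinv_0_lt_compat.
  destruct (displacement_angular M eps HM) as [d [Hd K]].
  { split; [exact E0|]. assert (160 <= 160 * M * r)%R by nra. nra. }
  exists d. split; [exact Hd|]. intros z Hz Dz. pose proof (toH_Re_pos z (proj1 Hz)) as P.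
  split; [exact P|]. specialize (K z Hz Dz). pose proof (stolz_toH M z Hz) as L.
  set (w := toH z) in *.
  apply Rle_trans with (40 * r * (2 * eps * (2 * M * Re w)))%R.
  - apply Rmult_le_compat_l; [lra|]. eapply Rle_trans; [exact K|]. apply Rmult_le_compat_l; lra.
  - right. replace (40 * r * (2 * eps * (2 * M * Re w)))%R with (160 * M * r * eps * Re w)%R by ring.
    rewrite E1. ring.
Qed.

Lemma deep_zero_step (r : R) : zero_hyperbolic_step phi -> (1 <= r)%R -> exists w, deep Phi r w.
Proof.
  intros [z [Hz L]] Hr. apply is_lim_seq_spec in L.
  assert (He : (0 < / (640 * r))%R) by (apply Rinv_0_lt_compat; lra).
  destruct (L (mkposreal _ He)) as [n Hn]. specialize (Hn n (Nat.le_refl n)). simpl in Hn.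
  set (zn := Nat.iter n phi z) in *.
  assert (Dn : unit_disc zn) by now apply iter_disc.
  set (w := toH zn). assert (Hw : 0 < Re w) by now apply toH_Re_pos.
  assert (Ez : toD w = zn) by now apply toD_toH.
  assert (Ez' : toD (Phi w) = phi zn) by (rewrite toD_conj_H, Ez; auto).
  exists w. split; [exact Hw|].
  pose proof (conj_H_Re phi w phi_self Hw) as Hw'.
  pose proof (hyp_dist_step w (Phi w) Hw Hw') as K. rewrite Ez, Ez' in K.
  set (h := hyp_dist zn (phi zn)) in *. replace (h - 0)%R with h in Hn by ring.
  pose proof (Rle_abs h).
  set (P := Cmod (Phi w - w)) in *. rewrite Cmod_sym in K. fold P in K.
  (* The denominator of the pseudo-hyperbolic distance exceeds [2 * Re w] by at most the step [P]
     itself, which the small hyperbolic step allows to be absorbed on the left. *)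
  assert (T : (Cmod (w + Cconj (Phi w)) <= 2 * Re w + P)%R).
  { replace (w + Cconj (Phi w)) with (RtoC (2 * Re w) + Cconj (Phi w - w)).
    - eapply Rle_trans; [apply Cmod_triangle|]. rewrite Cmod_conj, Cmod_R, Rabs_pos_eq by lra.
      unfold P. lra.
    - destruct w as [a b], (Phi (a, b)) as [a' b'].
      unfold Cconj, RtoC, Re, Cplus, Cminus, Copp; simpl. f_equal; ring. }
  pose proof (Cmod_ge_0 (w + Cconj (Phi w))). assert (0 <= P)%R by apply Cmod_ge_0.
  assert (X : (P <= 2 * / (640 * r) * (2 * Re w + P))%R).
  { eapply Rle_trans; [exact K|]. apply Rle_trans with (2 * / (640 * r) * Cmod (w + Cconj (Phi w)))%R.
    - apply Rmult_le_compat_r; lra.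
    - apply Rmult_le_compat_l; lra. }
  assert (Y : (320 * r * P <= 2 * Re w + P)%R).
  { apply Rle_trans with (320 * r * (2 * / (640 * r) * (2 * Re w + P)))%R.
    - apply Rmult_le_compat_l; lra.
    - right. field. lra. }
  assert (P <= r * P)%R by nra. lra.
Qed.

(** * The Koenigs function carried to the half-plane, and both statements *)

Section Koenigs.
Variable hphi : C -> C.
Hypothesis Hk : is_koenigs phi hphi.

Definition koenigs_H (w : C) : C := hphi (toD w).

Lemma holo_toD_comp (h : C -> C) (w : C) : holomorphic_on unit_disc h -> 0 < Re w ->
  holo (fun w => h (toD w)) w.
Proof.
  intros Hh Hw. apply (holo_comp h toD); [now apply toD_holo|].
  apply ex_derive_holo, Hh, toD_disc, Hw.
Qed.

Lemma koenigs_H_Phi (w : C) : 0 < Re w -> koenigs_H (Phi w) = koenigs_H w + 1.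
Proof.
  intros Hw. unfold koenigs_H. rewrite toD_conj_H by auto.
  destruct Hk as [_ [_ [E _]]]. apply E, toD_disc, Hw.
Qed.

(** After [n1 + n2] iterations both orbits lie in the forward invariant domain [V]; the values of
    the Koenigs function are still equal there, and it is injective on [V]. *)
Lemma koenigs_H_fibre (a b : C) : 0 < Re a -> 0 < Re b -> koenigs_H a = koenigs_H b ->
  exists n, Nat.iter n Phi a = Nat.iter n Phi b.
Proof.
  intros Ha Hb E. destruct Hk as [_ [_ [Hphi [_ [V [[_ [HVD [HV Habs]]] Hinj]]]]]].
  assert (Da := toD_disc a Ha). assert (Db := toD_disc b Hb).
  destruct (Habs _ Da) as [n1 V1]. destruct (Habs _ Db) as [n2 V2].
  assert (VA : forall m z, V z -> V (Nat.iter m phi z)) by (induction m; simpl; auto).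
  assert (HI : forall m z, unit_disc z -> hphi (Nat.iter m phi z) = hphi z + INR m).
  { intros m z Hz. induction m.
    - simpl. ring.
    - rewrite S_INR, RtoC_plus. change (Nat.iter (S m) phi z) with (phi (Nat.iter m phi z)).
      rewrite Hphi by now apply iter_disc. rewrite IHm. ring. }
  exists (n1 + n2)%nat. rewrite !iter_conj_H by auto. f_equal. apply Hinj.
  - rewrite Nat.add_comm, Nat.iter_add. now apply VA.
  - rewrite Nat.iter_add. now apply VA.
  - rewrite !HI by auto. unfold koenigs_H in E. now rewrite E.
Qed.

Lemma koenigs_linearizer_pair (psi h : C -> C) (c c1 c2 : C) :
  zero_hyperbolic_step phi -> centralizer phi psi -> is_linearization_coeff hphi psi c ->
  holomorphic_on unit_disc h ->
  (forall z, unit_disc z -> h (phi z) = h z + c1) ->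
  (forall z, unit_disc z -> h (psi z) = h z + c2) ->
  c2 = c1 * c.
Proof.
  intros Hz [psi_self Hcomm] Hc Hh H1 H2.
  apply (linearizer_coefficient Phi koenigs_H (fun w Hw => conj_H_holo phi w phi_self Hw) Phi_Re_incr
    (fun w Hw => holo_toD_comp hphi w (proj1 Hk) Hw) koenigs_H_Phi koenigs_H_fibre
    (conj_H psi) (fun w => h (toD w))).
  - intros w Hw. now apply conj_H_holo.
  - intros w Hw. now apply conj_H_Re.
  - intros w Hw. unfold conj_H at 1 3. rewrite !toD_conj_H by auto. f_equal. apply Hcomm, toD_disc, Hw.
  - intros w Hw. unfold koenigs_H. rewrite toD_conj_H by auto. apply Hc, toD_disc, Hw.
  - intros r. destruct (deep_zero_step (Rmax r 1) Hz (Rmax_r _ _)) as [w [G1 G2]].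
    exists w. split; [exact G1|]. eapply Rle_trans; [|exact G2].
    apply Rmult_le_compat_r; [apply Cmod_ge_0|]. pose proof (Rmax_l r 1). lra.
  - intros w Hw. now apply holo_toD_comp.
  - intros w Hw. rewrite toD_conj_H by auto. apply H1, toD_disc, Hw.
  - intros w Hw. rewrite toD_conj_H by auto. apply H2, toD_disc, Hw.
Qed.

Lemma centralizer_angular_lim (psi : C -> C) (c : C) :
  centralizer phi psi -> is_linearization_coeff hphi psi c ->
  angular_lim (fun z => (psi z - z) / (phi z - z)) tau c.
Proof.
  intros [psi_self Hcomm] Hc. apply angular_lim_iff. intros M HM e He.
  destruct (centralizer_displacement Phi koenigs_H (fun w Hw => conj_H_holo phi w phi_self Hw) Phi_Re_incr
    (fun w Hw => holo_toD_comp hphi w (proj1 Hk) Hw) koenigs_H_Phi koenigs_H_fibre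
    (conj_H psi) c) as [r0 [K [Hr0 [HK L]]]].
  - intros w Hw. now apply conj_H_holo.
  - intros w Hw. now apply conj_H_Re.
  - intros w Hw. unfold conj_H at 1 3. rewrite !toD_conj_H by auto. f_equal. apply Hcomm, toD_disc, Hw.
  - intros w Hw. unfold koenigs_H. rewrite toD_conj_H by auto. apply Hc, toD_disc, Hw.
  - pose proof (Cmod_ge_0 c) as Pc.
    (* [U] bounds the quotient [u] of the half-plane displacements, and [B / r] the whole error:
       [K / r] in the half-plane, the rest from returning to the disc. *)
    set (U := (Cmod c + K)%R). assert (HU : (0 <= U)%R) by (unfold U; lra).
    set (B := (K + U * (1 + U))%R). assert (HB : (0 <= B)%R) by (unfold B; nra).
    set (r := (r0 + U + 2 * B / e)%R).
    assert (HBe : (0 <= 2 * B / e)%R) by (apply Rdiv_le_0_compat; lra).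
    destruct (deep_stolz M r HM ltac:(unfold r; lra)) as [d [Hd D]].
    exists d. split; [exact Hd|]. intros z Hz Dz. specialize (D z Hz Dz). destruct Hz as [Hz _].
    set (w := toH z) in *. specialize (L w r ltac:(unfold r; lra) D). destruct D as [Hw D].
    assert (Ez : toD w = z) by now apply toD_toH.
    pose proof (displacement_neq0 Phi koenigs_H koenigs_H_Phi w Hw) as NP.
    pose proof (conj_H_Re phi w phi_self Hw) as HP. pose proof (conj_H_Re psi w psi_self Hw) as HS.
    replace (phi z) with (toD (Phi w)) by (rewrite toD_conj_H, Ez; auto).
    replace (psi z) with (toD (conj_H psi w)) by (rewrite toD_conj_H, Ez; auto).
    rewrite <- Ez. rewrite !toD_minus by auto.
    set (P := Phi w - w) in *. set (Psw := conj_H psi w) in *.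
    set (u := (Psw - w) / P).
    assert (Eu : Psw - w = u * P) by (unfold u; field; exact NP).
    rewrite Eu in L. replace (u * P - c * P) with ((u - c) * P) in L by ring. rewrite Cmod_mult in L.
    apply Cmod_gt_0 in NP as PP.
    assert (Hr : (4 <= r)%R) by (unfold r; lra).
    assert (Lu : (Cmod (u - c) <= K / r)%R).
    { apply Rmult_le_reg_r with (Cmod P); [exact PP|]. exact L. }
    assert (LU : (Cmod u <= U)%R).
    { pose proof (Cmod_triangle_inv u c). assert (K / r <= K)%R by (apply Rle_div_l; nra). unfold U. lra. }
    assert (N1 := succ_neq0 w Hw). assert (N2 := succ_neq0 _ HP). assert (N3 := succ_neq0 _ HS).
    fold Psw in N3.
    pose proof tau_neq0 as Nt. assert (T2 : RtoC 2 <> 0) by (intros e'; injection e'; lra).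
    (* In the disc the quotient is [u * (Phi w + 1) / (Psw + 1)], and the two numerators [Phi w + 1]
       and [Psw + 1] differ by [(1 - u) * P]. *)
    replace (2 * tau * (Psw - w) / ((Psw + 1) * (w + 1)) / (2 * tau * P / ((Phi w + 1) * (w + 1))) - c)
      with ((u - c) + u * ((1 - u) * P / (Psw + 1))).
    2: { replace ((1 - u) * P) with ((Phi w + 1) - (Psw + 1)).
         - rewrite Eu. field. repeat split; auto.
         - replace ((1 - u) * P) with (P - u * P) by ring. rewrite <- Eu. unfold P. ring. }
    (* [Psw] differs from [w] by at most [r * Cmod P], hence by at most [Re w / 40]. *)
    assert (LP : (Re w / 2 <= Cmod (Psw + 1))%R).
    { apply Rle_trans with (Re (Psw + 1)); [|apply Re_le]. rewrite Re_plus.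
      replace (Re 1) with 1%R by reflexivity.
      pose proof (Re_diff_le w Psw) as T. rewrite Cmod_sym, Eu, Cmod_mult in T.
      assert (Cmod u * Cmod P <= r * Cmod P)%R by (apply Rmult_le_compat_r; unfold r; lra). lra. }
    eapply Rle_lt_trans; [apply Cmod_triangle|]. rewrite Cmod_mult, Cmod_div, Cmod_mult by exact N3.
    assert (L1 : (Cmod (1 - u) <= 1 + U)%R).
    { pose proof (Cmod_minus_le 1 u) as T. rewrite Cmod_1 in T. lra. }
    assert (L2 : (Cmod (1 - u) * Cmod P / Cmod (Psw + 1) <= (1 + U) / r)%R).
    { apply Rle_div_l; [lra|].
      apply Rle_trans with ((1 + U) / r * (20 * r * Cmod P))%R.
      - replace ((1 + U) / r * (20 * r * Cmod P))%R with (20 * ((1 + U) * Cmod P))%R by (field; lra).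
        assert (Cmod (1 - u) * Cmod P <= (1 + U) * Cmod P)%R by (apply Rmult_le_compat_r; lra).
        assert (0 <= (1 + U) * Cmod P)%R by nra. lra.
      - apply Rmult_le_compat_l; [apply Rdiv_le_0_compat; lra|]. lra. }
    assert (L3 : (Cmod u * (Cmod (1 - u) * Cmod P / Cmod (Psw + 1)) <= U * ((1 + U) / r))%R).
    { apply Rmult_le_compat; [apply Cmod_ge_0| |exact LU|exact L2].
      apply Rdiv_le_0_compat; [apply Rmult_le_pos; apply Cmod_ge_0|lra]. }
    apply Rle_lt_trans with (B / r)%R.
    { unfold B. replace ((K + U * (1 + U)) / r)%R with (K / r + U * ((1 + U) / r))%R by (field; lra). lra. }
    apply Rlt_div_l; [lra|].
    assert (2 * B + 4 * e <= e * r)%R; [|lra].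
    unfold r. replace (e * (r0 + U + 2 * B / e))%R with (2 * B + e * r0 + e * U)%R by (field; lra). nra.
Qed.

End Koenigs.
End Parabolic.
End Disc.

Local Close Scope C_scope.

Theorem theorem5p1 :
  forall (phi psi hphi : C -> C) (tau c : C),
    parabolic phi tau ->
    zero_hyperbolic_step phi ->
    is_koenigs phi hphi ->
    centralizer phi psi ->
    is_linearization_coeff hphi psi c ->
    angular_lim (fun z : C => ((psi z - z) / (phi z - z))%C) tau c
    /\
    (forall (h : C -> C) (c1 c2 : C),
       holomorphic_on unit_disc h ->
       (forall z : C, unit_disc z -> h (phi z) = (h z + c1)%C) ->
       (forall z : C, unit_disc z -> h (psi z) = (h z + c2)%C) ->
       (Cmod c1 ^ 2 + Cmod c2 ^ 2 <> 0)%R ->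
       c1 <> RtoC 0 /\ (c2 / c1)%C = c).
Proof.
  intros phi psi hphi tau c [Hphi [Htau [_ Hder]]] Hzero Hk Hpsi Hc. split.
  - now apply (centralizer_angular_lim tau Htau phi Hphi Hder hphi).
  - intros h c1 c2 Hh H1 H2 H0.
    assert (E : c2 = (c1 * c)%C).
    { now apply (koenigs_linearizer_pair tau Htau phi Hphi Hder hphi Hk psi h). }
    assert (N : c1 <> RtoC 0).
    { intros ->. rewrite E, Cmult_0_l, Cmod_0 in H0. apply H0. ring. }
    split; [exact N|]. rewrite E. field. exact N.
Qed.
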